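(* Suppose that $0\le y\le 1$, $\varepsilon\ge 0$ and $0<y+\varepsilon\le 1$, and let $S(y,\varepsilon)\subseteq\mathbb{R}^3$, $SC(S^1)$ and $\mathcal{G}$ be the spaces described in the context. Then the following assertions hold: (1) For every $1/2<y\le 1$, the spaces $S(1,0)$ and $S(y,\varepsilon)$ are contractible. (2) For $y=0$, the space $S(y,\varepsilon)$ is homotopy equivalent to $SC(S^1)$. (3) For every $0<y\le 1/2$, the space $S(y,\varepsilon)$ is homotopy equivalent to the space $\mathcal{G}$.
   Context: $\mathbb{I}=[0,1]$ and $\mathbb{I}^2=\mathbb{I}\times\mathbb{I}\subset\mathbb{R}^2$, where $\mathbb{R}^2$ is regarded as $\mathbb{R}^2\times\{0\}\subset\mathbb{R}^3$. The space $S(y,\varepsilon)$: for $0\le y\le 1$ and $\varepsilon\ge 0$ with $0<y+\varepsilon\le 1$, consider for every integer $n\ge 1$ the points of $\mathbb{R}^3$ $A_n=\left(\frac{1}{2n-1},0,0\right)$, $B_n=\left(\frac{1}{2n},1,0\right)$, $C_n=\left(\frac{1}{2n-1},\,y+\frac{\varepsilon}{2n-1},\,0\right)$, $D_n=\left(\frac{1}{2n},\,1-y-\frac{\varepsilon}{2n},\,0\right)$, $\overline{E}_n=\left(\frac{1}{2n-1},\,\frac12\left(y+\frac{\varepsilon}{2n-1}\right),\,\frac{1}{2(2n-1)}\right)$, $\overline{F}_n=\left(\frac{1}{2n},\,\frac12\left(2-y-\frac{\varepsilon}{2n}\right),\,\frac{1}{4n}\right)$. Let $H_{2n-1}$ be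 the convex hull of $A_n,B_n,C_n,D_n,\overline{E}_n,\overline{F}_n$ and let $H_{2n}$ be the convex hull of $A_{n+1},B_n,C_{n+1},D_n,\overline{F}_n,\overline{E}_{n+1}$. Let $H_\infty=\bigcup_{n=1}^{\infty}H_n$, let $\partial H_\infty$ be its boundary in $\mathbb{R}^3$, and let $\Delta A_1C_1\overline{E}_1\subset\partial H_\infty$ be the open triangle (the triangle without its edges) with vertices $A_1,C_1,\overline{E}_1$. Then $$S(y,\varepsilon)=\left((\mathbb{I}^2\times\{0\})\cup\partial H_\infty\right)\setminus\Delta A_1C_1\overline{E}_1\subseteq\mathbb{R}^3 .$$ The space $SC(S^1)$: put $A=(0,0)$, $B=(0,1)$ and, for $n\ge 1$, $P_n=(2^{1-n},0)$, $Q_n=(2^{1-n},1)$. Let $T\subset\mathbb{I}^2$ (the piecewise linear Topologist sine curve) be the union of the segment $AB=\{0\}\times\mathbb{I}$ and of all the segments $P_nQ_n$ and $Q_nP_{n+1}$, $n\ge 1$. Let $s_0\in S^1$ be a base point. $SC(S^1)$ is the quotient space of the topological sum of $\mathbb{I}^2$ and $T\times S^1$ obtained by identifying $(t,s_0)\in T\times S^1$ with $t\in T\subset\mathbb{I}^2$ for every $t\in T$, and by identifying the whole set $\{t\}\times S^1$ with the point $t$ for every $t\in\{0\}\times\mathbb{I}$. The space $\mathcal{G}$: let $\mathbb{H}=\bigcup_{m=1}^{\infty}\{(x,y)\in\mathbb{R}^2:(x-1/m)^2+y^2=1/m^2\}$ be the Hawaiian earring, $\theta=(0,0)\in\mathbb{H}$,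 and let $C(\mathbb{H})$ be the cone over $\mathbb{H}$, i.e. the quotient of $\mathbb{H}\times\mathbb{I}$ obtained by collapsing $\mathbb{H}\times\{1\}$ to a point, with $\mathbb{H}$ regarded as the subspace $\mathbb{H}\times\{0\}$ of $C(\mathbb{H})$. Then $\mathcal{G}$ is the one-point union of two copies of $C(\mathbb{H})$ obtained by identifying the two copies of the point $\theta$. *)

(* Defs.v *)
From HB Require Import structures.
From Stdlib Require Import Relation_Operators.
From mathcomp Require Import all_boot all_order all_algebra generic_quotient.
From mathcomp Require Import boolp classical_sets functions set_interval reals.
From mathcomp Require Import interval_inference topology normedtype convex.
From mathcomp Require Import wedge_sigT.

Set Implicit Arguments.
Unset Strict Implicit.
Unset Printing Implicit Defensive.

Import Order.TTheory GRing.Theory Num.Theory.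
Import numFieldNormedType.Exports.

Local Open Scope classical_set_scope.
Local Open Scope ring_scope.
Local Open Scope quotient_scope.

Section homotopy.
Context (R : realType).

Definition homotopic (X Y : topologicalType) (f g : X -> Y) : Prop :=
  exists H : X * R -> Y,
    [/\ {within [set: X] `*` `[0, 1], continuous H},
        forall x, H (x, 0) = f x & forall x, H (x, 1) = g x].

Definition homotopy_equivalent (X Y : topologicalType) : Prop :=
  exists (f : X -> Y) (g : Y -> X),
    [/\ continuous f, continuous g,
        homotopic (g \o f) id & homotopic (f \o g) id].

Definition contractible (X : topologicalType) : Prop :=
  exists x0 : X, homotopic id (cst x0).

End homotopy.

(* The quotient of X by the equivalence relation generated by r. *)
Section generated_quotient.
Context (X : topologicalType) (r : X -> X -> Prop).

Definition generated_rel (x y : X) : bool :=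
  `[< clos_refl_sym_trans X r x y >].

Lemma generated_rel_refl : reflexive generated_rel.
Proof. by move=> x; apply/asboolP; exact: rst_refl. Qed.

Lemma generated_rel_sym : symmetric generated_rel.
Proof. by move=> x y; apply/asboolP/asboolP; exact: rst_sym. Qed.

Lemma generated_rel_trans : transitive generated_rel.
Proof.
move=> y x z /asboolP xy /asboolP yz; apply/asboolP.
exact: (rst_trans _ _ _ y).
Qed.

Definition generated_equiv : equiv_rel X :=
  EquivRel generated_rel
    generated_rel_refl generated_rel_sym generated_rel_trans.

Definition quotient_by := {eq_quot generated_equiv}.

HB.instance Definition _ :=
  Topological.copy quotient_by (quotient_topology quotient_by).
HB.instance Definition _ := Quotient.on quotient_by.

End generated_quotient.

Definition conv_hull (R : realType) (M : lmodType R) (A : set M) : set M :=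
  smallest (@convex_set R M) A.

Definition boundary (X : topologicalType) (A : set X) : set X :=
  closure A `\` interior A.

Section spaces.
Context (R : realType).

Definition unit_itv : set R := `[0, 1].
Definition unit_square : set (R * R) := unit_itv `*` unit_itv.

Section snake.
Context (y e : R).
Implicit Types n : nat.

(* These points are only used for n >= 1. *)
Definition snakeA n : R * R * R := ((2 * n%:R - 1)^-1, 0, 0).
Definition snakeB n : R * R * R := ((2 * n%:R)^-1, 1, 0).
Definition snakeC n : R * R * R :=
  ((2 * n%:R - 1)^-1, y + e / (2 * n%:R - 1), 0).
Definition snakeD n : R * R * R :=
  ((2 * n%:R)^-1, 1 - y - e / (2 * n%:R), 0).
Definition snakeE n : R * R * R :=
  ((2 * n%:R - 1)^-1, 2^-1 * (y + e / (2 * n%:R - 1)),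
   (2 * (2 * n%:R - 1))^-1).
Definition snakeF n : R * R * R :=
  ((2 * n%:R)^-1, 2^-1 * (2 - y - e / (2 * n%:R)), (4 * n%:R)^-1).

(* H_(2n-1) and H_(2n) *)
Definition snakeHodd n : set (R * R * R) :=
  conv_hull [set snakeA n; snakeB n; snakeC n; snakeD n; snakeE n; snakeF n].
Definition snakeHeven n : set (R * R * R) :=
  conv_hull [set snakeA n.+1; snakeB n; snakeC n.+1; snakeD n; snakeF n;
                 snakeE n.+1].

Definition snakeH : set (R * R * R) :=
  \bigcup_(n in [set n | (0 < n)%N]) (snakeHodd n `|` snakeHeven n).

Definition open_triangle (a b c : R * R * R) : set (R * R * R) :=
  conv_hull [set a; b; c] `\`
  (conv_hull [set a; b] `|` conv_hull [set b; c] `|` conv_hull [set a; c]).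

Definition snake_set : set (R * R * R) :=
  ((unit_square `*` [set 0]) `|` boundary snakeH) `\`
  open_triangle (snakeA 1) (snakeC 1) (snakeE 1).

Definition snake_space : topologicalType := snake_set.

End snake.

Section SC.

Definition circle : set (R * R) := [set p | p.1 ^+ 2 + p.2 ^+ 2 = 1].

(* P_n = (2^(1-n), 0) and Q_n = (2^(1-n), 1), used for n >= 1 *)
Definition sineP (n : nat) : R * R := (2 / 2 ^+ n, 0).
Definition sineQ (n : nat) : R * R := (2 / 2 ^+ n, 1).

Definition sine_curve : set (R * R) :=
  conv_hull [set (0, 0); (0, 1)] `|`
  \bigcup_(n in [set n | (0 < n)%N])
    (conv_hull [set sineP n; sineQ n] `|` conv_hull [set sineQ n; sineP n.+1]).

(* SC_sum is the topological sum of I^2 and T x S^1. *)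
Definition SC_summand (b : bool) : topologicalType :=
  if b then unit_square : topologicalType
  else (sine_curve * circle)%type : topologicalType.

Definition SC_sum : topologicalType := {b : bool & SC_summand b}.

Definition SC_square (u : unit_square) : SC_sum := existT SC_summand true u.
Definition SC_tube (p : sine_curve * circle) : SC_sum :=
  existT SC_summand false p.

Inductive SC_identify (s0 : circle) : SC_sum -> SC_sum -> Prop :=
| SC_base (u : unit_square) (t : sine_curve) :
    val u = val t -> SC_identify s0 (SC_tube (t, s0)) (SC_square u)
| SC_collapse (u : unit_square) (t : sine_curve) (s : circle) :
    ([set 0] `*` unit_itv) (val t) -> val u = val t ->
    SC_identify s0 (SC_tube (t, s)) (SC_square u).

Definition SC (s0 : circle) : topologicalType := quotient_by (SC_identify s0).

End SC.

Section griffiths.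

Definition hawaiian : set (R * R) :=
  \bigcup_(m in [set m | (0 < m)%N])
    [set p | (p.1 - m%:R^-1) ^+ 2 + p.2 ^+ 2 = m%:R^-1 ^+ 2].

Lemma hawaiian_theta : hawaiian (0, 0).
Proof. by exists 1%N => //=; rewrite invr1 sub0r sqrrN expr0n/= addr0. Qed.

Definition theta : hawaiian := SigSub (mem_set hawaiian_theta).

Lemma unit_itv0 : unit_itv 0.
Proof. by rewrite /unit_itv/= in_itv/= lexx ler01. Qed.

Definition itv0 : unit_itv := SigSub (mem_set unit_itv0).

Definition cone_rel (X : topologicalType) (p q : X * unit_itv) : Prop :=
  val p.2 = 1 /\ val q.2 = 1.

Definition cone (X : topologicalType) : topologicalType :=
  quotient_by (@cone_rel X).

Definition cone_base (X : topologicalType) (x : X) : cone X :=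
  \pi_(quotient_by (@cone_rel X)) (x, itv0).

Definition griffiths : topologicalType :=
  wedge (fun _ : bool => cone_base theta).

End griffiths.

End spaces.

Arguments unit_itv R : clear implicits.
Arguments unit_square R : clear implicits.
Arguments circle R : clear implicits.
Arguments sine_curve R : clear implicits.
Arguments hawaiian R : clear implicits.
Arguments griffiths R : clear implicits.
Arguments snake_space R y e : clear implicits.

(* Main.v *)
(* The prisms H_k form a tower over a band in the square that follows the zigzag
   x = 1/k |-> 0 (k odd), 1 (k even) and has vertical width y + e x at abscissa x.
   Hence S(y, e) is a double: two copies of the square, the floor and the roof,
   glued along the left edge and outside of the band. Homotopies of the square
   that respect the zero set of the height of the roof lift to the double.
   (1) If y > 1/2, every slice of the band contains [1 - y, y]. Shrinking [0, 1 - y]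
   to 0 and [y, 1] to 1, then sliding to the left edge and down, contracts S(y, e).
   (3) A circle of the Hawaiian earring is the double of a segment, so the
   Griffiths space is the double of two cones over a fan of segments. If
   0 < y <= 1/2, height in the square becomes height in the cones, the regions
   above (below) the band, which only meet in points of the top (bottom) edge, go
   to the feet of the segments, and the middle of the left edge to the common point.
   (2) If y = 0, the band closes up at the left edge. Collapsing the part of the
   floor below the band onto the zigzag turns the floor into the square with the
   sine curve drawn on it, and the slices of the roof into the circles attached
   along this curve. *)
From HB Require Import structures.
From Stdlib Require Import Relation_Operators.
Require Import Defs.
From mathcomp Require Import all_boot all_order all_algebra generic_quotient.
From mathcomp Require Import boolp classical_sets functions reals.
From mathcomp Require Import interval_inference topology normedtype convex realfun.
From mathcomp Require Import cardinality wedge_sigT.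
From mathcomp Require Import ring lra.

Set Implicit Arguments.
Unset Strict Implicit.
Unset Printing Implicit Defensive.

Import Order.TTheory GRing.Theory Num.Theory.
Import numFieldNormedType.Exports.

Local Open Scope classical_set_scope.
Local Open Scope ring_scope.

(** * Continuity on a subset *)

(** The left edge of the square is the obstacle: infinitely many pieces accumulate there, and
    functions such as [zigzag] oscillate. Away from this edge continuity is finite pasting over the
    intervals [1/(k+1), 1/k]; at the edge the maps differ from continuous ones by at most a constant
    times the abscissa. The same kind of estimate handles the centre of the fan of arcs. No homotopy
    is ever built on a quotient space. Each quotient is compact and is mapped continuously and
    injectively into four-dimensional space, with a double as its image; the target being Hausdorff,
    this is an embedding. All homotopies then live on explicit subsets, as total functions that are
    continuous on the subset. Maps of the bases suffice for (1) and (3), but not for (2): once the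
    floor under the band is collapsed, the two ends of a slice of the roof are identified and the
    slice has to run through both halves of a circle, so it changes sheets midway. There the maps
    and homotopies are written on the doubles themselves. *)

Section within_continuity.
Context {T U V : topologicalType}.
Implicit Types (A C : set T) (B : set U).

Lemma ctsP (X Y : topologicalType) (A : set X) (f : X -> Y) :
  {within A, continuous f} <->
  forall x, A x -> forall S, nbhs (f x) S -> nbhs x [set z | A z -> S (f z)].
Proof. by rewrite subspace_continuousP. Qed.

Lemma cts_comp A B (f : T -> U) (g : U -> V) :
  {within A, continuous f} -> {within B, continuous g} ->
  (forall x, A x -> B (f x)) -> {within A, continuous (g \o f)}.
Proof.
move=> /ctsP cf /ctsP cg AB; apply/ctsP => x Ax S /(cg _ (AB _ Ax)) wS.
by apply: filterS (cf x Ax _ wS) => z + Az => /(_ Az); apply; exact: AB.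
Qed.

(** At points outside the closed set [C] a whole neighbourhood avoids [C], so the claim is vacuous
    there. This is what makes pasting work at points that lie in only one of the closed pieces. *)
Lemma cts_near A C (f : T -> U) x S :
  closed C -> {within A `&` C, continuous f} -> A x -> nbhs (f x) S ->
  nbhs x [set z | A z -> C z -> S (f z)].
Proof.
move=> cC /ctsP fC Ax nS; case: (pselect (C x)) => [Cx|nCx].
  by apply: filterS (fC x (conj Ax Cx) S nS) => z + Az Cz; apply.
have : nbhs x (~` C) by apply: open_nbhs_nbhs; split => //; exact: closed_openC.
by apply: filterS => z nCz _ /nCz.
Qed.

Lemma cts_paste A C0 C1 (f : T -> U) :
  closed C0 -> closed C1 -> A `<=` C0 `|` C1 ->
  {within A `&` C0, continuous f} -> {within A `&` C1, continuous f} ->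
  {within A, continuous f}.
Proof.
move=> c0 c1 cov f0 f1; apply/ctsP => x Ax S nS.
apply: filterS2 (cts_near c0 f0 Ax nS) (cts_near c1 f1 Ax nS) => z h0 h1 Az.
by case: (cov z Az); [exact: h0|exact: h1].
Qed.

Lemma cts_eq A (f g : T -> U) : (forall x, A x -> f x = g x) ->
  {within A, continuous f} -> {within A, continuous g}.
Proof. by move=> fg; apply: subspace_eq_continuous => x /set_mem /fg. Qed.

Lemma cts_pair A (f : T -> U) (g : T -> V) :
  {within A, continuous f} -> {within A, continuous g} ->
  {within A, continuous (fun x => (f x, g x))}.
Proof.
move=> /subspace_continuousP cf /subspace_continuousP cg.
apply/subspace_continuousP => x Ax.
by apply: cvg_pair; [exact: cf|exact: cg].
Qed.

Lemma cts_sub A C (f : T -> U) : A `<=` C ->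
  {within C, continuous f} -> {within A, continuous f}.
Proof. exact: continuous_subspaceW. Qed.

End within_continuity.

Section within_arithmetic.
Context {R : realType} {T : topologicalType}.
Implicit Types (A : set T) (f g : T -> R).

Lemma cts_cst (U : topologicalType) A (c : U) :
  {within A, continuous (fun _ => c)}.
Proof. by apply: continuous_subspaceT => x; exact: cvg_cst. Qed.

Lemma cts_id A : {within A, continuous (fun x => x)}.
Proof. by apply: continuous_subspaceT => x. Qed.

Lemma cts_fst (U V : topologicalType) A (f : T -> U * V) :
  {within A, continuous f} -> {within A, continuous (fun x => (f x).1)}.
Proof.
move=> cf; apply: (@cts_comp _ _ _ A setT f fst cf) => //.
by apply: continuous_subspaceT => x; exact: cvg_fst.
Qed.

Lemma cts_snd (U V : topologicalType) A (f : T -> U * V) :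
  {within A, continuous f} -> {within A, continuous (fun x => (f x).2)}.
Proof.
move=> cf; apply: (@cts_comp _ _ _ A setT f snd cf) => //.
by apply: continuous_subspaceT => x; exact: cvg_snd.
Qed.

Lemma cts_after (U V : topologicalType) A (f : T -> U) (k : U -> V) :
  continuous k -> {within A, continuous f} ->
  {within A, continuous (fun x => k (f x))}.
Proof.
move=> ck cf; apply: (@cts_comp _ _ _ A setT f k cf) => //.
exact: continuous_subspaceT.
Qed.

Lemma cts_D A f g : {within A, continuous f} -> {within A, continuous g} ->
  {within A, continuous (fun x => f x + g x)}.
Proof.
move=> /subspace_continuousP cf /subspace_continuousP cg.
by apply/subspace_continuousP => x Ax; apply: cvgD; [exact: cf|exact: cg].
Qed.

Lemma cts_N A f : {within A, continuous f} -> {within A, continuous (fun x => - f x)}.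
Proof.
move=> /subspace_continuousP cf.
by apply/subspace_continuousP => x Ax; apply: cvgN; exact: cf.
Qed.

Lemma cts_B A f g : {within A, continuous f} -> {within A, continuous g} ->
  {within A, continuous (fun x => f x - g x)}.
Proof. by move=> cf cg; apply: cts_D => //; exact: cts_N. Qed.

Lemma cts_M A f g : {within A, continuous f} -> {within A, continuous g} ->
  {within A, continuous (fun x => f x * g x)}.
Proof.
move=> /subspace_continuousP cf /subspace_continuousP cg.
by apply/subspace_continuousP => x Ax; apply: cvgM; [exact: cf|exact: cg].
Qed.

Lemma cts_V A f : (forall x, A x -> f x != 0) -> {within A, continuous f} ->
  {within A, continuous (fun x => (f x)^-1)}.
Proof.
move=> fn0 /subspace_continuousP cf.
by apply/subspace_continuousP => x Ax; apply: cvgV; [exact: fn0|exact: cf].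
Qed.

Lemma cts_X A f n : {within A, continuous f} ->
  {within A, continuous (fun x => f x ^+ n)}.
Proof.
move=> cf; elim: n => [|n ih]; first exact: cts_cst.
apply: (@cts_eq _ _ _ (fun x => f x * f x ^+ n)) => [x _|]; first by rewrite exprS.
exact: cts_M.
Qed.

Lemma cts_norm A f : {within A, continuous f} ->
  {within A, continuous (fun x => `|f x|)}.
Proof.
move=> /subspace_continuousP cf.
by apply/subspace_continuousP => x Ax; apply: cvg_norm; exact: cf.
Qed.

Lemma cts_max A f g : {within A, continuous f} -> {within A, continuous g} ->
  {within A, continuous (fun x => Num.max (f x) (g x))}.
Proof.
move=> cf cg.
apply: (@cts_eq _ _ _ (fun x => 2^-1 * (f x + g x + `|f x - g x|))) => [x _|].
  by case: leP => h; [rewrite ler0_norm|rewrite gtr0_norm]; lra.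
apply: cts_M; first exact: cts_cst.
by apply: cts_D; [exact: cts_D|apply: cts_norm; exact: cts_B].
Qed.

Lemma cts_min A f g : {within A, continuous f} -> {within A, continuous g} ->
  {within A, continuous (fun x => Num.min (f x) (g x))}.
Proof.
move=> cf cg.
apply: (@cts_eq _ _ _ (fun x => - Num.max (- f x) (- g x))) => [x _|].
  by rewrite oppr_max !opprK.
by apply: cts_N; apply: cts_max; exact: cts_N.
Qed.

(** The retraction of the line onto [0, 1]. It extends functions of the square, and homotopies with
    time in [0, 1], to total functions without losing continuity. *)
Definition clamp (t : R) : R := Num.max 0 (Num.min 1 t).

Lemma clamp01 t : 0 <= clamp t <= 1.
Proof. by rewrite /clamp le_max lexx /= ge_max ler01 /= ge_min lexx. Qed.

Lemma clampE t : 0 <= t <= 1 -> clamp t = t.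
Proof. by move=> /andP[t0 t1]; rewrite /clamp min_r // max_r. Qed.

Lemma continuous_clamp : continuous clamp.
Proof.
move=> t; apply: continuous_max; first exact: cst_continuous.
by apply: continuous_min; [exact: cst_continuous|exact: cvg_id].
Qed.

End within_arithmetic.

(** Continuity on a subset by recursion on the syntax of the function; a head symbol that is not
    listed has to be covered by a hypothesis of the context. *)
Ltac cts_step := lazymatch goal with |- context [from_subspace _ ?F] =>
  lazymatch F with
  | fun x => x => exact: cts_id
  | id => exact: cts_id
  | fun _ => ?c => exact: cts_cst
  | fun x => (@?f x, @?g x) => apply: (@cts_pair _ _ _ _ f g)
  | fun x => @Algebra.add _ (@?f x) (@?g x) => apply: (@cts_D _ _ _ f g)
  | fun x => @Algebra.opp _ (@?f x) => apply: (@cts_N _ _ _ f)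
  | fun x => @GRing.mul _ (@?f x) (@?g x) => apply: (@cts_M _ _ _ f g)
  | fun x => @GRing.exp _ (@?f x) ?n => apply: (@cts_X _ _ _ f n)
  | fun x => @Num.norm _ _ (@?f x) => apply: (@cts_norm _ _ _ f)
  | fun x => Num.max (@?f x) (@?g x) => apply: (@cts_max _ _ _ f g)
  | fun x => Num.min (@?f x) (@?g x) => apply: (@cts_min _ _ _ f g)
  | fun x => clamp (@?f x) => apply: (@cts_after _ _ _ _ f clamp); first exact: continuous_clamp
  | fun x => fst (@?f x) => apply: (@cts_fst _ _ _ _ f)
  | fun x => snd (@?f x) => apply: (@cts_snd _ _ _ _ f)
  | fst => apply: (@cts_fst _ _ _ _ (fun x => x))
  | snd => apply: (@cts_snd _ _ _ _ (fun x => x))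
  | _ => assumption
  end end.
Ltac cts := repeat cts_step.

(** * Homotopies of subsets *)

Section homotopies.
Context {R : realType}.

(* [Q u v] constrains every point v on the track of u. *)
Definition track_homotopic (U V : topologicalType) (A : set U)
    (Q : U -> V -> Prop) (f g : U -> V) : Prop :=
  exists H : U * R -> V,
    [/\ {within A `*` `[0, 1], continuous H},
        forall u t, A u -> 0 <= t <= 1 -> Q u (H (u, t)),
        forall u, A u -> H (u, 0) = f u &
        forall u, A u -> H (u, 1) = g u].

Lemma track_homotopic_trans (U V : topologicalType) (A : set U)
    (Q : U -> V -> Prop) (f g h : U -> V) :
  track_homotopic A Q f g -> track_homotopic A Q g h -> track_homotopic A Q f h.
Proof.
move=> [F [cF QF F0 F1]] [G [cG QG G0 G1]].
pose H (x : U * R) := if x.2 <= 2^-1 then F (x.1, 2 * x.2) else G (x.1, 2 * x.2 - 1).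
exists H; split; last first.
- by move=> u Au; rewrite /H /= lt_geF /=; [rewrite -G1//; congr (G (_, _)); lra|lra].
- by move=> u Au; rewrite /H /= invr_ge0 ler0n mulr0; exact: F0.
- move=> u t Au t01; rewrite /H /=; case: ifPn => [tl|]; [|rewrite -ltNge => tl].
    by apply: QF => //; lra.
  by apply: QG => //; lra.
apply: (@cts_paste _ _ _ (snd @^-1` [set t : R | t <= 2^-1])
    (snd @^-1` [set t : R | 2^-1 <= t])).
- by apply: preimage_closed; [move=> x _; exact: cvg_snd|exact: closed_le].
- by apply: preimage_closed; [move=> x _; exact: cvg_snd|exact: closed_ge].
- by move=> x _ /=; case: (leP x.2 2^-1) => xl; [left|right; exact: ltW].
- apply: (@cts_eq _ _ _ (fun x : U * R => F (x.1, 2 * x.2))).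
    by move=> x [_ /= xl]; rewrite /H xl.
  apply: (@cts_comp _ _ _ _ _ (fun x : U * R => (x.1, 2 * x.2)) F _ cF).
    by cts.
  move=> [u t] /= [[Au]]; rewrite /= in_itv /= => t01 tl; split => //=.
  by rewrite in_itv /=; lra.
- apply: (@cts_eq _ _ _ (fun x : U * R => G (x.1, 2 * x.2 - 1))).
    move=> [u t] [[Au /= _] /= xl]; rewrite /H /=; case: ifPn => // tl.
    have -> : t = 2^-1 by apply/eqP; rewrite eq_le tl xl.
    by rewrite divff ?subrr ?pnatr_eq0 // G0 // F1.
  apply: (@cts_comp _ _ _ _ _ (fun x : U * R => (x.1, 2 * x.2 - 1)) G _ cG).
    by cts.
  move=> [u t] /= [[Au]]; rewrite /= in_itv /= => t01 tl; split => //=.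
  by rewrite in_itv /=; lra.
Qed.

Lemma track_homotopic_sym (U V : topologicalType) (A : set U)
    (Q : U -> V -> Prop) (f g : U -> V) :
  track_homotopic A Q f g -> track_homotopic A Q g f.
Proof.
move=> [F [cF QF F0 F1]]; exists (fun x => F (x.1, 1 - x.2)); split.
- apply: (@cts_comp _ _ _ _ _ (fun x : U * R => (x.1, 1 - x.2)) F _ cF).
    by cts.
  move=> [u t] /= [Au]; rewrite /= in_itv /= => t01; split => //=.
  by rewrite in_itv /=; lra.
- by move=> u t Au t01; apply: QF => //=; lra.
- by move=> u Au /=; rewrite subr0; exact: F1.
- by move=> u Au /=; rewrite subrr; exact: F0.
Qed.

Lemma track_homotopic_eq (U V : topologicalType) (A : set U)
    (Q : U -> V -> Prop) (f f' g g' : U -> V) :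
  (forall u, A u -> f u = f' u) -> (forall u, A u -> g u = g' u) ->
  track_homotopic A Q f g -> track_homotopic A Q f' g'.
Proof.
move=> ff gg [F [cF QF F0 F1]]; exists F; split => // u Au.
  by rewrite F0 // ff.
by rewrite F1 // gg.
Qed.

(** The maps and homotopies are total on the ambient spaces, so formulas can be handled apart from
    membership; only the end results are moved to subtypes. *)
Definition set_homotopy_equivalent (U V : topologicalType) (A : set U)
    (B : set V) : Prop :=
  exists (f : U -> V) (g : V -> U),
    [/\ {within A, continuous f}, {within B, continuous g},
        forall u, A u -> B (f u), forall v, B v -> A (g v) &
        track_homotopic A (fun _ => A) (g \o f) id /\
        track_homotopic B (fun _ => B) (f \o g) id].

Definition Sub_in (U : topologicalType) (A : set U) (u : U) (Au : A u) : A :=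
  SigSub (mem_set Au).

Lemma cts_Sub_in (T U : topologicalType) (A : set U) (f : T -> U)
    (fA : forall x, A (f x)) :
  continuous f -> continuous (fun x => Sub_in (fA x)).
Proof.
move=> cf x; apply: (@continuous_comp_initial _ _ _ (@set_val U A)).
exact: cf.
Qed.

Lemma homotopic_from (X Y : topologicalType) (H : X * R -> Y) (f g : X -> Y) :
  continuous H -> (forall x, H (x, 0) = f x) -> (forall x, H (x, 1) = g x) ->
  homotopic R f g.
Proof. by move=> cH H0 H1; exists H; split => //; exact: continuous_subspaceT. Qed.

(* Clamping the time makes a homotopy on a subset a total map. *)
Lemma set_track_total (U V : topologicalType) (A : set U) (H : U * R -> V) :
  {within A `*` `[0, 1], continuous H} ->
  continuous (fun p : A * R => H (\val p.1, clamp p.2)).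
Proof.
move=> cH; apply/continuous_subspace_setT.
apply: (@cts_comp _ _ _ _ _ (fun p : A * R => (\val p.1, clamp p.2)) H _ cH).
  apply: cts_pair; last by apply: cts_after; [exact: continuous_clamp|cts].
  by apply: cts_after; [exact: initial_continuous|cts].
move=> [[u Au] t] _ /=; split => /=; first exact: set_mem.
by rewrite in_itv /=; exact: clamp01.
Qed.

Lemma within_val (U V : topologicalType) (A : set U) (f : U -> V) :
  {within A, continuous f} -> continuous (fun a : A => f (\val a)).
Proof. by move=> /subspace_sigL_continuousP. Qed.

Lemma set_contractible (U : topologicalType) (A : set U) (u0 : U) :
  A u0 -> track_homotopic A (fun _ => A) id (cst u0) -> contractible R A.
Proof.
move=> Au0 [H [cH AH H0 H1]]; exists (Sub_in Au0).
have AH' (p : A * R) : A (H (\val p.1, clamp p.2)).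
  by apply: AH; [exact: set_valP|exact: clamp01].
apply: (@homotopic_from _ _ (fun p => Sub_in (AH' p))).
- by apply: cts_Sub_in; exact: set_track_total.
- move=> a; apply: val_inj => /=.
  by rewrite clampE ?lexx ?ler01 // H0 //; exact: set_valP.
- move=> a; apply: val_inj => /=.
  by rewrite clampE ?lexx ?ler01 // H1 //; exact: set_valP.
Qed.

(** A continuous map from a compact space to a Hausdorff one is closed; [psi] pulls a closed set
    back to the trace on [B] of its image under [phi], which is therefore closed. *)
Lemma compact_inverse (X : topologicalType) (V : topologicalType) (B : set V)
    (phi : X -> V) (psi : B -> X) :
  compact [set: X] -> hausdorff_space V -> continuous phi ->
  (forall b, phi (psi b) = \val b) -> injective phi -> continuous psi.
Proof.
move=> cX hV cphi phipsi phi_inj.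
apply/continuous_closedP => C cC.
have -> : psi @^-1` C = (@set_val V B) @^-1` (phi @` C).
  apply/seteqP; split => b /=.
    by move=> Cb; exists (psi b) => //; rewrite phipsi.
  by move=> [x Cx]; rewrite -[set_val b]phipsi => /phi_inj <-.
apply: preimage_closed; first by move=> b _; exact: initial_continuous.
apply: compact_closed => //; apply: continuous_compact.
  exact: continuous_subspaceT.
exact: subclosed_compact cC cX _.
Qed.

(** The passage from subsets to abstract spaces: the equivalence with [B] is composed with the
    inverse of the embedding [phi]. *)
Lemma homotopy_equivalent_image (U V X : topologicalType) (A : set U)
    (B : set V) (phi : X -> V) :
  set_homotopy_equivalent A B -> compact [set: X] -> hausdorff_space V ->
  continuous phi -> injective phi -> range phi = B ->
  homotopy_equivalent R A X.
Proof.
move=> [f [g [cf cg AB BA [[F [cF AF F0 F1]] [G [cG BG G0 G1]]]]]] cX hV cphi inj img.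
have phiB x : B (phi x) by rewrite -img; exists x.
have sur (b : B) : exists x, phi x = \val b.
  have surB v : B v -> exists x, phi x = v by rewrite -img => -[x _ <-]; exists x.
  exact: surB (set_valP b).
have [psi psiE] := choice sur.
have cpsi : continuous psi by exact: compact_inverse psiE inj.
have psiK x : psi (Sub_in (phiB x)) = x by apply: inj; rewrite psiE.
have fB (a : A) : B (f (\val a)) by apply: AB; exact: set_valP.
have gA x : A (g (phi x)) by apply: BA.
have cgphi : continuous (g \o phi).
  apply/continuous_subspace_setT; apply: (@cts_comp _ _ _ _ B) => //.
  exact: continuous_subspaceT.
exists (fun a => psi (Sub_in (fB a))), (fun x => Sub_in (gA x)); split.
- move=> a; apply: (@continuous_comp _ _ _ (fun a => Sub_in (fB a)) psi).
    by apply: cts_Sub_in; exact: within_val.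
  exact: cpsi.
- exact: cts_Sub_in.
- have AH (p : A * R) : A (F (\val p.1, clamp p.2)).
    by apply: AF; [exact: set_valP|exact: clamp01].
  apply: (@homotopic_from _ _ (fun p => Sub_in (AH p))).
  + by apply: cts_Sub_in; exact: set_track_total.
  + move=> a; apply: val_inj => /=.
    by rewrite clampE ?lexx ?ler01 // F0 ?psiE //; exact: set_valP.
  + move=> a; apply: val_inj => /=.
    by rewrite clampE ?lexx ?ler01 // F1 //; exact: set_valP.
- have BH (p : X * R) : B (G (phi p.1, clamp p.2)).
    by apply: BG => //; exact: clamp01.
  apply: (@homotopic_from _ _ (fun p => psi (Sub_in (BH p)))).
  + move=> p; apply: (@continuous_comp _ _ _ (fun p => Sub_in (BH p)) psi);
      last exact: cpsi.
    apply: cts_Sub_in; apply/continuous_subspace_setT.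
    apply: (@cts_comp _ _ _ _ _ (fun p : X * R => (phi p.1, clamp p.2)) G _ cG).
      apply: cts_pair; last by apply: cts_after; [exact: continuous_clamp|cts].
      by apply: cts_after; [exact: cphi|cts].
    by move=> [x t] _; split => //=; rewrite in_itv /=; exact: clamp01.
  + move=> x /=; apply: inj; rewrite !psiE /=.
    by rewrite clampE ?lexx ?ler01 // G0.
  + move=> x; apply: inj; rewrite psiE /=.
    by rewrite clampE ?lexx ?ler01 // G1.
Qed.

End homotopies.

Arguments track_homotopic R {U V}.
Arguments set_homotopy_equivalent R {U V}.

(** * Doubles *)

Section doubles.
Context {R : realType}.

(* Two copies of X glued along the zero set of h. *)
Definition dbl (U : Type) (X : set U) (h : U -> R) : set (U * R) :=
  [set p | X p.1 /\ (p.2 = 0 \/ p.2 = h p.1)].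

(** The sheet is kept: height 0 stays 0, any other height becomes the one prescribed by [k]. This is
    consistent only if zeros of the first height go to zeros of [k], because over a zero both sheets
    are the same point. *)
Definition dmap (U V : Type) (k : V -> R) (f : U -> V) (p : U * R) : V * R :=
  (f p.1, if p.2 == 0 then 0 else k (f p.1)).

Definition pair_homotopic (U V : topologicalType) (X : set U) (h : U -> R)
    (Y : set V) (k : V -> R) : (U -> V) -> (U -> V) -> Prop :=
  track_homotopic R X (fun u v => Y v /\ (h u = 0 -> k v = 0)).

(** The closed sets where [z] is 0 and where [z] is [hh] cover [A]. On the first the new height is
    0, on the second it is [k (b x)], and on the overlap [hh] vanishes, hence [k (b x)] too. *)
Lemma cts_lift (T V : topologicalType) (A : set T) (Y : set V) (k : V -> R)
    (b : T -> V) (z hh : T -> R) :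
  {within Y, continuous k} -> {within A, continuous b} ->
  (forall x, A x -> Y (b x)) ->
  continuous z -> continuous hh ->
  (forall x, A x -> z x = 0 \/ z x = hh x) ->
  (forall x, A x -> hh x = 0 -> k (b x) = 0) ->
  {within A, continuous (fun x => (b x, if z x == 0 then 0 else k (b x)))}.
Proof.
move=> ck cb bY cz chh zE k0; apply: cts_pair => //.
apply: (@cts_paste _ _ A (z @^-1` [set 0]) ((fun x => z x - hh x) @^-1` [set 0])).
- by apply: preimage_closed; [move=> x _; exact: cz|exact: closed_eq].
- apply: preimage_closed; last exact: closed_eq.
  by move=> x _; apply: cvgB; [exact: cz|exact: chh].
- by move=> x /zE[z0|zh]; [left|right => /=; rewrite zh subrr].
- apply: (@cts_eq _ _ _ (fun=> 0)); last exact: cts_cst.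
  by move=> x [_ /= z0]; rewrite /= z0 eqxx.
- apply: (@cts_eq _ _ _ (fun x => k (b x))) => [x [Ax /= /subr0_eq zh]|].
    by case: eqP => //= z0; rewrite k0 // -zh.
  apply: (@cts_comp _ _ _ _ Y) => //; last by move=> x [/bY].
  by apply: cts_sub cb => x [].
Qed.

Lemma dmap_id (U : Type) (h : U -> R) (X : set U) p : dbl X h p -> dmap h id p = p.
Proof.
by case: p => u z [/= _ zE]; rewrite /dmap /=; case: eqP => [->//|z0]; case: zE => [/z0|->].
Qed.

Section lift.
Context {U V : topologicalType} (X : set U) (h : U -> R) (Y : set V) (k : V -> R).
Hypotheses (ch : continuous h) (ck : {within Y, continuous k}).

Lemma cts_dmap (f : U -> V) : {within X, continuous f} ->
  (forall u, X u -> Y (f u) /\ (h u = 0 -> k (f u) = 0)) ->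
  {within dbl X h, continuous (dmap k f)}.
Proof.
move=> cf fY; apply: (@cts_lift _ _ _ Y k (fun p : U * R => f p.1) snd
  (fun p : U * R => h p.1)) => //.
- apply: (@cts_comp _ _ _ _ X fst f) => //; last by move=> p [].
  by cts.
- by move=> p [/fY[]].
- by move=> p; exact: cvg_snd.
- by move=> p; apply: continuous_comp; [exact: cvg_fst|exact: ch].
- by move=> p [].
- by move=> p [/fY[]].
Qed.

Lemma dmap_dbl (f : U -> V) (p : U * R) :
  Y (f p.1) -> dbl Y k (dmap k f p).
Proof. by move=> Yf; split => //=; case: ifP; [left|right]. Qed.

Lemma dbl_homotopic (f g : U -> V) : pair_homotopic X h Y k f g ->
  track_homotopic R (dbl X h) (fun _ => dbl Y k) (dmap k f) (dmap k g).
Proof.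
move=> [F [cF FY F0 F1]].
exists (fun q => dmap k (fun u => F (u, q.2)) q.1); split.
- apply: (@cts_lift _ _ _ Y k (fun q : U * R * R => F (q.1.1, q.2))
    (fun q => q.1.2) (fun q : U * R * R => h q.1.1)) => //.
  + apply: (@cts_comp _ _ _ _ _ (fun q : U * R * R => (q.1.1, q.2)) F _ cF).
      by cts.
    by move=> q [/= [Xq _]].
  + by move=> q [/= [Xq _]]; rewrite in_itv /= => t01; case: (FY _ q.2 Xq t01).
  + move=> q; apply: (@continuous_comp _ _ _ fst snd); first exact: cvg_fst.
    exact: cvg_snd.
  + move=> q; apply: (@continuous_comp _ _ _ fst (fun p : U * R => h p.1)).
      exact: cvg_fst.
    by apply: (@continuous_comp _ _ _ fst h); [exact: cvg_fst|exact: ch].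
  + by move=> q [/= [_ ]].
  + by move=> q [/= [Xq _]]; rewrite in_itv /= => t01; case: (FY _ q.2 Xq t01).
- by move=> p t [Xp _] t01; apply: dmap_dbl => /=; case: (FY _ _ Xp t01).
- by move=> p [Xp _]; rewrite /dmap /= F0.
- by move=> p [Xp _]; rewrite /dmap /= F1.
Qed.

End lift.

Lemma dbl_homotopy_equivalent (U V : topologicalType) (X : set U) (h : U -> R)
    (Y : set V) (k : V -> R) (f : U -> V) (g : V -> U) :
  continuous h -> continuous k ->
  {within X, continuous f} -> {within Y, continuous g} ->
  (forall u, X u -> Y (f u) /\ (h u = 0 -> k (f u) = 0)) ->
  (forall v, Y v -> X (g v) /\ (k v = 0 -> h (g v) = 0)) ->
  pair_homotopic X h X h (g \o f) id -> pair_homotopic Y k Y k (f \o g) id ->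
  set_homotopy_equivalent R (dbl X h) (dbl Y k).
Proof.
move=> ch ck cf cg fY gX Hgf Hfg.
(* [dmap] forgets the sheet at a point that lands on a zero of [l'], so composites agree only if
   such points continue to zeros of [l]. *)
have dmap_comp (W W' : Type) (l : W -> R) (l' : W' -> R)
    (a : W -> W') (b : W' -> W) p :
    (l' (a p.1) = 0 -> l (b (a p.1)) = 0) -> dmap l (b \o a) p = dmap l b (dmap l' a p).
  move=> ab; rewrite /dmap /=; case: (p.2 == 0); first by rewrite eqxx.
  by case: eqP => //= /ab ->.
exists (dmap k f), (dmap h g); split.
- exact: (cts_dmap ch (continuous_subspaceT ck) cf fY).
- exact: (cts_dmap ck (continuous_subspaceT ch) cg gX).
- by move=> p [Xp _]; apply: dmap_dbl; case: (fY _ Xp).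
- by move=> p [Yp _]; apply: dmap_dbl; case: (gX _ Yp).
- split.
    apply: track_homotopic_eq (dbl_homotopic ch (continuous_subspaceT ch) Hgf).
      move=> p [Xp _] /=; apply: dmap_comp => //.
      by have [Yf _] := fY _ Xp; case: (gX _ Yf).
    by move=> p /dmap_id ->.
  apply: track_homotopic_eq (dbl_homotopic ck (continuous_subspaceT ck) Hfg).
    move=> p [Yp _] /=; apply: dmap_comp => //.
    by have [Xg _] := gX _ Yp; case: (fY _ Xg).
  by move=> p /dmap_id ->.
Qed.

Lemma pair_homotopic_segment (U : topologicalType) (X : set U) (h : U -> R)
    (Y : set (R * R)) (k : R * R -> R) (f g : U -> R * R) :
  {within X, continuous f} -> {within X, continuous g} ->
  (forall u t, X u -> 0 <= t <= 1 ->
    let v := ((1 - t) * (f u).1 + t * (g u).1, (1 - t) * (f u).2 + t * (g u).2) in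
    Y v /\ (h u = 0 -> k v = 0)) ->
  pair_homotopic X h Y k f g.
Proof.
move=> cf cg HY.
exists (fun q => ((1 - q.2) * (f q.1).1 + q.2 * (g q.1).1,
                  (1 - q.2) * (f q.1).2 + q.2 * (g q.1).2)); split.
- have cX (W : topologicalType) (a : U -> W) : {within X, continuous a} ->
      {within X `*` `[0, 1], continuous (fun q : U * R => a q.1)}.
    by move=> ca; apply: (@cts_comp _ _ _ _ X fst a) => //; [cts|move=> q []].
  by cts; apply: cX.
- by move=> u t Xu t01; exact: HY.
- by move=> u Xu /=; rewrite subr0 !mul1r !mul0r !addr0; case: (f u).
- by move=> u Xu /=; rewrite subrr !mul1r !mul0r !add0r; case: (g u).
Qed.

Lemma pair_homotopic_segment3 (U : topologicalType) (X : set U) (h : U -> R)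
    (Y : set (R * R * R)) (k : R * R * R -> R) (f g : U -> R * R * R) :
  {within X, continuous f} -> {within X, continuous g} ->
  (forall u t, X u -> 0 <= t <= 1 ->
    let v := ((1 - t) * (f u).1.1 + t * (g u).1.1, (1 - t) * (f u).1.2 + t * (g u).1.2,
              (1 - t) * (f u).2 + t * (g u).2) in
    Y v /\ (h u = 0 -> k v = 0)) ->
  pair_homotopic X h Y k f g.
Proof.
move=> cf cg HY.
exists (fun q => ((1 - q.2) * (f q.1).1.1 + q.2 * (g q.1).1.1,
                  (1 - q.2) * (f q.1).1.2 + q.2 * (g q.1).1.2,
                  (1 - q.2) * (f q.1).2 + q.2 * (g q.1).2)); split.
- have cX (W : topologicalType) (a : U -> W) : {within X, continuous a} ->
      {within X `*` `[0, 1], continuous (fun q : U * R => a q.1)}.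
    by move=> ca; apply: (@cts_comp _ _ _ _ X fst a) => //; [cts|move=> q []].
  by cts; apply: cX.
- by move=> u t Xu t01; exact: HY.
- by move=> u Xu /=; rewrite subr0 !mul1r !mul0r !addr0; case: (f u) => -[].
- by move=> u Xu /=; rewrite subrr !mul1r !mul0r !add0r; case: (g u) => -[].
Qed.

End doubles.

(** * Interpolation at the points 1/k *)

Section piecewise.
Context {R : realType}.
Implicit Types (k n : nat) (x t : R) (a b : nat -> R).

(** The interval [1/(k+1), 1/k] for k at least 1, written with products to keep the conditions
    linear in [x]. *)
Definition piece k : set R := [set x | k%:R * x <= 1 <= k.+1%:R * x].

Definition idx x : nat := Num.truncn x^-1.

Lemma idx_itv x : 0 < x <= 1 ->
  (0 < idx x)%N /\ (idx x)%:R * x <= 1 < (idx x).+1%:R * x.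
Proof.
move=> /andP[x0 x1].
have xV : 0 <= x^-1 by rewrite invr_ge0 ltW.
have /andP[l u] := truncn_itv xV; split.
  by rewrite truncn_gt0 -[1]invr1 lef_pV2 // posrE.
by rewrite -ler_pdivlMr // -ltr_pdivrMr // div1r l u.
Qed.

Lemma piece_idx x : 0 < x <= 1 -> piece (idx x) x.
Proof. by move=> /idx_itv[_ /andP[l u]]; rewrite /piece /= l ltW. Qed.

Lemma piece_pos k x : piece k x -> 0 < x.
Proof.
move=> /andP[_ h]; have : 0 < k.+1%:R * x by apply: lt_le_trans h.
by rewrite pmulr_rgt0 // ltr0n.
Qed.

(** Neighbouring pieces share the point 1/(k+1), at which [idx] selects the left one,
    [1/(k+2), 1/(k+1)]. Formulas that depend on [idx] have to be checked for agreement at these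
    points. *)
Lemma piece_eq k x : (0 < k)%N -> piece k x ->
  idx x = k \/ (k.+1%:R * x = 1 /\ idx x = k.+1).
Proof.
move=> k0 pk; have x0 := piece_pos pk; case/andP: pk => h1 h2.
have [h3|h3] := ltP 1 (k.+1%:R * x).
  by left; apply/truncn_def; rewrite -div1r ler_pdivlMr // ltr_pdivrMr // h1.
right; have e : k.+1%:R * x = 1 by apply/eqP; rewrite eq_le h3 h2.
split => //; apply/truncn_def; rewrite -div1r ler_pdivlMr // ltr_pdivrMr // h3 /=.
by rewrite -[k.+2]addn1 natrD mulrDl mul1r e ltrDl.
Qed.

Lemma piece_le1 k x : (0 < k)%N -> piece k x -> 0 < x <= 1.
Proof.
move=> k0 pk; have x0 := piece_pos pk; rewrite x0 /=; case/andP: pk => h _.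
by apply: le_trans h; rewrite ler_peMl ?ler1n // ltW.
Qed.

Lemma piece_closed k : closed (piece k).
Proof.
have -> : piece k = (fun x => k%:R * x) @^-1` [set x | x <= 1] `&`
    (fun x => k.+1%:R * x) @^-1` [set x | 1 <= x].
  by apply/seteqP; split => x /=; rewrite /piece /= => /andP.
have cM (c : R) : continuous (fun x : R => c * x).
  by move=> x; apply: cvgM; [exact: cvg_cst|exact: cvg_id].
by apply: closedI; apply: preimage_closed; [move=> ? _; exact: cM|exact: closed_le|
  move=> ? _; exact: cM|exact: closed_ge].
Qed.

(** The pieces are locally finite away from 0: if [p u] has index k, then near [u] only the pieces k
    and k - 1 occur, and for k = 1 only the first, since [p] does not exceed 1 on [A]. *)
Lemma cts_pieces (U V : topologicalType) (A : set U) (p : U -> R) (f : U -> V) :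
  continuous p -> (forall u, A u -> 0 < p u <= 1) ->
  (forall k, (0 < k)%N -> {within A `&` (p @^-1` piece k), continuous f}) ->
  {within A, continuous f}.
Proof.
move=> cp Ap fk; apply/ctsP => u Au S nS.
have pu := Ap _ Au; have [k0 /andP[ku uk]] := idx_itv pu.
set k := idx (p u) in k0 ku uk.
have cl j : closed (p @^-1` piece j).
  by apply: preimage_closed; [move=> ? _; exact: cp|exact: piece_closed].
have n1 := cts_near (cl k) (fk k k0) Au nS.
have n3 : nbhs u [set z | 1 < k.+1%:R * p z].
  apply: open_nbhs_nbhs; split => //.
  apply: (@open_comp _ _ (fun z => k.+1%:R * p z) [set r | 1 < r]);
    last exact: open_gt.
  by move=> z _; apply: cvgM; [exact: cvg_cst|exact: cp].
case: (ltnP 1 k) => k1; last first.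
  have {k0 k1} kE : k = 1%N by apply/eqP; rewrite eqn_leq k1 k0.
  apply: filterS2 n1 n3 => z /= h1 h3 Az; apply: h1 => //.
  by rewrite /piece /= (ltW h3) andbT kE mul1r; case/andP: (Ap _ Az).
have kp : (0 < k.-1)%N by case: (k) k1 => [|[]].
have kpE : k.-1.+1 = k by case: (k) k0.
have n2 := cts_near (cl k.-1) (fk _ kp) Au nS.
have n4 : nbhs u [set z | k.-1%:R * p z < 1].
  apply: open_nbhs_nbhs; split => /=.
    apply: (@open_comp _ _ (fun z => k.-1%:R * p z) [set r | r < 1]);
      last exact: open_lt.
    by move=> z _; apply: cvgM; [exact: cvg_cst|exact: cp].
  apply: lt_le_trans ku; rewrite ltr_pM2r; last by case/andP: pu.
  by rewrite ltr_nat ltn_predL.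
apply: filterS3 n1 n2 (filterI n3 n4) => z /= h1 h2 [h3 h4] Az.
have [h|h] := leP (k%:R * p z) 1.
  by apply: h1 => //; rewrite /piece /= h ltW.
by apply: h2 => //; rewrite /piece /= kpE (ltW h4) ltW.
Qed.

(** Barycentric coordinate on the piece: 0 at 1/k and 1 at 1/(k+1). *)
Definition wt k x : R := k.+1%:R * (1 - k%:R * x).

Lemma wt_itv k x : piece k x -> 0 <= wt k x <= 1.
Proof.
move=> /andP[h1 h2]; rewrite /wt mulr_ge0 ?subr_ge0 //=.
have := ler_wpM2l (ler0n R k) h2; rewrite mulr1 => h3.
rewrite -subr_ge0; suff -> : 1 - k.+1%:R * (1 - k%:R * x) = k%:R * (k.+1%:R * x) - k%:R.
  by rewrite subr_ge0.
by rewrite -natr1; ring.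
Qed.

Lemma wt_x k x : (0 < k)%N -> x = (1 - wt k x) / k%:R + wt k x / k.+1%:R.
Proof. by move=> k0; rewrite /wt -natr1; field; rewrite pnatr_eq0 -lt0n k0 natr1 pnatr_eq0. Qed.

(* Linear interpolation of the values a k at the points 1/k. *)
Definition pl a x : R :=
  let k := idx x in (1 - wt k x) * a k + wt k x * a k.+1.

(** At the shared end 1/(k+1) the weight is 1 on piece k and 0 on piece k + 1, so both formulas
    return [a k.+1]. *)
Lemma plE a k x : (0 < k)%N -> piece k x ->
  pl a x = (1 - wt k x) * a k + wt k x * a k.+1.
Proof.
move=> k0 pk; rewrite /pl; case: (piece_eq k0 pk) => [->//|[e ->]].
have k0' : (0 < k%:R :> R) by rewrite ltr0n.
have k1' : (k.+1%:R : R) = k%:R + 1 by rewrite natr1.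
have -> : wt k.+1 x = 0 by rewrite /wt e subrr mulr0.
have -> : wt k x = 1.
  rewrite /wt k1' (_ : _ * _ = k%:R + 1 - k%:R * ((k%:R + 1) * x)); last by ring.
  by rewrite -k1' e k1'; ring.
by rewrite !subr0 subrr !mul1r !mul0r addr0 add0r.
Qed.

Lemma piece_seg k x x' t : 0 <= t <= 1 -> piece k x -> piece k x' ->
  piece k ((1 - t) * x + t * x').
Proof.
move=> /andP[t0 t1] /andP[h1 h2] /andP[h3 h4]; rewrite /piece /=.
set c := k%:R in h1 h3 *; set d := k.+1%:R in h2 h4 *; apply/andP; split.
  have -> : c * ((1 - t) * x + t * x') = (1 - t) * (c * x) + t * (c * x') by ring.
  nra.
have -> : d * ((1 - t) * x + t * x') = (1 - t) * (d * x) + t * (d * x') by ring.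
nra.
Qed.

Lemma pl_seg a k x x' t : (0 < k)%N -> 0 <= t <= 1 -> piece k x -> piece k x' ->
  pl a ((1 - t) * x + t * x') = (1 - t) * pl a x + t * pl a x'.
Proof.
move=> k0 t01 h h'; rewrite !(plE _ k0) //; last exact: piece_seg.
by rewrite /wt; ring.
Qed.

Lemma piece_V k : (0 < k)%N -> piece k k%:R^-1.
Proof.
move=> k0; have e : k%:R * k%:R^-1 = 1 :> R by rewrite mulfV ?pnatr_eq0 -?lt0n.
rewrite /piece /= e lexx /=.
by rewrite ler_pdivlMr ?ltr0n // mul1r ler_nat.
Qed.

Lemma piece_VS k : (0 < k)%N -> piece k k.+1%:R^-1.
Proof.
move=> k0; have e : k.+1%:R * k.+1%:R^-1 = 1 :> R by rewrite mulfV ?pnatr_eq0.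
rewrite /piece /= e lexx andbT.
by rewrite ler_pdivrMr ?ltr0n // mul1r ler_nat.
Qed.

Lemma pl_V a k : (0 < k)%N -> pl a k%:R^-1 = a k.
Proof.
move=> k0; have e : k%:R * k%:R^-1 = 1 :> R by rewrite mulfV ?pnatr_eq0 -?lt0n.
rewrite (plE _ k0); last exact: piece_V.
by rewrite /wt e subrr mulr0 subr0 mul1r mul0r addr0.
Qed.

Lemma pl_le a b x : (forall k, (0 < k)%N -> a k <= b k) -> 0 < x <= 1 ->
  pl a x <= pl b x.
Proof.
move=> ab x01; have [k0 _] := idx_itv x01.
have /andP[f0 f1] := wt_itv (piece_idx x01).
rewrite /pl; apply: lerD; apply: ler_wpM2l; rewrite ?subr_ge0 ?ab //.
Qed.

Lemma pl_affine (c d : R) x : 0 < x <= 1 -> pl (fun k => c + d / k%:R) x = c + d * x.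
Proof.
move=> x01; have [k0 _] := idx_itv x01.
rewrite [in RHS](wt_x x k0) /pl; set f := wt _ _.
by rewrite [idx]lock; ring.
Qed.

Lemma pl_cst (c : R) x : 0 < x <= 1 -> pl (fun=> c) x = c.
Proof. by move=> _; rewrite /pl; ring. Qed.

Lemma plD a b x : pl (fun k => a k + b k) x = pl a x + pl b x.
Proof. by rewrite /pl; ring. Qed.

Lemma cts_pl (U : topologicalType) (A : set U) (p : U -> R) a : continuous p ->
  (forall u, A u -> 0 < p u <= 1) -> {within A, continuous (fun u => pl a (p u))}.
Proof.
move=> cp Ap; apply: (cts_pieces cp Ap) => k k0.
apply: (@cts_eq _ _ _ (fun u => (1 - wt k (p u)) * a k + wt k (p u) * a k.+1)).
  by move=> u [_ pk]; rewrite (plE a k0).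
rewrite /wt; have cp' := @continuous_subspaceT _ _ (A `&` p @^-1` piece k) _ cp.
by cts.
Qed.

(* Functions are only controlled by a multiple of p near the zero set of p. *)
Lemma cts_squeeze (U : topologicalType) (A : set U) (p f g : U -> R) (C : R) :
  continuous p -> {within A, continuous g} -> (forall u, A u -> 0 <= p u) ->
  (forall u, A u -> `|f u - g u| <= C * p u) ->
  {within A `&` [set u | 0 < p u], continuous f} -> {within A, continuous f}.
Proof.
move=> cp /ctsP cg p0 fg /ctsP cf; apply/ctsP => u Au S nS.
have := p0 _ Au; rewrite le_eqVlt => /orP[/eqP pu0|pu].
  have fu : f u = g u.
    by apply/eqP; rewrite -subr_eq0 -normr_le0; have := fg _ Au; rewrite -pu0 mulr0.
  move: nS; rewrite fu => /nbhs_ballP[e /= e0 bS].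
  have e2 : 0 < e / 2 by rewrite divr_gt0.
  have n1 := cg _ Au _ (nbhsx_ballx (g u) (e / 2) e2).
  have n2 : nbhs u [set z | C * p z < e / 2].
    have : {for u, continuous (fun z => C * p z)}.
      by apply: cvgM; [exact: cvg_cst|exact: cp].
    move=> /(_ [set r | r < e / 2]); apply => /=; apply: open_nbhs_nbhs; split.
      exact: open_lt.
    by rewrite -pu0 mulr0.
  apply: filterS2 n1 n2 => z /= n1 n2 Az; apply: bS; rewrite /ball /=.
  have := n1 Az; rewrite /ball /= => h1; have h2 := fg _ Az.
  rewrite (_ : g u - f z = (g u - g z) - (f z - g z)); last by ring.
  by apply: le_lt_trans (ler_normB _ _) _; lra.
have n1 := cf _ (conj Au pu) _ nS.
have n2 : nbhs u [set z | 0 < p z].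
  apply: open_nbhs_nbhs; split => //.
  by apply: (@open_comp _ _ p [set r | 0 < r]); [move=> z _; exact: cp|exact: open_gt].
by apply: filterS2 n1 n2 => z h1 h2 Az; apply: h1.
Qed.

End piecewise.

(** * The snake as a double of the square *)

Section convexity.
Context {R : realType}.

Lemma convex_setP (M : lmodType R) (A : set M) :
  @convex_set R M A <->
  forall t x y, 0 <= t <= 1 -> A x -> A y -> A ((1 - t) *: x + t *: y).
Proof.
split=> [cA t x y /andP[t0 t1] Ax Ay|cA x y l /set_mem Ax /set_mem Ay].
  have := cA y x (Itv01 t0 t1) (mem_set Ay) (mem_set Ax).
  by move=> /set_mem; rewrite (addrC ((1 - t) *: x)).
apply/mem_set; have := cA l%:num y x; rewrite (addrC ((1 - l%:num) *: y)).
by apply => //; rewrite ge0 le1.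
Qed.

Lemma conv_hull_seg (M : lmodType R) (S : set M) t x y : 0 <= t <= 1 ->
  conv_hull S x -> conv_hull S y -> conv_hull S ((1 - t) *: x + t *: y).
Proof.
move=> t01 Sx Sy B [cB SB]; move/convex_setP: (cB); apply => //.
  by apply: Sx; split.
by apply: Sy; split.
Qed.

Lemma conv_hull_sub (M : lmodType R) (S : set M) x : S x -> conv_hull S x.
Proof. by move=> Sx B [_ SB]; exact: SB. Qed.

Lemma conv_hull_min (M : lmodType R) (S B : set M) :
  (forall t x y, 0 <= t <= 1 -> B x -> B y -> B ((1 - t) *: x + t *: y)) ->
  S `<=` B -> conv_hull S `<=` B.
Proof. by move=> /convex_setP cB SB x; apply; split. Qed.

Lemma conv_hull2 (M : lmodType R) (a b : M) :
  conv_hull [set a; b] = [set (1 - t) *: a + t *: b | t in `[0, 1]].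
Proof.
apply/seteqP; split.
  apply: conv_hull_min; last first.
    move=> x [->|->]; [exists 0|exists 1]; rewrite /= ?in_itv /= ?lexx ?ler01 //.
      by rewrite subr0 scale1r scale0r addr0.
    by rewrite subrr scale1r scale0r add0r.
  move=> t _ _ /andP[t0 t1] [u + <-] [v + <-]; rewrite /= !in_itv /= => /andP[u0 u1] /andP[v0 v1].
  exists ((1 - t) * u + t * v); first by rewrite in_itv /=; apply/andP; split; nra.
  rewrite !scalerDr !scalerA addrACA -!scalerDl; congr (_ *: _ + _ *: _); ring.
move=> _ [t t01 <-]; apply: conv_hull_seg; first by move: t01; rewrite /= in_itv.
  by apply: conv_hull_sub; left.
by apply: conv_hull_sub; right.
Qed.

Lemma seg3E t (a b c a' b' c' : R) :
  (1 - t) *: (a, b, c) + t *: (a', b', c') =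
  ((1 - t) * a + t * a', (1 - t) * b + t * b', (1 - t) * c + t * c').
Proof. by []. Qed.

Lemma seg2E t (a b a' b' : R) :
  (1 - t) *: (a, b) + t *: (a', b') = ((1 - t) * a + t * a', (1 - t) * b + t * b').
Proof. by []. Qed.

End convexity.

(** * The band and the height of its roof *)

Section snake_geometry.
Context {R : realType} (y e : R).
Implicit Types (x Y t : R) (k n : nat).

Definition width (x : R) : R := y + e * x.
Definition widths (k : nat) : R := y + e / k%:R.
(** For odd k the slice at 1/k stands on a point A of the bottom edge; for even k it hangs from a
    point B of the top edge and begins at D. *)
Definition bottoms (k : nat) : R := if odd k then 0 else 1 - widths k.
Definition lo (x : R) : R := pl bottoms x.
Definition hi (x : R) : R := lo x + width x.
Definition zigzag (x : R) : R := pl (fun k => (~~ odd k)%:R) x.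
Definition mid (x : R) : R := lo x + width x / 2.
(** Ridge height 1/(2k) over the half width of the slice at 1/k, that is, the slope of the sides of
    the triangle standing there. *)
Definition slope (k : nat) : R := (k%:R * y + e)^-1.
(** On either side of the ridge the four vertices need not be coplanar, and the hull folds along the
    diagonal from the ridge at 1/k to the edge at 1/(k+1). The first term is the plane through both
    ridge points and the edge at 1/(k+1), the second the plane through both edges and the ridge at
    1/k; the roof is concave, hence the minimum. *)
Definition top (k : nat) (x Y : R) : R :=
  Num.min (x / 2 - slope k.+1 * `|Y - mid x|) (slope k * (width x / 2 - `|Y - mid x|)).

(* Height of the upper sheet over (x, Y), 0 outside of the band. *)
Definition height (x Y : R) : R :=
  if 0 < x <= 1 then Num.max 0 (top (idx x) x Y) else 0.

Definition admissible := [/\ 0 <= y, 0 <= e, 0 < y + e & y + e <= 1].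
Hypothesis ok : admissible.

Lemma width_itv x : 0 < x <= 1 -> 0 < width x <= 1.
Proof.
have [y0 e0 ye0 ye1] := ok.
move=> /andP[x0 x1]; have h1 : 0 < x * (y + e) by exact: mulr_gt0.
have h2 : 0 <= y * (1 - x) by rewrite mulr_ge0 // subr_ge0.
have h3 : 0 <= e * (1 - x) by rewrite mulr_ge0 // subr_ge0.
by rewrite /width; apply/andP; split; lra.
Qed.

Lemma invn_itv k : (0 < k)%N -> 0 < (k%:R^-1 : R) <= 1.
Proof. by move=> k0; rewrite invr_gt0 ltr0n k0 invf_le1 ?ltr0n // ler1n. Qed.

Lemma widths_itv k : (0 < k)%N -> 0 < widths k <= 1.
Proof. by move=> k0; exact: (width_itv (invn_itv k0)). Qed.

Lemma lo_ge0 x : 0 < x <= 1 -> 0 <= lo x.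
Proof.
move=> x01; rewrite -(pl_cst 0 x01); apply: pl_le => // k k0.
by rewrite /bottoms; case: ifP => // _; have := widths_itv k0; lra.
Qed.

Lemma widthE x : 0 < x <= 1 -> width x = pl widths x.
Proof. by move=> x01; rewrite pl_affine. Qed.

Lemma hi_le1 x : 0 < x <= 1 -> hi x <= 1.
Proof.
move=> x01; rewrite /hi widthE // -plD -(pl_cst 1 x01); apply: pl_le => // k k0.
by rewrite /bottoms; case: ifP => _; have := widths_itv k0; lra.
Qed.

Lemma lo_le_zigzag x : 0 < x <= 1 -> lo x <= zigzag x.
Proof.
move=> x01; apply: pl_le => // k k0.
by rewrite /bottoms; case: ifP => _ //=; have := widths_itv k0; lra.
Qed.

Lemma zigzag_le_hi x : 0 < x <= 1 -> zigzag x <= hi x.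
Proof.
move=> x01; rewrite /hi widthE // -plD; apply: pl_le => // k k0.
by rewrite /bottoms; case: ifP => _ //=; have := widths_itv k0; lra.
Qed.

Lemma zigzag_itv x : 0 < x <= 1 -> 0 <= zigzag x <= 1.
Proof.
move=> x01; rewrite -{1}(pl_cst 0 x01) -(pl_cst 1 x01).
by rewrite !pl_le // => k _; rewrite ?ler0n ?lern1 ?leq_b1.
Qed.

Lemma slope_gt0 k : (0 < k)%N -> 0 < slope k.
Proof.
have [y0 e0 ye0 ye1] := ok.
move=> k0; rewrite invr_gt0; have : (1 : R) <= k%:R by rewrite ler1n.
nra.
Qed.

Lemma slope_le k : (0 < k)%N -> slope k.+1 <= slope k.
Proof.
have [y0 e0 ye0 ye1] := ok.
move=> k0; have := slope_gt0 k0; have := slope_gt0 (ltn0Sn k).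
rewrite /slope !invr_gt0 => h1 h2; rewrite lef_pV2 ?posrE //.
by rewrite lerD2r ler_wpM2r // ler_nat.
Qed.

(** The difference of the two sides is a positive multiple of y (1 - k x), so the side of 1/k on
    which [x] lies decides its sign. *)
Lemma slope_width k x : (0 < k)%N -> k%:R * x <= 1 -> x / 2 <= slope k * (width x / 2).
Proof.
have [y0 e0 ye0 ye1] := ok.
move=> k0 kx; have := slope_gt0 k0; rewrite /slope invr_gt0 => h.
rewrite ler_pdivlMl // /width; nra.
Qed.

Lemma width_slope k x : (0 < k)%N -> 1 <= k%:R * x -> slope k * (width x / 2) <= x / 2.
Proof.
have [y0 e0 ye0 ye1] := ok.
move=> k0 kx; have := slope_gt0 k0; rewrite /slope invr_gt0 => h.
rewrite ler_pdivrMl // /width; nra.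
Qed.

Lemma top_gt0 k x Y : (0 < k)%N -> piece k x -> (0 < top k x Y) = (lo x < Y < hi x).
Proof.
move=> k0 /andP[h1 h2]; have s0 := slope_gt0 k0; have s1 := slope_gt0 (ltn0Sn k).
have := width_slope (ltn0Sn k) h2.
rewrite /top lt_min (pmulr_rgt0 _ s0) => h3.
have -> : (lo x < Y < hi x) = (`|Y - mid x| < width x / 2).
  by rewrite ltr_norml /mid /hi; apply/idP/idP => ?; lra.
apply/andP/idP => [[]|h]; first by lra.
by split; nra.
Qed.

Lemma top_ge0 k x Y : (0 < k)%N -> piece k x -> lo x <= Y <= hi x -> 0 <= top k x Y.
Proof.
move=> k0 /andP[h1 h2]; have s0 := slope_gt0 k0; have s1 := slope_gt0 (ltn0Sn k).
have := width_slope (ltn0Sn k) h2.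
rewrite /top le_min (pmulr_rge0 _ s0) => h3 lY.
have h : `|Y - mid x| <= width x / 2 by rewrite ler_norml /mid; move: lY; rewrite /hi; lra.
by apply/andP; split; nra.
Qed.

(** At the shared abscissa 1/(k+1) the ridge height is [slope k.+1] times the half width. Inside the
    band both formulas then give the tent of slope [slope k.+1], because slopes do not increase with
    the index; outside both are nonpositive and the maximum with 0 hides the difference. *)
Lemma height_piece k x Y : (0 < k)%N -> piece k x ->
  height x Y = Num.max 0 (top k x Y).
Proof.
move=> k0 pk; have x01 := piece_le1 k0 pk; rewrite /height x01.
case: (piece_eq k0 pk) => [->//|[kx ->]].
have s1 := slope_gt0 (ltn0Sn k); have s2 := slope_gt0 (ltn0Sn k.+1).
have s0 := slope_gt0 k0; have s01 := slope_le k0; have s12 := slope_le (ltn0Sn k).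
rewrite /top; set d := `|Y - mid x|.
have -> : x / 2 = slope k.+1 * (width x / 2).
  by apply/eqP; rewrite eq_le slope_width ?width_slope ?kx.
set a := slope k in s0 s01 *; set b := slope k.+1 in s1 s01 s12 *.
set c := slope k.+2 in s2 s12 *; set v := width x / 2.
have d0 : 0 <= d by exact: normr_ge0.
have [dv|dv] := leP d v.
  have h1 : 0 <= (b - c) * d by rewrite mulr_ge0 // subr_ge0.
  have h2 : 0 <= (a - b) * (v - d) by rewrite mulr_ge0 // subr_ge0.
  rewrite (_ : Num.min (b * v - c * d) _ = b * (v - d)); last by rewrite min_r //; lra.
  rewrite (_ : Num.min (b * v - b * d) _ = b * v - b * d); last by rewrite min_l //; lra.
  by rewrite mulrBr.
have h1 : 0 <= b * (d - v) by rewrite mulr_ge0 // ltW // subr_gt0.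
have h2 : 0 <= a * (d - v) by rewrite mulr_ge0 // ltW // subr_gt0.
by rewrite !max_l // ge_min; apply/orP; right; lra.
Qed.

Lemma height_gt0 x Y : 0 < x <= 1 -> (0 < height x Y) = (lo x < Y < hi x).
Proof.
move=> x01; have [k0 _] := idx_itv x01; have pk := piece_idx x01.
by rewrite (height_piece _ k0 pk) lt_max ltxx /= top_gt0.
Qed.

Lemma height_ge0 x Y : 0 <= height x Y.
Proof. by rewrite /height; case: ifP => // _; rewrite le_max lexx. Qed.

Lemma height_eq0 x Y : 0 < x <= 1 -> height x Y = 0 -> Y <= lo x \/ hi x <= Y.
Proof.
move=> x01 h0; have := height_gt0 Y x01; rewrite h0 ltxx => /esym/negbT.
by rewrite negb_and -!leNgt => /orP[]; [left|right].
Qed.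

Lemma height0 x Y : 0 < x <= 1 -> Y <= lo x \/ hi x <= Y -> height x Y = 0.
Proof.
move=> x01 h; apply/eqP; rewrite eq_le height_ge0 andbT leNgt height_gt0 //.
by apply/negP => /andP[? ?]; case: h; lra.
Qed.

Lemma height_x0 Y : height 0 Y = 0.
Proof. by rewrite /height ltxx. Qed.

(** The bound by a multiple of the abscissa that gives continuity at the left edge. *)
Lemma height_le x Y : 0 <= x -> height x Y <= x / 2.
Proof.
move=> x0; rewrite /height; case: ifP => [x01|_]; last by lra.
have [k0 _] := idx_itv x01.
rewrite ge_max; apply/andP; split; first by lra.
rewrite /top ge_min; apply/orP; left.
by rewrite lerBlDr lerDl mulr_ge0 // ltW // slope_gt0.
Qed.

Lemma cts_lo (U : topologicalType) (A : set U) (p : U -> R) : continuous p ->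
  (forall u, A u -> 0 < p u <= 1) -> {within A, continuous (fun u => lo (p u))}.
Proof. exact: cts_pl. Qed.

Lemma cts_width (U : topologicalType) (A : set U) (p : U -> R) : continuous p ->
  {within A, continuous (fun u => width (p u))}.
Proof.
by move=> cp; have cp' := @continuous_subspaceT _ _ A _ cp; rewrite /width; cts.
Qed.

Lemma cts_height : {within unit_square R, continuous (fun p : R * R => height p.1 p.2)}.
Proof.
have sq (u : R * R) : unit_square R u -> 0 <= u.1 <= 1 /\ 0 <= u.2 <= 1.
  by case=> /=; rewrite /unit_itv /= !in_itv.
apply: (@cts_squeeze _ _ _ fst _ (fun=> 0) (2^-1)).
- by move=> u; exact: cvg_fst.
- exact: cts_cst.
- by move=> u /sq[/andP[]].
- move=> u /sq[/andP[u0 _] _]; rewrite subr0 ger0_norm ?height_ge0 //.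
  by rewrite mulrC; exact: height_le.
have A01 (u : R * R) : (unit_square R `&` [set u | 0 < u.1]) u -> 0 < u.1 <= 1.
  by case=> /sq[/andP[_ ->]] _ /= ->.
have cf : continuous (fst : R * R -> R) by move=> u; exact: cvg_fst.
apply: (cts_pieces cf A01) => k k0.
apply: (@cts_eq _ _ _ (fun u : R * R => Num.max 0 (top k u.1 u.2))).
  by move=> u [_ pk]; rewrite (height_piece _ k0).
have c1 : {within unit_square R `&` [set u | 0 < u.1] `&` fst @^-1` piece k,
    continuous (fun u : R * R => mid u.1)}.
  apply: cts_D; first by apply: cts_lo => // u [/A01].
  by apply: cts_M; [exact: cts_width|exact: cts_cst].
by rewrite /top; cts; exact: cts_width.
Qed.

(** Continuity of [height] is available on the square; truncating both coordinates turns it into the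
    globally continuous height that the lemmas on doubles ask for. *)
Definition sheet (p : R * R) : R := height (clamp p.1) (clamp p.2).

Lemma continuous_sheet : continuous sheet.
Proof.
apply/continuous_subspace_setT.
apply: (@cts_comp _ _ _ _ _ (fun p : R * R => (clamp p.1, clamp p.2)) _ _ cts_height).
  by apply: cts_pair; (apply: cts_after; [exact: continuous_clamp|cts]).
by move=> p _; split; rewrite /= /unit_itv /= in_itv /= clamp01.
Qed.

Lemma unit_squareP (u : R * R) : unit_square R u <-> 0 <= u.1 <= 1 /\ 0 <= u.2 <= 1.
Proof. by rewrite /unit_square /unit_itv; split; case=> /=; rewrite !in_itv. Qed.

Lemma sheetE (u : R * R) : unit_square R u -> sheet u = height u.1 u.2.
Proof. by move=> /unit_squareP[h1 h2]; rewrite /sheet !clampE. Qed.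

End snake_geometry.

(** * The prisms as regions under the roof *)

Section snake_hulls.
Context {R : realType} (y e : R).
Implicit Types (x Y t : R) (k n : nat).
Hypothesis ok : admissible y e.

Notation bottoms := (bottoms y e).
Notation widths := (widths y e).
Notation slope := (slope y e).
Notation lo := (lo y e).
Notation hi := (hi y e).
Notation mid := (mid y e).
Notation width := (width y e).
Notation top := (top y e).

(** Uniform names for the vertices at abscissa 1/k: bottom, top and ridge are A, C, E for odd k and
    D, B, F for even k. *)
Definition vbot k : R * R * R := (k%:R^-1, bottoms k, 0).
Definition vtop k : R * R * R := (k%:R^-1, bottoms k + widths k, 0).
Definition vridge k : R * R * R := (k%:R^-1, bottoms k + widths k / 2, k%:R^-1 / 2).

Definition prism k : set (R * R * R) :=
  conv_hull [set vbot k; vtop k; vridge k; vbot k.+1; vtop k.+1; vridge k.+1].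

Lemma slope_widths k : (0 < k)%N -> slope k * widths k = k%:R^-1.
Proof.
move=> k0; have := slope_gt0 ok k0; rewrite /slope /widths invr_gt0 => h.
by field; rewrite (gt_eqF h) pnatr_eq0 -lt0n k0.
Qed.

Lemma lo_piece k x : (0 < k)%N -> piece k x ->
  lo x = (1 - wt k x) * bottoms k + wt k x * bottoms k.+1.
Proof. exact: plE. Qed.

Lemma lo_seg k x x' t : (0 < k)%N -> 0 <= t <= 1 -> piece k x -> piece k x' ->
  lo ((1 - t) * x + t * x') = (1 - t) * lo x + t * lo x'.
Proof. exact: pl_seg. Qed.

Lemma width_piece k x : (0 < k)%N ->
  width x = (1 - wt k x) * widths k + wt k x * widths k.+1.
Proof.
by move=> k0; rewrite /width [in LHS](wt_x x k0) /widths; set f := wt k x; ring.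
Qed.

Lemma width_seg x x' t : width ((1 - t) * x + t * x') = (1 - t) * width x + t * width x'.
Proof. by rewrite /width; ring. Qed.

Definition prism_region k : set (R * R * R) :=
  [set p | [/\ piece k p.1.1, lo p.1.1 <= p.1.2 <= hi p.1.1 &
               0 <= p.2 <= top k p.1.1 p.1.2]].

Lemma top_le k x Y z : (z <= top k x Y) =
  (z <= x / 2 - slope k.+1 * `|Y - mid x|) && (z <= slope k * (width x / 2 - `|Y - mid x|)).
Proof. by rewrite /top le_min. Qed.

(** On one piece [lo] and [width] are affine, hence the distance to the middle line is convex and
    both terms of [top] are concave. *)
Lemma prism_region_convex k (t : R) p q : (0 < k)%N -> 0 <= t <= 1 ->
  prism_region k p -> prism_region k q -> prism_region k ((1 - t) *: p + t *: q).
Proof.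
move=> k0 t01; case: p q => [[x Y] z] [[x' Y'] z'].
rewrite seg3E /prism_region /= !top_le => -[px lY /and3P[z0 z1 z2]].
move=> [px' lY' /and3P[z0' z1' z2']].
have s0 := slope_gt0 ok k0; have s1 := slope_gt0 ok (ltn0Sn k).
have [t0 t1] := andP t01.
rewrite /mid /hi in lY lY' z1 z2 z1' z2' *.
rewrite (lo_seg k0 t01 px px') width_seg.
set L := lo x in lY z1 z2 *; set L' := lo x' in lY' z1' z2' *.
set W := width x in lY z1 z2 *; set W' := width x' in lY' z1' z2' *.
split; first exact: piece_seg.
  by apply/andP; split; nra.
set D := `|Y - _| in z1 z2; set D' := `|Y' - _| in z1' z2'; set D'' := `|_ - _|.
have hD : D'' <= (1 - t) * D + t * D'.
  rewrite /D'' (_ : _ - _ = (1 - t) * (Y - (L + W / 2)) + t * (Y' - (L' + W' / 2))); last by ring.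
  by apply: le_trans (ler_normD _ _) _; rewrite !normrM (ger0_norm t0) (@ger0_norm _ (1 - t)) ?subr_ge0.
have h1 : 0 <= slope k * ((1 - t) * D + t * D' - D'') by rewrite mulr_ge0 ?subr_ge0 // ltW.
have h2 : 0 <= slope k.+1 * ((1 - t) * D + t * D' - D'') by rewrite mulr_ge0 ?subr_ge0 // ltW.
by apply/and3P; split; nra.
Qed.

Lemma lo_V k : (0 < k)%N -> lo k%:R^-1 = bottoms k.
Proof. exact: pl_V. Qed.

Lemma prism_sub k : (0 < k)%N -> prism k `<=` prism_region k.
Proof.
move=> k0; apply: conv_hull_min; first by move=> t p q; exact: prism_region_convex.
have vert (j : nat) : (0 < j)%N -> piece k (j%:R^-1 : R) -> [/\ prism_region k (vbot j),
    prism_region k (vtop j) & prism_region k (vridge j)].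
  move=> j0 pj; have w0 := widths_itv ok j0.
  have W : width j%:R^-1 = widths j by [].
  have H : hi j%:R^-1 = bottoms j + widths j by rewrite /hi (lo_V j0).
  have tj (u : R) : 0 <= u <= 1 ->
      0 <= top k j%:R^-1 (bottoms j + widths j * u).
    move=> u01; apply: (top_ge0 ok k0 pj); rewrite H (lo_V j0).
    by have [u0 u1] := andP u01; have [w1 _] := andP w0; apply/andP; split; nra.
  split; split => //=; rewrite ?H ?lo_V //.
  - by lra.
  - by have := tj 0; rewrite mulr0 addr0 lexx => ->; rewrite ?lexx ?ler01.
  - by lra.
  - by have := tj 1; rewrite mulr1 lexx => ->; rewrite ?lexx ?ler01.
  - by lra.
  - rewrite top_le /mid lo_V // W subrr normr0 mulr0 !subr0 lexx /=.
    case/andP: pj => h1 _; have := slope_width ok k0 h1; rewrite W => ->.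
    by rewrite divr_ge0 ?invr_ge0 ?ler0n.
have [b1 t1 r1] := vert k k0 (piece_V k0).
have [b2 t2 r2] := vert k.+1 (ltn0Sn k) (piece_VS k0).
by move=> p [[[[[]|]|]|]|] ->.
Qed.

(** Each point lies on a vertical segment from the base of the prism to its roof, and both ends of
    the segment are iterated convex combinations of vertices. *)
Lemma region_sub k : (0 < k)%N -> prism_region k `<=` prism k.
Proof.
move=> k0 [[x Y] z] [/= pk lY]; rewrite top_le => /and3P[z0 z1 z2].
have C1 : prism k (vbot k) by apply: conv_hull_sub; do 5 left.
have C2 : prism k (vtop k) by apply: conv_hull_sub; do 4 left; right.
have C3 : prism k (vridge k) by apply: conv_hull_sub; do 3 left; right.
have C4 : prism k (vbot k.+1) by apply: conv_hull_sub; do 2 left; right.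
have C5 : prism k (vtop k.+1) by apply: conv_hull_sub; left; right.
have C6 : prism k (vridge k.+1) by apply: conv_hull_sub; right.
have f01 := wt_itv pk; have Lx := lo_piece k0 pk; have Wx := width_piece x k0.
have xE := wt_x x k0; have w0 := widths_itv ok k0; have w1 := widths_itv ok (ltn0Sn k).
have sw := slope_widths k0; have sw1 := slope_widths (ltn0Sn k).
have Wp := width_itv ok (piece_le1 k0 pk).
have [f0 f1] := andP f01.
have seg_id (r a : R) : (1 - r) * a + r * a = a by ring.
have seg := @conv_hull_seg R (R * R * R)%type _.
have CL : prism k (x, lo x, 0).
  have := seg _ _ _ _ f01 C1 C4; rewrite seg3E -Lx mulr0 mulr0 addr0.
  by rewrite -[_ * _ + _]xE.
have CH : prism k (x, hi x, 0).
  have := seg _ _ _ _ f01 C2 C5; rewrite seg3E mulr0 mulr0 addr0.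
  rewrite -[_ / _ + _]xE; congr (prism k (_, _, _)).
  by rewrite /hi Lx Wx; ring.
have CY : prism k (x, Y, 0).
  have u01 : 0 <= (Y - lo x) / width x <= 1.
    rewrite divr_ge0 ?subr_ge0; [|lra..].
    by rewrite ler_pdivrMr ?mul1r /=; move: lY; rewrite /hi; lra.
  have := seg _ _ _ _ u01 CL CH; rewrite seg3E.
  have [Wp0 _] := andP Wp.
  by congr (prism k (_, _, _)); rewrite ?/hi; field; rewrite gt_eqF.
suff [z' zz' C] : exists2 z', z <= z' & prism k (x, Y, z').
  have v01 : 0 <= z / z' <= 1.
    rewrite divr_ge0 ?(le_trans z0) //=; have [->|zn0] := eqVneq z' 0.
      by rewrite invr0 mulr0 ler01.
    by rewrite ler_pdivrMr ?mul1r // lt_def zn0 (le_trans z0).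
  have := seg _ _ _ _ v01 CY C; rewrite seg3E; congr (prism k (_, _, _)); try ring.
  have [z'0|zn0] := eqVneq z' 0; last by field.
  have -> : z = 0 by apply/eqP; rewrite eq_le z0 andbT -z'0.
  by rewrite !mul0r mulr0 addr0.
pose m j : R := bottoms j + widths j / 2.
have mE : mid x = (1 - wt k x) * m k + wt k x * m k.+1.
  by rewrite /mid Lx Wx /m; ring.
set d := `|Y - mid x| in z1 z2.
(* [s] is the side of the ridge, 1 or -1; the two prism points are the edge vertices on that side,
   written relative to the midpoints [m]. *)
have [s [sd vk vk1]] : exists s : R, [/\ Y = mid x + s * d,
    prism k (k%:R^-1, m k + s * (widths k / 2), 0) &
    prism k (k.+1%:R^-1, m k.+1 + s * (widths k.+1 / 2), 0)].
  have [Ym|Ym] := leP (mid x) Y.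
    exists 1; split; first by rewrite /d ger0_norm; lra.
      by move: C2; congr (prism k (_, _, _)); rewrite /m; lra.
    by move: C5; congr (prism k (_, _, _)); rewrite /m; lra.
  exists (-1); split; first by rewrite /d ltr0_norm; lra.
    by move: C1; congr (prism k (_, _, _)); rewrite /m; lra.
  by move: C4; congr (prism k (_, _, _)); rewrite /m; lra.
have d0 : 0 <= d by exact: normr_ge0.
have dW : d <= width x / 2.
  by rewrite /d ler_norml /mid; move: lY; rewrite /hi; lra.
set f := wt k x in f01 Lx Wx xE f0 f1 mE.
(* At abscissa [x] the diagonal from the ridge at 1/k to the edge at 1/(k+1) is at distance [a2]
   from the middle line, so comparing [d] with [a2] selects the roof triangle over the point. *)
pose a1 := (1 - f) * (widths k / 2); pose a2 := f * (widths k.+1 / 2).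
have a10 : 0 <= a1 by rewrite mulr_ge0 //; lra.
have a20 : 0 <= a2 by rewrite mulr_ge0 //; lra.
have aW : a1 + a2 = width x / 2 by rewrite Wx /a1 /a2; ring.
have [da|da] := leP d a2.
  exists (x / 2 - slope k.+1 * d) => //.
  have [r r01 rE] : exists2 r : R, 0 <= r <= 1 & r * a2 = d.
    have [a2z|a2n] := eqVneq a2 0; first by exists 0; rewrite ?lexx ?ler01 //; lra.
    have a2p : 0 < a2 by rewrite lt_def a2n.
    by exists (d / a2); [rewrite divr_ge0 // ler_pdivrMr // mul1r|field].
  have C7 := seg _ _ _ _ r01 C6 vk1; rewrite /vridge seg3E in C7.
  have := seg _ _ _ _ f01 C3 C7; rewrite seg3E.
  congr (prism k (_, _, _)).
  - by rewrite seg_id.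
  - by rewrite sd mE -rE /a2 /m; ring.
  - by rewrite -rE /a2 [in RHS]xE mulr0 addr0 -sw -sw1; ring.
exists (slope k * (width x / 2 - d)) => //.
have [r r01 rE] : exists2 r : R, 0 <= r <= 1 & r * a1 = d - a2.
  have [a1z|a1n] := eqVneq a1 0; first by exists 0; rewrite ?lexx ?ler01 //; lra.
  have a1p : 0 < a1 by rewrite lt_def a1n.
  exists ((d - a2) / a1); last by field.
  by rewrite divr_ge0 ?subr_ge0 ?(ltW da) // ler_pdivrMr // mul1r; lra.
have C7 := seg _ _ _ _ r01 C3 vk; rewrite /vridge seg3E in C7.
have := seg _ _ _ _ f01 C7 vk1; rewrite seg3E.
congr (prism k (_, _, _)).
- by rewrite seg_id.
- rewrite sd mE (_ : d = r * a1 + a2); last by lra.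
  by rewrite /a1 /a2 /m; ring.
- rewrite -aW (_ : d = r * a1 + a2); last by lra.
  by rewrite /a1 !mulr0 !addr0 -sw; ring.
Qed.

Lemma prismE k : (0 < k)%N -> prism k = prism_region k.
Proof. by move=> k0; apply/seteqP; split; [exact: prism_sub|exact: region_sub]. Qed.

End snake_hulls.

(** * The boundary of the tower and its open end *)

Section snake_set.
Context {R : realType} (y e : R).
Implicit Types (x Y t z : R) (k n : nat).
Hypothesis ok : admissible y e.

Lemma natr_odd n : (n.*2.+1)%:R = 2 * n.+1%:R - 1 :> R.
Proof. by rewrite -addn1 -mul2n natrD natrM -[n.+1]addn1 natrD; ring. Qed.

Lemma natr_even n : (n.*2.+2)%:R = 2 * n.+1%:R :> R.
Proof. by rewrite -natrM mul2n. Qed.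

Lemma snakeA_vbot n : snakeA R n.+1 = vbot y e n.*2.+1.
Proof. by rewrite /snakeA /vbot /bottoms /= odd_double /= natr_odd. Qed.

Lemma snakeC_vtop n : snakeC y e n.+1 = vtop y e n.*2.+1.
Proof. by rewrite /snakeC /vtop /bottoms /widths /= odd_double /= natr_odd add0r. Qed.

Lemma snakeE_vridge n : snakeE y e n.+1 = vridge y e n.*2.+1.
Proof.
rewrite /snakeE /vridge /bottoms /widths /= odd_double /= natr_odd add0r.
by congr (_, _, _); [rewrite mulrC|rewrite invfM mulrC].
Qed.

Lemma snakeB_vtop n : snakeB R n.+1 = vtop y e n.*2.+2.
Proof. by rewrite /snakeB /vtop /bottoms /= odd_double /= natr_even subrK. Qed.

Lemma snakeD_vbot n : snakeD y e n.+1 = vbot y e n.*2.+2.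
Proof.
rewrite /snakeD /vbot /bottoms /widths /= odd_double /= natr_even.
by congr (_, _, _); ring.
Qed.

Lemma snakeF_vridge n : snakeF y e n.+1 = vridge y e n.*2.+2.
Proof.
rewrite /snakeF /vridge /bottoms /widths /= odd_double /= natr_even.
have : n.+1%:R != 0 :> R by rewrite pnatr_eq0.
by move: n.+1%:R => m m0; congr (_, _, _); field.
Qed.

Lemma snakeHodd_prism n : snakeHodd y e n.+1 = prism y e n.*2.+1.
Proof.
rewrite /snakeHodd snakeA_vbot snakeC_vtop snakeE_vridge snakeB_vtop snakeD_vbot.
rewrite snakeF_vridge /prism; congr conv_hull.
by apply/seteqP; split => p /=; intuition.
Qed.

Lemma snakeHeven_prism n : snakeHeven y e n.+1 = prism y e n.*2.+2.
Proof.
rewrite /snakeHeven !snakeA_vbot !snakeC_vtop !snakeE_vridge snakeB_vtop snakeD_vbot.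
rewrite snakeF_vridge /prism doubleS; congr conv_hull.
by apply/seteqP; split => p /=; intuition.
Qed.

Lemma snakeHP (p : R * R * R) : snakeH y e p <->
  [/\ 0 < p.1.1 <= 1, lo y e p.1.1 <= p.1.2 <= hi y e p.1.1 &
      0 <= p.2 <= height y e p.1.1 p.1.2].
Proof.
have regP k : (0 < k)%N -> prism y e k p ->
    [/\ 0 < p.1.1 <= 1, lo y e p.1.1 <= p.1.2 <= hi y e p.1.1 &
      0 <= p.2 <= height y e p.1.1 p.1.2].
  move=> k0; rewrite prismE // => -[pk lY /andP[z0 z1]]; split => //.
    exact: piece_le1 pk.
  by rewrite (height_piece ok _ k0 pk) z0 le_max z1 orbT.
split.
  move=> [[//|n] _ []].
    by rewrite snakeHodd_prism; exact: regP.
  by rewrite snakeHeven_prism; exact: regP.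
move=> [x01 lY z01]; have [k0 _] := idx_itv x01; have pk := piece_idx x01.
have : prism y e (idx p.1.1) p.
  rewrite prismE //; split => //; move: z01.
  by rewrite (height_piece ok _ k0 pk) max_r // top_ge0.
move: (idx _) k0 => [//|k] _; rewrite -[k]odd_double_half.
case: (odd k) => /=; rewrite ?add0n ?add1n => pp; exists (k./2).+1 => //.
  by right; rewrite snakeHeven_prism.
by left; rewrite snakeHodd_prism.
Qed.

(** The triangle is the end slice x = 1 of the tower, whose roof there is the tent of half width
    [W]; off the three edges means strictly between floor and tent. *)
Lemma end_triangleP (p : R * R * R) :
  open_triangle (snakeA R 1) (snakeC y e 1) (snakeE y e 1) p <->
  p.1.1 = 1 /\ 0 < p.2 < height y e 1 p.1.2.
Proof.
have [y0 e0 ye0 ye1] := ok.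
pose W := (y + e) / 2; have W0 : 0 < W by rewrite /W; lra.
have A : snakeA R 1 = (1, 0, 0) by rewrite /snakeA mulr1 (_ : 2 - 1 = 1) ?invr1 //; ring.
have C : snakeC y e 1 = (1, 2 * W, 0).
  by rewrite /snakeC mulr1 (_ : 2 - 1 = 1) ?invr1 /W //; [congr (_, _, _); field|ring].
have E : snakeE y e 1 = (1, W, 2^-1).
  by rewrite /snakeE mulr1 (_ : 2 - 1 = 1) ?invr1 /W ?mulr1 //; [congr (_, _, _); field|ring].
rewrite A C E {A C E}.
have hE Y : 0 < height y e 1 Y -> height y e 1 Y = Num.min Y (2 * W - Y) / (2 * W).
  move=> h0; have p1 : piece 1 (1 : R) by rewrite /piece /= mul1r lexx mulr1 ler1n.
  have := h0; rewrite height_gt0 ?lexx ?ltr01 // => lY.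
  have t0 : 0 < top y e 1 1 Y by rewrite top_gt0.
  rewrite (height_piece ok _ _ p1) // max_r; last exact: ltW.
  have lo1 : lo y e 1 = 0.
    by have := pl_V (bottoms y e) (isT : (0 < 1)%N); rewrite invr1 /bottoms.
  have w1 : width y e 1 = 2 * W by rewrite /width /W; field.
  rewrite /hi lo1 w1 in lY.
  have s1 : slope y e 1 = (2 * W)^-1 by rewrite /slope /W mul1r; congr (_^-1); field.
  have s2 := slope_le ok (isT : (0 < 1)%N).
  have s0 := slope_gt0 ok (isT : (0 < 1)%N).
  have eW : slope y e 1 * (2 * W) = 1 by rewrite s1 mulVf // gt_eqF //; lra.
  rewrite /top /mid lo1 w1 add0r (_ : 2 * W / 2 = W); last by field.
  have dE : W - `|Y - W| = Num.min Y (2 * W - Y).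
    by have [h|h] := leP Y W; [rewrite ler0_norm ?min_l|rewrite gtr0_norm ?min_r]; lra.
  have dn : 0 <= `|Y - W| by exact: normr_ge0.
  have hm : slope y e 1 * (W - `|Y - W|) <= 1 / 2 - slope y e 2 * `|Y - W| by nra.
  by rewrite (min_r hm) dE s1 mulrC.
have hP Y z : 0 < z -> z < height y e 1 Y <-> 2 * W * z < Y /\ 2 * W * z < 2 * W - Y.
  move=> z0; split.
    move=> zh; move: (zh); rewrite hE; last exact: lt_trans zh.
    by rewrite ltr_pdivlMr ?lt_min 1?(mulrC z) => [/andP[]//|]; lra.
  move=> [h1 h2]; have h0 : 0 < height y e 1 Y.
    have lo1 : lo y e 1 = 0.
      by have := pl_V (bottoms y e) (isT : (0 < 1)%N); rewrite invr1 /bottoms.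
    have zW : 0 < 2 * W * z by rewrite mulr_gt0 //; lra.
    rewrite height_gt0 ?lexx ?ltr01 // /hi lo1 /width.
    by rewrite /W in h1 h2 zW; apply/andP; split; lra.
  by rewrite hE // ltr_pdivlMr ?lt_min 1?(mulrC z) ?h1 ?h2 //; lra.
have seg := @conv_hull_seg R (R * R * R)%type _.
pose tri : set (R * R * R) := [set q | [/\ q.1.1 = 1, 0 <= q.2,
  2 * W * q.2 <= q.1.2 & 2 * W * q.2 <= 2 * W - q.1.2]].
have triS : conv_hull [set (1, 0, 0); (1, 2 * W, 0); (1, W, 2^-1)] `<=` tri.
  apply: conv_hull_min.
    move=> t [[a b] c] [[a' b'] c'] /andP[t0 t1] [/= a1 c0 h1 h2] [/= a1' c0' h1' h2'].
    rewrite seg3E; split => /=; [by rewrite a1 a1'; ring|nra|nra|nra].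
  by move=> q [[]|] ->; split => //=; lra.
split.
  move=> [pt pe]; have [x1 z0 h1 h2] := triS _ pt.
  case: p pt pe x1 z0 h1 h2 => [[x Y] z] /= _ pe x1 z0 h1 h2; rewrite x1 in pe; split => //.
  have zn : z != 0.
    apply/eqP => z0'; apply: pe; left; left; rewrite conv_hull2.
    rewrite z0' mulr0 in h1 h2.
    exists (Y / (2 * W)); rewrite ?seg3E /= ?in_itv /=.
      by rewrite divr_ge0 ?ler_pdivrMr ?mul1r; lra.
    have tY : Y / (2 * W) * (2 * W) = Y by rewrite divfK // gt_eqF //; lra.
    by move: (Y / _) tY => t tY; rewrite z0'; congr (_, _, _); [ring|rewrite -tY|]; ring.
  have z0' : 0 < z by rewrite lt_def zn.
  have z2 : 0 <= 2 * z <= 1 by apply/andP; split; nra.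
  rewrite z0' /=; apply/hP => //; split; rewrite lt_neqAle ?h1 ?h2 andbT; apply/eqP => ez; apply: pe.
    right; rewrite conv_hull2; exists (2 * z); rewrite ?seg3E /= ?in_itv //=.
    by rewrite -ez; congr (_, _, _); field.
  left; right; rewrite conv_hull2; exists (2 * z); rewrite ?seg3E /= ?in_itv //=.
  by rewrite (_ : Y = 2 * W - 2 * W * z); [congr (_, _, _); field|lra].
case: p => [[x Y] z] /= [-> /andP[z0 /(hP _ _ z0)[h1 h2]]].
pose tr : set (R * R * R) := [set (1, 0, 0); (1, 2 * W, 0); (1, W, 2^-1)].
split.
  have C1 : conv_hull tr (1, 0, 0) .
    by apply: conv_hull_sub; left; left.
  have C2 : conv_hull tr (1, 2 * W, 0) .
    by apply: conv_hull_sub; left; right.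
  have C3 : conv_hull tr (1, W, 2^-1) .
    by apply: conv_hull_sub; right.
  have z2 : 0 <= 2 * z <= 1 by apply/andP; split; nra.
  have t1 : 0 < 1 - 2 * z by nra.
  have u01 : 0 <= (Y - 2 * W * z) / (2 * W * (1 - 2 * z)) <= 1.
    rewrite divr_ge0 ?ler_pdivrMr ?mul1r /= ?mulr_gt0 //; nra.
  have C4 := seg _ _ _ _ u01 C1 C2; rewrite seg3E in C4.
  have := seg _ _ _ _ z2 C4 C3; rewrite seg3E.
  by congr (conv_hull tr (_, _, _)); field; rewrite ?gt_eqF.
have eq0 : 2 * W * z <> 0 by apply/eqP; rewrite gt_eqF // !mulr_gt0.
by case=> [[]|]; rewrite conv_hull2 => -[t _]; rewrite seg3E => -[_ hY hz]; move: h1 h2; rewrite -hY -hz; nra.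
Qed.

(** The conditions of [snakeHP] are not closed at the left edge, where the prisms accumulate. The
    larger set [K] is cut out by weak inequalities between continuous functions, so it is closed,
    and it still bounds the height. *)
Lemma snakeH_sub_closed :
  closure (snakeH y e) `<=` [set p | unit_square R p.1 /\ 0 <= p.2 <= sheet y e p.1].
Proof.
set K := [set p | _].
have cK : closed K.
  have cS := @continuous_sheet _ _ _ ok.
  have -> : K = (fun p : R * R * R => p.1.1) @^-1` [set` `[0, 1]] `&`
      (fun p : R * R * R => p.1.2) @^-1` [set` `[0, 1]] `&`
      snd @^-1` [set z | 0 <= z] `&`
      (fun p : R * R * R => sheet y e p.1 - p.2) @^-1` [set z | 0 <= z].
    apply/seteqP; split => p /=.
      move=> [/unit_squareP[h1 h2] /andP[h3 h4]]; rewrite !in_itv /=.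
      by split => //; rewrite subr_ge0.
    rewrite !in_itv /= subr_ge0 => -[[[h1 h2] h3] h4]; split; last exact/andP.
    exact/unit_squareP.
  have c11 : continuous (fun p : R * R * R => p.1.1).
    by move=> p; apply: (@continuous_comp _ _ _ fst fst); exact: cvg_fst.
  have c12 : continuous (fun p : R * R * R => p.1.2).
    by move=> p; apply: (@continuous_comp _ _ _ fst snd); [exact: cvg_fst|exact: cvg_snd].
  apply: closedI; [apply: closedI; [apply: closedI|]|].
  - by apply: preimage_closed; [move=> p _; exact: c11|exact: itv_closed].
  - by apply: preimage_closed; [move=> p _; exact: c12|exact: itv_closed].
  - by apply: preimage_closed; [move=> p _; exact: cvg_snd|exact: closed_ge].
  - apply: preimage_closed; last exact: closed_ge.
    move=> p _; apply: cvgB; last exact: cvg_snd.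
    by apply: (@continuous_comp _ _ _ fst (sheet y e)); [exact: cvg_fst|exact: cS].
rewrite (closure_id K).1 //; apply: closureS => p /snakeHP[x01 lY z01].
have [lo0 hi1] := (lo_ge0 ok x01, hi_le1 ok x01).
have sq : unit_square R p.1.
  by apply/unit_squareP; case/andP: x01 => ? ?; split; apply/andP; split; lra.
by split => //; rewrite sheetE.
Qed.

(** The strict inequalities persist near the point, by continuity of [sheet], and a positive height
    already forces a position inside the band. *)
Lemma interior_snakeH (p : R * R * R) : unit_square R p.1 ->
  p.1.1 < 1 -> 0 < p.2 < sheet y e p.1 -> interior (snakeH y e) p.
Proof.
move=> sq x1 /andP[z0 zh].
have cS := @continuous_sheet _ _ _ ok.
have hp : 0 < height y e p.1.1 p.1.2 by rewrite -sheetE //; exact: lt_trans zh.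
have xp : 0 < p.1.1 <= 1.
  move: hp; rewrite /height; case: ifP => //.
  by rewrite ltxx.
have := hp; rewrite height_gt0 // => /andP[lY Yh].
have lo0 := lo_ge0 ok xp; have hi1 := hi_le1 ok xp.
have c11 : continuous (fun p : R * R * R => p.1.1).
  by move=> q; apply: (@continuous_comp _ _ _ fst fst); exact: cvg_fst.
have c12 : continuous (fun p : R * R * R => p.1.2).
  by move=> q; apply: (@continuous_comp _ _ _ fst snd); [exact: cvg_fst|exact: cvg_snd].
have near_gt (f : R * R * R -> R) (c : R) : continuous f -> c < f p ->
    nbhs p [set q | c < f q].
  move=> cf fp; apply: open_nbhs_nbhs; split => //.
  by apply: (@open_comp _ _ f [set r | c < r]); [move=> q _; exact: cf|exact: open_gt].
have near_lt (f : R * R * R -> R) (c : R) : continuous f -> f p < c ->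
    nbhs p [set q | f q < c].
  move=> cf fp; apply: open_nbhs_nbhs; split => //.
  by apply: (@open_comp _ _ f [set r | r < c]); [move=> q _; exact: cf|exact: open_lt].
have n1 := near_gt _ _ c11 (andP xp).1; have n2 := near_lt _ _ c11 x1.
have n3 := near_gt _ 0 c12 (le_lt_trans lo0 lY).
have n4 := near_lt _ 1 c12 (lt_le_trans Yh hi1).
have c2 : continuous (snd : R * R * R -> R) by move=> q; exact: cvg_snd.
have n5 := near_gt _ _ c2 z0.
have c3 : continuous (fun p : R * R * R => sheet y e p.1 - p.2).
  move=> q; apply: cvgB; last exact: cvg_snd.
  by apply: (@continuous_comp _ _ _ fst (sheet y e)); [exact: cvg_fst|exact: cS].
have n6 : nbhs p [set q : R * R * R | 0 < sheet y e q.1 - q.2].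
  by apply: near_gt => //; rewrite subr_gt0.
apply: filterS3 (filterI n1 n2) (filterI n3 n4) (filterI n5 n6).
move=> q /= [q1 q2] [q3 q4] [q5 q6]; apply/snakeHP.
have sqq : unit_square R q.1 by apply/unit_squareP; split; apply/andP; split; exact: ltW.
have xq : 0 < q.1.1 <= 1 by rewrite q1 ltW.
rewrite subr_gt0 sheetE // in q6.
have := lt_trans q5 q6; rewrite height_gt0 // => /andP[? ?].
by split => //; apply/andP; split; exact: ltW.
Qed.

Lemma snake_setE : snake_set y e = dbl (unit_square R) (sheet y e).
Proof.
apply/seteqP; split => p.
  move=> [[[sq /= p0]|[cp np]] nt]; first by split => //; left.
  have [sq /andP[z0 zh]] := snakeH_sub_closed cp; split => //.
  have [->|zn0] := eqVneq p.2 0; [by left|right].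
  apply/eqP; rewrite eq_le zh leNgt /=; apply/negP => zlt.
  have z0' : 0 < p.2 by rewrite lt_def zn0.
  have [_ [x1 _]] := (I, unit_squareP _ : unit_square R p.1 <-> _).
  have /unit_squareP[/andP[_ x1'] _] := sq.
  (* Strictly between floor and roof a point is interior if x < 1, and lies in the deleted triangle
     if x = 1. *)
  have [x1n|x1n] := ltP p.1.1 1; first by apply: np; apply: interior_snakeH; rewrite ?z0'.
  have xE : p.1.1 = 1 by apply/eqP; rewrite eq_le x1' x1n.
  by apply: nt; apply/end_triangleP; rewrite z0' -xE -sheetE.
move=> [sq pz].
have hE := sheetE y e sq.
have /unit_squareP[/andP[x0 x1] _] := sq.
have nt : ~ open_triangle (snakeA R 1) (snakeC y e 1) (snakeE y e 1) p.
  move=> /end_triangleP[xE /andP[z0 zh]]; case: pz => pz; first by rewrite pz ltxx in z0.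
  by move: zh; rewrite pz hE xE ltxx.
split => //; have [p0|pn0] := eqVneq p.2 0; first by left.
case: pz => pz; first by rewrite pz eqxx in pn0.
have z0 : 0 < p.2 by rewrite lt_def pn0 pz hE height_ge0.
have xp : 0 < p.1.1 <= 1.
  by move: z0; rewrite pz hE /height; case: ifP => //; rewrite ltxx.
right; split.
  apply: subset_closure; apply/snakeHP; split => //.
    by move: z0; rewrite pz hE height_gt0 // => /andP[? ?]; apply/andP; split; exact: ltW.
  by rewrite ltW //= pz hE.
rewrite /interior => /nbhs_ballP[d /= d0 bH].
(* A point of the roof is not interior: raising it by half the radius leaves the tower. *)
have : ball p d (p.1, p.2 + d / 2).
  split; first exact: ballxx.
  rewrite /ball /= opprD addrA subrr sub0r normrN ger0_norm; lra.
move=> /bH/snakeHP[_ _ /= /andP[_]]; rewrite pz hE; lra.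
Qed.

End snake_set.

(** * Contractibility for y > 1/2 *)

Section snake_zero_set.
Context {R : realType} (y e : R).
Implicit Types (x Y t z : R).
Hypothesis ok : admissible y e.

Lemma sheet_eq0P (u : R * R) : unit_square R u -> sheet y e u = 0 <->
  u.1 = 0 \/ 0 < u.1 <= 1 /\ (u.2 <= lo y e u.1 \/ hi y e u.1 <= u.2).
Proof.
move=> sq; rewrite sheetE //; have /unit_squareP[/andP[x0 x1] _] := sq.
split.
  have [x00|xn0] := eqVneq u.1 0; first by left.
  by move=> h0; right; have xp : 0 < u.1 <= 1; [rewrite lt_def xn0 x0|split => //; exact: height_eq0 h0].
by move=> [->|[x01]]; [exact: height_x0|exact: height0].
Qed.

Lemma snake_contractible : 2^-1 < y -> contractible R (snake_space R y e).
Proof.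
move=> y2; rewrite /snake_space snake_setE //.
have [y0 e0 ye0 ye1] := ok.
(* The denominator is positive as y > 1/2; points below the band get the value 0, points above it
   the value 1. *)
pose phi (Y : R) : R := clamp ((Y - (1 - y)) / (2 * y - 1)).
have phi01 Y : 0 <= phi Y <= 1 by exact: clamp01.
have d0 : 0 < 2 * y - 1 by lra.
have phi0 Y : Y <= 1 - y -> phi Y = 0.
  move=> h; rewrite /phi /clamp max_l // ge_min; apply/orP; right.
  by rewrite pmulr_lle0 ?invr_gt0 // subr_le0.
have phi1 Y : y <= Y -> phi Y = 1.
  move=> h; have h1 : 1 <= (Y - (1 - y)) / (2 * y - 1) by rewrite ler_pdivlMr // mul1r; lra.
  by rewrite /phi /clamp (min_l h1) max_r ?ler01.
have cphi (X : set (R * R)) : {within X, continuous (fun u : R * R => phi u.2)}.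
  by rewrite /phi; cts.
have cS := continuous_sheet ok.
have lo_y x : 0 < x <= 1 -> lo y e x <= 1 - y.
  move=> x01; have := hi_le1 ok x01; rewrite /hi /width; have [? ?] := andP x01.
  have ex : 0 <= e * x by rewrite mulr_ge0 // ltW.
  lra.
have hi_y x : 0 < x <= 1 -> y <= hi y e x.
  move=> x01; have := lo_ge0 ok x01; rewrite /hi /width; have [? ?] := andP x01.
  have ex : 0 <= e * x by rewrite mulr_ge0 // ltW.
  lra.
have H1 : pair_homotopic (unit_square R) (sheet y e) (unit_square R) (sheet y e)
    id (fun u => (u.1, phi u.2)).
  apply: pair_homotopic_segment; [by cts; exact: cphi|by cts; exact: cphi|].
  move=> [x Y] t sq t01 v; have vE : v = (x, (1 - t) * Y + t * phi Y).
    by rewrite /v /=; congr (_, _); ring.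
  have /unit_squareP[/= x01 Y01] := sq; have := phi01 Y.
  rewrite {}/v in vE *; rewrite vE => p01.
  have sqv : unit_square R (x, (1 - t) * Y + t * phi Y).
    by apply/unit_squareP; split => //=; apply/andP; split; nra.
  split => // /(sheet_eq0P sq)/= h; apply/(sheet_eq0P sqv) => /=.
  case: h => [|[xp h]]; first by left.
  right; split => //; case: h => h; [left|right].
    by rewrite phi0; [nra|exact: le_trans h (lo_y _ xp)].
  by rewrite phi1; [nra|exact: le_trans (hi_y _ xp) h].
(* Points off the band now have ordinate 0 or 1, which is off the band at every abscissa, so the
   abscissa may be shrunk freely. *)
have H2 : pair_homotopic (unit_square R) (sheet y e) (unit_square R) (sheet y e)
    (fun u => (u.1, phi u.2)) (fun u => (0, phi u.2)).
  apply: pair_homotopic_segment; [by cts; exact: cphi|by cts; exact: cphi|].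
  move=> [x Y] t sq t01 v; have vE : v = ((1 - t) * x, phi Y).
    by rewrite /v /=; congr (_, _); ring.
  have /unit_squareP[/= x01 Y01] := sq.
  rewrite {}/v in vE *; rewrite vE.
  have sqv : unit_square R ((1 - t) * x, phi Y).
    by apply/unit_squareP; split => //=; apply/andP; split; nra.
  split => // /(sheet_eq0P sq)/= h; apply/(sheet_eq0P sqv) => /=.
  case: h => [->|[xp h]]; first by left; rewrite mulr0.
  have [x0|xn0] := eqVneq ((1 - t) * x) 0; first by left.
  have xp' : 0 < (1 - t) * x <= 1 by rewrite lt_def xn0; apply/andP; split; [|nra]; rewrite /=; nra.
  right; split => //; case: h => h; [left|right].
    by rewrite phi0; [exact: lo_ge0|exact: le_trans h (lo_y _ xp)].
  by rewrite phi1; [exact: hi_le1|exact: le_trans (hi_y _ xp) h].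
(* On the left edge both sheets coincide, so the zero set imposes no condition. *)
have H3 : pair_homotopic (unit_square R) (sheet y e) (unit_square R) (sheet y e)
    (fun u => (0, phi u.2)) (fun u => (0, 0)).
  apply: pair_homotopic_segment; [by cts; exact: cphi|by cts; exact: cphi|].
  move=> [x Y] t sq t01 v; have vE : v = (0, (1 - t) * phi Y).
    by rewrite /v /=; congr (_, _); ring.
  rewrite {}/v in vE *; rewrite vE; have p01 := phi01 Y.
  have sqv : unit_square R (0, (1 - t) * phi Y).
    by apply/unit_squareP; split => /=; apply/andP; split; nra.
  by split => // _; apply/(sheet_eq0P sqv); left.
have H := track_homotopic_trans H1 (track_homotopic_trans H2 H3).
have sq0 : unit_square R (0, 0) by apply/unit_squareP; rewrite /= lexx ler01.
have s0 : sheet y e (0, 0) = 0 by rewrite sheetE ?height_x0.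
apply: (@set_contractible _ _ _ ((0, 0), 0)); first by split => //; left.
apply: track_homotopic_eq (dbl_homotopic cS (continuous_subspaceT cS) H).
  by move=> p /dmap_id.
by move=> p _; rewrite /dmap s0 if_same.
Qed.

End snake_zero_set.

(** * Compactness, and maps out of quotients *)

Lemma compact_set_type (U : topologicalType) (A : set U) :
  compact A -> compact [set: A].
Proof.
move=> cA; have [A0|nA] := pselect (exists a, A a); last first.
  rewrite (_ : [set: A] = set0); first exact: compact0.
  by apply/seteqP; split => // x _; case: nA; exists (\val x); exact: set_valP.
have [a Aa] := A0; pose a0 : A := Sub_in Aa.
have cv : {within A, continuous (valL_ a0 (@id A))}.
  by apply/(@subspace_valL_continuousP' _ A _ a0) => x; exact: cvg_id.
have -> : [set: A] = valL_ a0 (@id A) @` A.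
  apply/seteqP; split => // x _; exists (\val x); first exact: set_valP.
  by have := valLK a0 (@id A) => /(congr1 (@^~ x)).
exact: continuous_compact.
Qed.

Section quotient_by.
Context (X Z : topologicalType) (r : X -> X -> Prop) (f : X -> Z).
Local Open Scope quotient_scope.

Lemma quotient_by_compact : compact [set: X] -> compact [set: quotient_by r].
Proof.
move=> cX; rewrite (_ : [set: quotient_by r] = \pi_(quotient_by r) @` setT).
  by apply: continuous_compact => //; apply: continuous_subspaceT; exact: pi_continuous.
by apply/seteqP; split => // q _; exists (repr q) => //; rewrite reprK.
Qed.

Lemma quotient_by_pi (x y : X) : generated_rel r x y ->
  \pi_(quotient_by r) x = \pi_(quotient_by r) y.
Proof. by move=> h; apply/eqmodP. Qed.

Lemma quotient_by_repr (x : X) :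
  generated_rel r (repr (\pi_(quotient_by r) x)) x.
Proof.
have /eqmodP : \pi_(quotient_by r) (repr (\pi_(quotient_by r) x)) = \pi_(quotient_by r) x.
  by rewrite reprK.
by [].
Qed.

Lemma generated_rel_eq (x y : X) : (forall a b, r a b -> f a = f b) ->
  generated_rel r x y -> f x = f y.
Proof.
move=> rf /asboolP; elim=> [a b /rf//|//|a b _ -> //|a b c _ -> _ -> //].
Qed.

(** A map constant on generating pairs is constant on classes, so [repr] may choose any
    representative; continuity is the universal property of the quotient topology. *)
Lemma quotient_by_lift : (forall a b, r a b -> f a = f b) -> continuous f ->
  continuous (f \o repr : quotient_by r -> Z) /\
  forall x, f (repr (\pi_(quotient_by r) x)) = f x.
Proof.
move=> rf cf; have fE x : f (repr (\pi_(quotient_by r) x)) = f x.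
  exact: generated_rel_eq rf (quotient_by_repr x).
split => //; apply/quotient_continuous.
by rewrite (_ : _ \o _ = f) //; apply/funext => x; exact: fE.
Qed.

End quotient_by.

(** * The Griffiths space as a double *)

Section hawaiian_model.
Context {R : realType}.
Implicit Types (r s t T z d : R) (n m : nat).

Definition arc_diam n : R := 2 / n%:R.

(* The circle of diameter d becomes the segment of slope d, traversed twice. *)
Definition arcs : set (R * R) := [set a | a = 0 \/ exists2 n, (0 < n)%N &
  `|a.2| = arc_diam n * a.1 /\ 0 <= a.1 <= arc_diam n].

(* Two cones on arcs, with apexes at height T = 1 and T = -1. *)
Definition arc_cones : set (R * R * R) := [set g |
  [/\ -1 <= g.2 <= 1, 0 <= g.2 * g.1.2 &
      exists2 a, arcs a & g.1 = ((1 - `|g.2|) * a.1, (1 - `|g.2|) * a.2)]].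

(** A point (a, c) of a circle has the arc point (a, a^2 + c^2) up to sign, so at level T this is
    the square of (1 - |T|) c. It vanishes at both ends of an arc, the base point 0 and the foot,
    and at the apexes. *)
Definition arc_height (g : R * R * R) : R := (1 - `|g.2|) * `|g.1.2| - g.1.1 ^+ 2.

Lemma continuous_arc_height : continuous arc_height.
Proof. by apply/continuous_subspace_setT; rewrite /arc_height; cts. Qed.

Lemma arc_diam_gt0 n : (0 < n)%N -> 0 < arc_diam n.
Proof. by move=> n0; rewrite divr_gt0 ?ltr0n. Qed.

Lemma arc_diam_le n : (0 < n)%N -> arc_diam n <= 2.
Proof.
by move=> n0; rewrite /arc_diam ler_pdivrMr ?ltr0n // ler_peMr // ler1n.
Qed.

Lemma hawaiianP (p : R * R) : hawaiian R p <->
  exists2 n, (0 < n)%N & p.1 ^+ 2 + p.2 ^+ 2 = arc_diam n * p.1.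
Proof.
have e n : (0 < n)%N -> (p.1 - n%:R^-1) ^+ 2 + p.2 ^+ 2 = n%:R^-1 ^+ 2 <->
    p.1 ^+ 2 + p.2 ^+ 2 = arc_diam n * p.1.
  rewrite /arc_diam; move: (n%:R^-1 : R) => v _.
  by split => h; [have : p.1 ^+ 2 + p.2 ^+ 2 = 2 * v * p.1 by nra|nra].
by split => -[n n0 /= h]; exists n => //; apply/(e _ n0).
Qed.

Lemma cts_closed_zero (U : topologicalType) (A : set U) (f : U -> R) :
  closed A -> {within A, continuous f} -> closed [set x | A x /\ f x = 0].
Proof.
move=> cA cf.
have -> : [set x | A x /\ f x = 0] = f @^-1` [set 0] `&` A.
  by apply/seteqP; split => x /= [].
rewrite closed_setIS //.
by move/continuous_closedP: cf; apply; exact: closed_eq.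
Qed.

(** The set of 0 and all 1/n, written as a zero set: on (0, 1] [zigzag] takes the values 0 and 1
    exactly at the 1/n, and the factor [c] restores continuity at 0, so closedness is automatic. *)
Definition circle_points : set R :=
  [set c | `[0, 1]%classic c /\ c * Num.min (zigzag c) (1 - zigzag c) = 0].

Lemma circle_points_compact : compact circle_points.
Proof.
have cz : {within `[0, 1], continuous (fun c : R => c * Num.min (zigzag c) (1 - zigzag c))}.
  have i01 (c : R) : `[0, 1]%classic c -> 0 <= c <= 1 by rewrite /= in_itv.
  have i01' (c : R) : (`[0, 1]%classic `&` [set u | 0 < u]) c -> 0 < c <= 1.
    by case=> /i01/andP[_ ->] /= ->.
  apply: (@cts_squeeze _ _ _ (fun c => c) _ (fun=> 0) 1).
  - by move=> c; exact: cvg_id.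
  - exact: cts_cst.
  - by move=> c /i01/andP[].
  - move=> c /i01/andP[c0 c1]; rewrite subr0 mul1r normrM ger0_norm //.
    move: c0; rewrite le_eqVlt => /orP[/eqP <-|c0]; first by rewrite mul0r.
    have cp : 0 < c <= 1 by rewrite c0.
    have := zigzag_itv cp; case/andP=> z0 z1.
    rewrite ler_piMr ?(ltW c0) // ger0_norm; first by rewrite ge_min z1.
    by rewrite le_min z0 subr_ge0.
  - have cZ : {within `[0, 1] `&` [set u : R | 0 < u], continuous (fun c : R => zigzag c)}.
      by apply: (@cts_pl _ _ _ (fun c => c)) => // c; exact: cvg_id.
    by cts.
apply: (@subclosed_compact _ _ (`[0, 1]%classic : set R)).
- by apply: cts_closed_zero cz; exact: itv_closed.
- exact: segment_compact.
- by move=> c [].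
Qed.

Lemma circle_pointsP (c : R) : circle_points c <->
  c = 0 \/ exists2 n, (0 < n)%N & c = n%:R^-1.
Proof.
split.
  move=> [/= + h]; rewrite in_itv /= => /andP[c0 c1].
  have [->|cn0] := eqVneq c 0; [by left|right].
  have cp : 0 < c <= 1 by rewrite lt_def cn0 c0.
  have [k0 _] := idx_itv cp; have pk := piece_idx cp.
  have hz : Num.min (zigzag c) (1 - zigzag c) = 0.
    by apply/eqP; move/eqP: h; rewrite mulf_eq0 (negPf cn0).
  have w01 : wt (idx c) c = 0 \/ wt (idx c) c = 1.
    move: hz; rewrite /zigzag (plE _ k0 pk) /=.
    by case: odd => /=; rewrite ?mulr0 ?mulr1 ?addr0 ?add0r;
      case: leP => _ h0; [left|right|right|left]; lra.
  case: w01 => w.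
    exists (idx c) => //; rewrite {1}(wt_x c k0) w; ring.
  by exists (idx c).+1 => //; rewrite {1}(wt_x c k0) w; ring.
case=> [->|[n n0 ->]]; first by split; rewrite ?mul0r //= in_itv /= lexx ler01.
have /andP[h1 h2] := @invn_itv R n n0.
split; first by rewrite /= in_itv /= h2 ltW.
rewrite /zigzag pl_V //; case: odd => /=; rewrite ?subr0 ?subrr.
  by rewrite min_l ?mulr0 ?ler01.
by rewrite min_r ?mulr0 ?ler01.
Qed.

Lemma circle_compact : compact (circle R).
Proof.
apply: (@subclosed_compact _ _ ((`[-1, 1]%classic : set R) `*` (`[-1, 1]%classic : set R))).
- rewrite /circle.
  have -> : [set p : R * R | p.1 ^+ 2 + p.2 ^+ 2 = 1] =
      [set p : R * R | setT p /\ p.1 ^+ 2 + p.2 ^+ 2 - 1 = 0].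
    by apply/seteqP; split => p /=; [move=> ->; rewrite subrr|case=> _ /subr0_eq].
  by apply: cts_closed_zero; [exact: closedT|cts].
- by apply: compact_setX; exact: segment_compact.
- move=> [a b]; rewrite /circle /= => h.
  have a2 := sqr_ge0 a; have b2 := sqr_ge0 b.
  by split; rewrite /= in_itv /=; apply/andP; split; nra.
Qed.

(** The earring is the image of a compact product: the radius runs over [circle_points], and the
    unit circle is scaled and translated so as to touch the origin; radius 0 contributes the origin
    alone. *)
Lemma hawaiian_compact : compact (hawaiian R).
Proof.
have -> : hawaiian R = (fun q : R * (R * R) => (q.1 * (1 + q.2.1), q.1 * q.2.2)) @`
    (circle_points `*` circle R).
  apply/seteqP; split => p.
    move=> [n n0 /= h]; have n0' : 0 < n%:R :> R by rewrite ltr0n.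
    exists (n%:R^-1, (n%:R * p.1 - 1, n%:R * p.2)).
      split; first by apply/circle_pointsP; right; exists n.
      rewrite /circle /=; have : n%:R ^+ 2 * ((p.1 - n%:R^-1) ^+ 2 + p.2 ^+ 2) = 1.
        by rewrite h exprVn mulfV // expf_neq0 // gt_eqF.
      have nV : n%:R * n%:R^-1 = 1 :> R by rewrite mulfV // gt_eqF.
      move=> h1; rewrite -[RHS]h1.
      transitivity ((n%:R * p.1 - n%:R * n%:R^-1) ^+ 2 + (n%:R * p.2) ^+ 2).
        by rewrite nV.
      by move: (n%:R^-1 : R) => v; ring.
    case: p h => a b h; congr (_, _) => /=; field; by rewrite gt_eqF.
  move=> [[c [a b]] [/= /circle_pointsP[->|[n n0 ->]] ab] <-] /=.
    by rewrite !mul0r; exact: hawaiian_theta.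
  exists n => //=; transitivity (n%:R^-1 ^+ 2 * (a ^+ 2 + b ^+ 2)); last by rewrite ab mulr1.
  by move: (n%:R^-1 : R) => v; ring.
apply: continuous_compact; first by cts.
by apply: compact_setX; [exact: circle_points_compact|exact: circle_compact].
Qed.

End hawaiian_model.

(** * Embedding of the Griffiths space *)

Section griffiths_model.
Context {R : realType}.
Implicit Types (sg : R) (q : hawaiian R * unit_itv R).
Local Open Scope quotient_scope.

(** [sg] selects the cone. The first three coordinates fold a circle onto its arc, p.1^2 + p.2^2
    being the diameter times p.1; the last one is nonzero only on the open lower half circle, which
    thus becomes the second sheet. *)
Definition cone_coord sg q : R * R * R * R :=
  let p := \val q.1 in let t := \val q.2 in
  ((1 - t) * p.1, sg * ((1 - t) * (p.1 ^+ 2 + p.2 ^+ 2)), sg * t,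
   ((1 - t) * Num.min 0 p.2) ^+ 2).

Lemma continuous_cone_coord sg : continuous (cone_coord sg).
Proof.
apply/continuous_subspace_setT; rewrite /cone_coord /=.
have cp : {within setT, continuous (fun q => \val q.1 : R * R)}.
  by apply: (@cts_after _ _ _ _ fst (@set_val _ (hawaiian R))); [exact: initial_continuous|cts].
have ct : {within setT, continuous (fun q => \val q.2 : R)}.
  by apply: (@cts_after _ _ _ _ snd (@set_val _ (unit_itv R))); [exact: initial_continuous|cts].
by cts.
Qed.

Lemma cone_coord_rel sg q q' : cone_rel q q' -> cone_coord sg q = cone_coord sg q'.
Proof. by move=> [h h']; rewrite /cone_coord h h' subrr !mul0r. Qed.

Definition cone_map sg : cone R (hawaiian R) -> R * R * R * R := cone_coord sg \o repr.

Lemma continuous_cone_map sg : continuous (cone_map sg).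
Proof.
by have [] := quotient_by_lift (@cone_coord_rel sg) (continuous_cone_coord (sg:=sg)).
Qed.

Lemma cone_mapE sg q : cone_map sg (\pi_(cone R (hawaiian R)) q) = cone_coord sg q.
Proof.
by have [_ h] := quotient_by_lift (@cone_coord_rel sg) (continuous_cone_coord (sg:=sg)); exact: h.
Qed.

Definition sign_of (b : bool) : R := if b then 1 else -1.

Lemma sign_of_neq (b b' : bool) (t t' : R) : b != b' -> 0 <= t -> 0 <= t' ->
  sign_of b * t = sign_of b' * t' -> t = 0 /\ t' = 0.
Proof. by rewrite /sign_of; case: b; case: b' => // _ t0 t0' e; split; lra. Qed.

Definition griffiths_map : griffiths R -> R * R * R * R :=
  wedge_fun (fun b => cone_map (sign_of b)).

Lemma cone_map_base b : cone_map (sign_of b) (cone_base R (theta R)) = 0.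
Proof.
by rewrite cone_mapE /cone_coord /= !mulr0 expr0n /= addr0 !mulr0 minxx mulr0 expr0n.
Qed.

Lemma continuous_griffiths_map : continuous griffiths_map.
Proof.
apply: wedge_fun_continuous; first by move=> b; exact: continuous_cone_map.
by move=> b b'; rewrite !cone_map_base.
Qed.

Definition cone_pt q : cone R (hawaiian R) := \pi_(cone R (hawaiian R)) q.

Definition griffiths_pt (b : bool) q : griffiths R :=
  wedge_lift (fun _ : bool => cone_base R (theta R)) (i := b) (cone_pt q).

Lemma griffiths_ptP (x : griffiths R) : exists b q, x = griffiths_pt b q.
Proof.
have : [set: griffiths R] x by [].
rewrite -(@wedgeTE _ _ (fun _ : bool => cone_base R (theta R))) => -[b _ [c _ <-]].
by exists b, (repr c); rewrite /griffiths_pt /cone_pt reprK.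
Qed.

Lemma griffiths_mapE b q : griffiths_map (griffiths_pt b q) = cone_coord (sign_of b) q.
Proof.
rewrite /griffiths_map /griffiths_pt wedge_lift_funE ?cone_mapE //.
by move=> i j; rewrite !cone_map_base.
Qed.

Lemma unit_itv_val (t : unit_itv R) : 0 <= (\val t : R) <= 1.
Proof. by have := set_valP t; rewrite /unit_itv /= in_itv. Qed.

Lemma hawaiian_val (p : hawaiian R) : exists2 n, (0 < n)%N &
  (\val p).1 ^+ 2 + (\val p).2 ^+ 2 = arc_diam n * (\val p).1.
Proof. by apply/hawaiianP; exact: set_valP. Qed.

Lemma cone_pt_eq q q' : \val q.2 = \val q'.2 :> R ->
  (\val q.2 != 1 :> R -> \val q.1 = \val q'.1 :> R * R) -> cone_pt q = cone_pt q'.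
Proof.
case: q q' => [p t] [p' t'] /= tt pp.
have [t1|tn1] := eqVneq (\val t) (1 : R).
  by apply: quotient_by_pi; apply/asboolP; apply: rst_step; rewrite /cone_rel /= -tt.
by congr cone_pt; congr (_, _); apply: val_inj => //; exact: pp.
Qed.

(** In one cone the parameter, then p.1 and the square of p.2 are read off, and the last coordinate
    supplies the sign of p.2. In different cones the opposite signs force parameter and norm to
    vanish, which leaves only the common base point. *)
Lemma griffiths_map_inj : injective griffiths_map.
Proof.
move=> x x'; have [b [q ->]] := griffiths_ptP x; have [b' [q' ->]] := griffiths_ptP x'.
rewrite !griffiths_mapE /cone_coord.
have t01 := unit_itv_val q.2; have t01' := unit_itv_val q'.2.
have [n n0 dn] := hawaiian_val q.1; have [n' n0' dn'] := hawaiian_val q'.1.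
move=> [e1 e2 e3 e4].
have [bb|bb] := eqVneq b b'.
  rewrite -bb in e2 e3 *; rewrite /griffiths_pt; congr wedge_lift.
  have s0 : sign_of b != 0 :> R by rewrite /sign_of; case: ifP; rewrite ?oppr_eq0 oner_eq0.
  have tt : \val q.2 = \val q'.2 :> R := mulfI s0 e3.
  apply: cone_pt_eq => // tn1.
  have u0 : 1 - \val q.2 != 0 :> R by rewrite subr_eq0 eq_sym.
  rewrite -tt in e1 e2 e4.
  have p1 := mulfI u0 e1.
  have := mulfI u0 (mulfI s0 e2); rewrite p1 => /addrI p2.
  move: e4; rewrite !exprMn => /(mulfI (expf_neq0 2 u0)) m2.
  rewrite [LHS]surjective_pairing [RHS]surjective_pairing p1; congr (_, _).
  move: p2 m2; case: (leP 0 (\val q.1).2) => h; case: (leP 0 (\val q'.1).2) => h' h1 h2.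
  - by apply/eqP; rewrite -(@eqrXn2 _ 2) // h1.
  - by move: h2 h'; rewrite expr0n /= => h2; have := sqr_ge0 (\val q'.1).2; nra.
  - by move: h2 h; rewrite expr0n /= => h2; nra.
  - by apply: oppr_inj; apply/eqP; rewrite -(@eqrXn2 _ 2) ?oppr_ge0 ?ltW // !sqrrN h1.
have [t0 t0'] := sign_of_neq bb (andP t01).1 (andP t01').1 e3.
rewrite t0 t0' !subr0 !mul1r in e1 e2.
have pos (p : hawaiian R) : 0 <= (\val p).1 ^+ 2 + (\val p).2 ^+ 2 :> R.
  by rewrite addr_ge0 ?sqr_ge0.
have [h h'] := sign_of_neq bb (pos _) (pos _) e2.
have base c (r : hawaiian R * unit_itv R) : \val r.2 = 0 :> R ->
    (\val r.1).1 ^+ 2 + (\val r.1).2 ^+ 2 = 0 :> R ->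
    griffiths_pt c r = wedge_lift (fun _ : bool => cone_base R (theta R)) (i := c) (cone_base R (theta R)).
  move=> r0 /eqP; rewrite paddr_eq0 ?sqr_ge0 // !sqrf_eq0 => /andP[/eqP p1 /eqP p2].
  rewrite /griffiths_pt; congr wedge_lift; apply: cone_pt_eq => //= _.
  by rewrite [LHS]surjective_pairing p1 p2.
rewrite !base //.
by apply: (@wedge_liftE _ _ (fun _ : bool => cone_base R (theta R)) b' (cone_base R (theta R)) b
  (cone_base R (theta R))).
Qed.

Lemma griffiths_compact : compact [set: griffiths R].
Proof.
apply: wedge_compact => [|b]; first exact: finite_finset.
apply: quotient_by_compact; rewrite -setXTT.
by apply: compact_setX; apply: compact_set_type;
  [exact: hawaiian_compact|exact: segment_compact].
Qed.

Lemma griffiths_map_range : range griffiths_map = dbl (arc_cones (R := R)) arc_height.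
Proof.
apply/seteqP; split.
  move=> _ [x _ <-]; have [b [q ->]] := griffiths_ptP x; rewrite griffiths_mapE.
  rewrite /cone_coord; have := unit_itv_val q.2; have [n n0] := hawaiian_val q.1.
  move: (\val q.1) (\val q.2) => [a c] t /= dn /andP[t0 t1].
  have sb : sign_of b = 1 \/ sign_of b = -1 :> R by case: b; [left|right].
  have sb1 : sign_of b * sign_of b = 1 :> R by case: sb => ->; ring.
  have nsb : `|sign_of b| = 1 :> R by case: sb => ->; rewrite ?normrN normr1.
  have nt : `|sign_of b * t| = t by rewrite normrM nsb mul1r ger0_norm.
  have c2 := sqr_ge0 c; have a2 := sqr_ge0 a; have d0 := @arc_diam_gt0 R n n0.
  have a0 : 0 <= a by rewrite -(pmulr_rge0 _ d0) -dn addr_ge0.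
  have n2 : `|sign_of b * ((1 - t) * (a ^+ 2 + c ^+ 2))| = (1 - t) * (a ^+ 2 + c ^+ 2).
    by rewrite normrM nsb mul1r ger0_norm // mulr_ge0 ?subr_ge0 ?addr_ge0.
  have hE : arc_height ((1 - t) * a, sign_of b * ((1 - t) * (a ^+ 2 + c ^+ 2)), sign_of b * t)
      = ((1 - t) * c) ^+ 2 by rewrite /arc_height /= nt n2; ring.
  split; last first.
    rewrite hE /=; have [c0|c0] := leP 0 c; last by right.
    by left; rewrite mulr0 expr0n.
  split => /=.
  - by case: sb => ->; apply/andP; split; lra.
  - rewrite (_ : _ * _ * _ = (sign_of b * sign_of b) * (t * ((1 - t) * (a ^+ 2 + c ^+ 2)))); last by ring.
    by rewrite sb1 mul1r !mulr_ge0 ?subr_ge0 ?addr_ge0.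
  - exists (a, sign_of b * (a ^+ 2 + c ^+ 2)).
      right; exists n => //=; rewrite normrM nsb mul1r ger0_norm ?addr_ge0 //; split => //.
      rewrite a0 /=; have [->|an0] := eqVneq a 0; first exact: ltW.
      have ap : 0 < a by rewrite lt_def an0.
      by rewrite -(ler_pM2r ap) -dn; lra.
    by rewrite /= nt; congr (_, _); ring.
move=> [[[r s] T] z] [[/= T1 Ts [a aE [rE sE]]] zE].
have [n n0 [an a0 ad]] : exists2 n, (0 < n)%N &
    [/\ `|a.2| = arc_diam n * a.1, 0 <= a.1 & a.1 <= arc_diam n :> R].
  case: aE => [->|[n n0 [h /andP[h1 h2]]]]; last by exists n.
  exists 1%N => //; rewrite (_ : (0 : R * R) = (0, 0)) //= normr0 mulr0.
  by split => //; exact/ltW/arc_diam_gt0.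
have T0 : 0 <= 1 - `|T| by rewrite subr_ge0 ler_norml.
(* The cone is given by the sign of [T], or by the sign of the second arc coordinate if [T] is 0. *)
have [b [bT bs]] : exists b, sign_of b * `|T| = T /\ sign_of b * ((1 - `|T|) * `|a.2|) = s.
  rewrite sE in Ts *.
  have [T0'|T0'|T0'] := ltgtP T 0.
  - exists false; rewrite /sign_of mulN1r ltr0_norm // opprK; split => //.
    have h : (1 + T) * a.2 <= 0 by move: Ts; rewrite ltr0_norm // opprK; nra.
    move: T0; rewrite ltr0_norm // opprK => T0.
    rewrite mulN1r -[X in - (X * _)](ger0_norm T0) -normrM ler0_norm ?opprK //.
  - exists true; rewrite /sign_of mul1r gtr0_norm //; split => //.
    have h : 0 <= (1 - T) * a.2 by move: Ts; rewrite gtr0_norm //; nra.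
    move: T0; rewrite gtr0_norm // => T0.
    by rewrite mul1r -[X in X * _](ger0_norm T0) -normrM ger0_norm.
  - rewrite T0' normr0 subr0 !mul1r.
    have [h|h] := leP 0 a.2.
      by exists true; rewrite /sign_of mulr0 mul1r ger0_norm.
    by exists false; rewrite /sign_of mulr0 mulN1r ltr0_norm // opprK.
have g0 : 0 <= `|a.2| - a.1 ^+ 2 by rewrite an; nra.
(* The ordinate on the circle is known up to sign; the sheet, that is, whether [z] is 0, decides the
   sign. *)
pose p2 := (if z == 0 then 1 else -1) * Num.sqrt (`|a.2| - a.1 ^+ 2).
have p2E : p2 ^+ 2 = `|a.2| - a.1 ^+ 2.
  by rewrite exprMn sqr_sqrtr //; case: ifP => _; ring.
have hp : hawaiian R (a.1, p2) by apply/hawaiianP; exists n => //=; rewrite p2E -an; ring.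
have ht : unit_itv R `|T|.
  by rewrite /unit_itv /= in_itv /= normr_ge0 /= -subr_ge0.
exists (griffiths_pt b (Sub_in hp, Sub_in ht)) => //.
rewrite griffiths_mapE /cone_coord /= p2E (_ : a.1 ^+ 2 + _ = `|a.2|); last by ring.
rewrite bT bs -rE; congr (_, _).
have sq0 := sqrtr_ge0 (`|a.2| - a.1 ^+ 2).
rewrite /p2; case: eqP => [->|zn]; first by rewrite mul1r min_l // mulr0 expr0n.
case: zE => // ->.
rewrite mulN1r min_r ?oppr_le0 // mulrN sqrrN exprMn sqr_sqrtr // /arc_height /=.
by rewrite sE rE normrM (ger0_norm T0); ring.
Qed.

End griffiths_model.

(** * Paths in the fan of arcs *)

Section geodesics.
Context {R : realType}.
Implicit Types (t : R) (a b : R * R) (n m : nat).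

Lemma arcsP a : arcs a -> exists2 n, (0 < n)%N &
  [/\ `|a.2| = arc_diam n * a.1, 0 <= a.1 & a.1 <= arc_diam n :> R].
Proof.
case=> [->|[n n0 [h /andP[h1 h2]]]]; last by exists n.
exists 1%N => //; rewrite (_ : (0 : R * R) = (0, 0)) //= normr0 mulr0.
by split => //; exact/ltW/arc_diam_gt0.
Qed.

(** The slopes 2/m are isolated: lying strictly between 2/(m+1) and 2/(m-1) is an open condition
    which, with the sign of the second coordinate, singles out the arc of [b]. The conclusion is the
    collinearity that [geodesic] tests. *)
Lemma arcs_slope_near b : arcs b -> 0 < b.1 ->
  nbhs b [set a | arcs a -> 0 < a.1 -> a.2 * b.1 = b.2 * a.1].
Proof.
move=> /arcsP[m m0 [bm b0 bd]] bp.
have dm := @arc_diam_gt0 R m m0.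
have b2 : 0 < `|b.2| by rewrite bm mulr_gt0.
have mE : m%:R * `|b.2| = 2 * b.1.
  by rewrite bm /arc_diam mulrA mulrCA mulfV ?mulr1 // pnatr_eq0 -lt0n.
pose A : set (R * R) := [set a | 0 < a.2 * b.2].
have c1 : continuous (fun a : R * R => a.2 * b.2).
  by apply/continuous_subspace_setT; cts.
have nA : nbhs b A.
  apply: open_nbhs_nbhs; split.
    apply: (@open_comp _ _ (fun a : R * R => a.2 * b.2) [set r | 0 < r]).
      by move=> a _; exact: c1.
    exact: open_gt.
  by rewrite /A /= -expr2 exprn_even_gt0 //= -normr_gt0.
have near_lt (f : R * R -> R) : continuous f -> 0 < f b -> nbhs b [set a | 0 < f a].
  move=> cf fb; apply: open_nbhs_nbhs; split => //.
  by apply: (@open_comp _ _ f [set r | 0 < r]); [move=> a _; exact: cf|exact: open_gt].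
have n1 : nbhs b [set a : R * R | 0 < m.+1%:R * `|a.2| - 2 * a.1].
  apply: near_lt; first by apply/continuous_subspace_setT; cts.
  by rewrite -natr1 mulrDl mE mul1r addrAC subrr add0r.
have n2 : nbhs b [set a : R * R | 0 < 2 * a.1 - m.-1%:R * `|a.2|].
  apply: near_lt; first by apply/continuous_subspace_setT; cts.
  rewrite -mE -(prednK m0) -natr1 prednK // mulrDl mul1r addrAC subrr add0r.
  exact: b2.
apply: filterS3 nA n1 n2 => a /= ab h1 h2 /arcsP[n n0 [an _ _]] ap.
have an2 : 0 < `|a.2| by rewrite an mulr_gt0 // arc_diam_gt0.
have nE : n%:R * `|a.2| = 2 * a.1.
  by rewrite an /arc_diam mulrA mulrCA mulfV ?mulr1 // pnatr_eq0 -lt0n.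
have nm : n = m.
  apply/eqP; rewrite eqn_leq; apply/andP; split.
    by rewrite -ltnS -(@ltr_nat R) -(ltr_pM2r an2) nE -subr_gt0.
  by rewrite -[m](prednK m0) -(@ltr_nat R) -(ltr_pM2r an2) nE -subr_gt0.
rewrite nm in nE.
have [a20|a20] := leP 0 a.2.
  have b20 : 0 <= b.2.
    by rewrite leNgt; apply/negP => /ltW/(mulr_ge0_le0 a20); rewrite leNgt ab.
  rewrite ger0_norm // in nE; rewrite ger0_norm // in mE.
  have : m%:R * (a.2 * b.1 - b.2 * a.1) = 0 by nra.
  by move/eqP; rewrite mulf_eq0 pnatr_eq0 eqn0Ngt m0 /= => /eqP/subr0_eq.
have b20 : b.2 < 0.
  by rewrite ltNge; apply/negP => /(mulr_le0_ge0 (ltW a20)); rewrite leNgt ab.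
rewrite ltr0_norm // in nE; rewrite ltr0_norm // in mE.
have : m%:R * (a.2 * b.1 - b.2 * a.1) = 0 by nra.
by move/eqP; rewrite mulf_eq0 pnatr_eq0 eqn0Ngt m0 /= => /eqP/subr0_eq.
Qed.

Definition geodesic_same t a b : R * R :=
  ((1 - t) * a.1 + t * b.1, (1 - t) * a.2 + t * b.2).

(* The path from a to b through the common end point 0 of their arcs. *)
Definition geodesic_through0 t a b : R * R :=
  let l := (1 - t) * a.1 - t * b.1 in
  (Num.max 0 l + Num.max 0 (- l),
   Num.max 0 l * (a.2 / a.1) + Num.max 0 (- l) * (b.2 / b.1)).

(** The test asks whether both points lie on one arc. It also succeeds if one of them is 0, so on
    arcs the other branch divides by nonzero abscissas only. *)
Definition geodesic t a b : R * R :=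
  if a.2 * b.1 == b.2 * a.1 then geodesic_same t a b else geodesic_through0 t a b.

Lemma geodesic0 a b : arcs a -> arcs b -> geodesic 0 a b = a.
Proof.
move=> /arcsP[n n0 [an a0 _]] /arcsP[m m0 [bm b0 _]]; rewrite /geodesic.
case: eqP => [_|ne]; rewrite /geodesic_same /geodesic_through0.
  by rewrite subr0 !mul1r !mul0r !addr0; case: a {an a0}.
have an0 : a.1 != 0.
  apply/eqP => az; apply: ne; move: an; rewrite az !mulr0 => /eqP.
  by rewrite normr_eq0 => /eqP ->; rewrite mul0r.
rewrite subr0 mul1r mul0r subr0 max_r // max_l ?oppr_le0 // addr0 mul0r addr0.
by rewrite mulrCA mulfV // mulr1; case: a {an a0 an0 ne}.
Qed.

Lemma geodesic1 a b : arcs a -> arcs b -> geodesic 1 a b = b.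
Proof.
move=> /arcsP[n n0 [an a0 _]] /arcsP[m m0 [bm b0 _]]; rewrite /geodesic.
case: eqP => [_|ne]; rewrite /geodesic_same /geodesic_through0.
  by rewrite subrr !mul1r !mul0r !add0r; case: b {bm b0}.
have bn0 : b.1 != 0.
  apply/eqP => bz; apply: ne; move: bm; rewrite bz !mulr0 => /eqP.
  by rewrite normr_eq0 => /eqP ->; rewrite mul0r.
rewrite subrr mul1r mul0r sub0r opprK [Num.max 0 (- _)]max_l ?oppr_le0 // max_r //.
by rewrite !add0r mul0r add0r mulrCA mulfV // mulr1; case: b {bm b0 bn0 ne}.
Qed.

Lemma geodesic_id t a : geodesic t a a = a.
Proof.
by rewrite /geodesic eqxx /geodesic_same -!mulrDl subrK !mul1r; case: a.
Qed.

Lemma geodesic_arcs t a b : 0 <= t <= 1 -> arcs a -> arcs b -> arcs (geodesic t a b).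
Proof.
move=> /andP[t0 t1] Aa Ab; have [n n0 [an a0 ad]] := arcsP Aa.
have [m m0 [bm b0 bd]] := arcsP Ab; rewrite /geodesic.
have dn := @arc_diam_gt0 R n n0; have dm := @arc_diam_gt0 R m m0.
have [az|an0] := eqVneq a.1 0.
  have a2 : a.2 = 0 by apply/eqP; rewrite -normr_eq0 an az mulr0.
  rewrite az a2 mul0r mulr0 eqxx /geodesic_same az a2 !mulr0 !add0r.
  right; exists m => //=; rewrite normrM ger0_norm // bm; split; first by ring.
  by apply/andP; split; nra.
have [bz|bn0] := eqVneq b.1 0.
  have b2 : b.2 = 0 by apply/eqP; rewrite -normr_eq0 bm bz mulr0.
  rewrite bz b2 mul0r mulr0 eqxx /geodesic_same bz b2 !mulr0 !addr0.
  right; exists n => //=; rewrite normrM ger0_norm ?subr_ge0 // an; split; first by ring.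
  by apply/andP; split; nra.
have ap : 0 < a.1 by rewrite lt_def an0.
have bp : 0 < b.1 by rewrite lt_def bn0.
case: eqP => [ab|ne].
  have b2E : b.2 = a.2 / a.1 * b.1.
    by rewrite mulrAC ab mulfK.
  have dd : arc_diam m = arc_diam n :> R.
    apply: (mulIf bn0); rewrite -bm b2E !normrM an normfV !(gtr0_norm ap) (gtr0_norm bp).
    by rewrite mulfK.
  right; exists n => //; rewrite /geodesic_same /=.
  rewrite (_ : _ + _ = a.2 / a.1 * ((1 - t) * a.1 + t * b.1)); last first.
    by rewrite b2E; field.
  rewrite normrM (_ : `|a.2 / a.1| = arc_diam n); last first.
    by rewrite normrM an normfV (gtr0_norm ap) mulfK.
  rewrite ger0_norm; last by rewrite addr_ge0 // mulr_ge0 // subr_ge0.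
  by split => //; rewrite dd in bd; apply/andP; split; nra.
rewrite /geodesic_through0; set l := (1 - t) * a.1 - t * b.1.
have nsl (c : R * R) k : 0 < c.1 -> `|c.2| = arc_diam k * c.1 -> `|c.2 / c.1| = arc_diam k.
  by move=> cp ck; rewrite normrM ck normfV (gtr0_norm cp) mulfK // gt_eqF.
have [l0|] := boolP (0 <= l); [|rewrite -ltNge => l0].
  rewrite max_r // max_l ?oppr_le0 // mul0r !addr0; right; exists n => //=.
  rewrite normrM (nsl _ _ ap an) ger0_norm // mulrC; split => //.
  by rewrite l0 /=; apply: le_trans ad; rewrite /l; nra.
rewrite max_l ?(ltW l0) // max_r ?oppr_ge0 ?(ltW l0) // mul0r !add0r; right; exists m => //=.
rewrite normrM (nsl _ _ bp bm) ger0_norm ?oppr_ge0 ?(ltW l0) // mulrC; split => //.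
rewrite /=; apply: le_trans bd; rewrite /l; nra.
Qed.

Lemma geodesic_ge0 t a b : 0 <= t <= 1 -> arcs a -> arcs b ->
  0 <= a.2 -> 0 <= b.2 -> 0 <= (geodesic t a b).2.
Proof.
move=> /andP[t0 t1] /arcsP[n n0 [_ a0 _]] /arcsP[m m0 [_ b0 _]] a2 b2.
rewrite /geodesic; case: eqP => _ /=; first by rewrite addr_ge0 // mulr_ge0 // subr_ge0.
by rewrite addr_ge0 // mulr_ge0 ?divr_ge0 // le_max lexx.
Qed.

Lemma geodesic_le0 t a b : 0 <= t <= 1 -> arcs a -> arcs b ->
  a.2 <= 0 -> b.2 <= 0 -> (geodesic t a b).2 <= 0.
Proof.
move=> /andP[t0 t1] /arcsP[n n0 [_ a0 _]] /arcsP[m m0 [_ b0 _]] a2 b2.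
have sl (c r : R) : 0 <= r -> c <= 0 -> c / r <= 0.
  by move=> r0 c0; rewrite mulr_le0_ge0 // invr_ge0.
rewrite /geodesic; case: eqP => _ /=.
  by rewrite -oppr_ge0 opprD addr_ge0 // oppr_ge0 mulr_ge0_le0 // subr_ge0.
by rewrite -oppr_ge0 opprD addr_ge0 // oppr_ge0 mulr_ge0_le0 ?sl // le_max lexx.
Qed.

Lemma geodesic_sym t a b : geodesic t a b = geodesic (1 - t) b a.
Proof.
rewrite /geodesic [X in _ = if X then _ else _]eq_sym.
case: ifP => _; rewrite /geodesic_same /geodesic_through0 subKr.
  by congr (_, _); rewrite addrC.
have -> : t * b.1 - (1 - t) * a.1 = - ((1 - t) * a.1 - t * b.1) by ring.
by rewrite opprK; congr (_, _); rewrite addrC.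
Qed.

(** Where [a] tends to 0 the test in [geodesic] is not locally constant, since [a] then meets all
    arcs. There the path is close to the straight one from 0 to [b]; the constant is generous and
    comes from slopes being at most 2. *)
Lemma geodesic_near t a b : 0 <= t <= 1 -> arcs a -> arcs b ->
  `|(geodesic t a b).1 - t * b.1| <= 8 * a.1 /\
  `|(geodesic t a b).2 - t * b.2| <= 8 * a.1.
Proof.
move=> /andP[t0 t1] Aa Ab; have [n n0 [an a0 ad]] := arcsP Aa.
have [m m0 [bm b0 bd]] := arcsP Ab; rewrite /geodesic.
have a2 : `|a.2| <= 2 * a.1.
  by rewrite an; apply: ler_wpM2r => //; exact: arc_diam_le.
have b2 : `|b.2| <= 2 * b.1.
  by rewrite bm; apply: ler_wpM2r => //; exact: arc_diam_le.
case: eqP => [_|ne].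
  rewrite /geodesic_same /= !addrK !normrM (@ger0_norm _ (1 - t)) ?subr_ge0 //.
  rewrite (ger0_norm a0); split; first by nra.
  by have := normr_ge0 a.2; nra.
have an0 : a.1 != 0.
  apply/eqP => az; apply: ne; move: an; rewrite az !mulr0 => /eqP.
  by rewrite normr_eq0 => /eqP ->; rewrite mul0r.
have bn0 : b.1 != 0.
  apply/eqP => bz; apply: ne; move: bm; rewrite bz !mulr0 => /eqP.
  by rewrite normr_eq0 => /eqP ->; rewrite mul0r.
have ap : 0 < a.1 by rewrite lt_def an0.
have bp : 0 < b.1 by rewrite lt_def bn0.
pose sa := a.2 / a.1; pose sb := b.2 / b.1.
have sa2 : `|sa| <= 2 by rewrite normrM normfV (gtr0_norm ap) ler_pdivrMr.
have sb2 : `|sb| <= 2 by rewrite normrM normfV (gtr0_norm bp) ler_pdivrMr.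
have b2E : b.2 = sb * b.1 by rewrite /sb divfK.
rewrite /geodesic_through0 /= -/sa -/sb b2E; set l := (1 - t) * a.1 - t * b.1.
have lE : l = (1 - t) * a.1 - t * b.1 by [].
have at0 : 0 <= t * a.1 by rewrite mulr_ge0.
have at1 : t * a.1 <= a.1 by rewrite ler_piMl.
have bt0 : 0 <= t * b.1 by rewrite mulr_ge0.
have [l0|] := boolP (0 <= l); [|rewrite -ltNge => l0].
  rewrite max_r // max_l ?oppr_le0 // mul0r !addr0; split.
    by rewrite ler_norml; apply/andP; split; lra.
  rewrite (_ : t * (sb * b.1) = (t * b.1) * sb); last by ring.
  apply: le_trans (ler_normB _ _) _.
  rewrite (normrM l) (normrM (t * b.1)) (ger0_norm l0) (ger0_norm bt0).
  have h1 : l * `|sa| <= l * 2 by apply: ler_wpM2l.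
  have h2 : (t * b.1) * `|sb| <= (t * b.1) * 2 by apply: ler_wpM2l.
  by lra.
rewrite max_l ?(ltW l0) // max_r ?oppr_ge0 ?(ltW l0) // mul0r !add0r; split.
  by rewrite ler_norml; apply/andP; split; lra.
rewrite (_ : _ - _ = - ((1 - t) * a.1) * sb); last by rewrite lE; ring.
have ta0 : 0 <= (1 - t) * a.1 by lra.
rewrite normrM normrN (ger0_norm ta0).
have h1 : (1 - t) * a.1 * `|sb| <= (1 - t) * a.1 * 2 by apply: ler_wpM2l.
lra.
Qed.

Lemma cts_local (U V : topologicalType) (A : set U) (f : U -> V) :
  (forall x, A x -> exists2 g : U -> V, {within A, continuous g} &
    nbhs x [set z | A z -> f z = g z]) -> {within A, continuous f}.
Proof.
move=> H; apply/ctsP => x Ax S nS; have [g /ctsP cg ng] := H _ Ax.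
have fx : f x = g x by exact: (nbhs_singleton ng Ax).
rewrite fx in nS; apply: filterS2 (cg _ Ax _ nS) ng => z h1 h2 Az.
by rewrite h2 //; exact: h1.
Qed.

Definition geodesic_dom : set (R * ((R * R) * (R * R))) :=
  [set q | [/\ 0 <= q.1 <= 1, arcs q.2.1 & arcs q.2.2]].

(** With both ends away from 0 the test is locally constant and either formula is continuous. The
    remaining points are reached by two squeezes, one for each end tending to 0. *)
Lemma cts_geodesic : {within geodesic_dom,
  continuous (fun q => geodesic q.1 q.2.1 q.2.2)}.
Proof.
have ca : continuous (fun q : R * ((R * R) * (R * R)) => q.2.1.1).
  by apply/continuous_subspace_setT; cts.
have cb : continuous (fun q : R * ((R * R) * (R * R)) => q.2.2.1).
  by apply/continuous_subspace_setT; cts.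
have a0 q : geodesic_dom q -> 0 <= q.2.1.1 by move=> [_ /arcsP[n _ []]].
have b0 q : geodesic_dom q -> 0 <= q.2.2.1 by move=> [_ _ /arcsP[n _ []]].
have near_b q : geodesic_dom q ->
    `|(geodesic q.1 q.2.1 q.2.2).1 - (1 - q.1) * q.2.1.1| <= 8 * q.2.2.1 /\
    `|(geodesic q.1 q.2.1 q.2.2).2 - (1 - q.1) * q.2.1.2| <= 8 * q.2.2.1.
  move=> [/andP[t0 t1] Aa Ab]; rewrite geodesic_sym; apply: geodesic_near => //.
  by rewrite subr_ge0 t1 lerBlDr lerDl.
have near_a q : geodesic_dom q ->
    `|(geodesic q.1 q.2.1 q.2.2).1 - q.1 * q.2.2.1| <= 8 * q.2.1.1 /\
    `|(geodesic q.1 q.2.1 q.2.2).2 - q.1 * q.2.2.2| <= 8 * q.2.1.1.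
  by move=> [t01 Aa Ab]; exact: geodesic_near.
pose D := geodesic_dom `&` [set q | 0 < q.2.1.1] `&` [set q | 0 < q.2.2.1].
have cD : {within D, continuous (fun q => geodesic q.1 q.2.1 q.2.2)}.
  have cs : {within D, continuous (fun q => geodesic_same q.1 q.2.1 q.2.2)}.
    by rewrite /geodesic_same; cts.
  have ct : {within D, continuous (fun q => geodesic_through0 q.1 q.2.1 q.2.2)}.
    have va : {within D, continuous (fun q => q.2.1.1^-1)}.
      by apply: cts_V => [q [[_ /lt0r_neq0]]|]; [|cts].
    have vb : {within D, continuous (fun q => q.2.2.1^-1)}.
      by apply: cts_V => [q [_ /lt0r_neq0]|]; [|cts].
    by rewrite /geodesic_through0; cts.
  apply: cts_local => -[t [a b]] [[[/= t01 Aa Ab] ap] bp].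
  have na := arcs_slope_near Aa ap; have nb := arcs_slope_near Ab bp.
  have na' : nbhs (t, (a, b)) [set q | arcs q.2.1 -> 0 < q.2.1.1 -> q.2.1.2 * a.1 = a.2 * q.2.1.1].
    have c1 : continuous (fun q : R * ((R * R) * (R * R)) => q.2.1).
      by apply/continuous_subspace_setT; cts.
    exact: (c1 (t, (a, b)) _ na).
  have nb' : nbhs (t, (a, b)) [set q | arcs q.2.2 -> 0 < q.2.2.1 -> q.2.2.2 * b.1 = b.2 * q.2.2.1].
    have c1 : continuous (fun q : R * ((R * R) * (R * R)) => q.2.2).
      by apply/continuous_subspace_setT; cts.
    exact: (c1 (t, (a, b)) _ nb).
  exists (if a.2 * b.1 == b.2 * a.1 then fun q => geodesic_same q.1 q.2.1 q.2.2
          else fun q => geodesic_through0 q.1 q.2.1 q.2.2); first by case: ifP.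
  apply: filterS2 na' nb' => -[t' [a' b']] /= ha hb [[[/= _ Aa' Ab'] ap'] bp'].
  have {}ha := ha Aa' ap'; have {}hb := hb Ab' bp'.
  rewrite /geodesic; suff -> : (a'.2 * b'.1 == b'.2 * a'.1) = (a.2 * b.1 == b.2 * a.1).
    by case: ifP.
  have e1 : (a'.2 * b'.1) * (a.1 * b.1) = (a.2 * b.1) * (a'.1 * b'.1).
    by transitivity ((a'.2 * a.1) * (b'.1 * b.1)); [ring|rewrite ha; ring].
  have e2 : (b'.2 * a'.1) * (a.1 * b.1) = (b.2 * a.1) * (a'.1 * b'.1).
    by transitivity ((b'.2 * b.1) * (a'.1 * a.1)); [ring|rewrite hb; ring].
  have n1 : a.1 * b.1 != 0 by rewrite gt_eqF // mulr_gt0.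
  have n2 : a'.1 * b'.1 != 0 by rewrite gt_eqF // mulr_gt0.
  by rewrite -(inj_eq (mulIf n1)) e1 e2 (inj_eq (mulIf n2)).
apply: (@cts_eq _ _ _ (fun q => ((geodesic q.1 q.2.1 q.2.2).1, (geodesic q.1 q.2.1 q.2.2).2))).
  by move=> q _; rewrite -surjective_pairing.
apply: cts_pair.
  apply: (@cts_squeeze R _ _ (fun q : R * ((R * R) * (R * R)) => q.2.1.1) _ (fun q : R * ((R * R) * (R * R)) => q.1 * q.2.2.1) 8) => //; first by cts.
    by move=> q /near_a[].
  apply: (@cts_squeeze R _ _ (fun q : R * ((R * R) * (R * R)) => q.2.2.1) _ (fun q : R * ((R * R) * (R * R)) => (1 - q.1) * q.2.1.1) 8) => //.
  - by cts.
  - by move=> q [/b0].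
  - by move=> q [/near_b[]].
  - exact: cts_fst.
apply: (@cts_squeeze R _ _ (fun q : R * ((R * R) * (R * R)) => q.2.1.1) _ (fun q : R * ((R * R) * (R * R)) => q.1 * q.2.2.2) 8) => //; first by cts.
  by move=> q /near_a[].
apply: (@cts_squeeze R _ _ (fun q : R * ((R * R) * (R * R)) => q.2.2.1) _ (fun q : R * ((R * R) * (R * R)) => (1 - q.1) * q.2.1.2) 8) => //.
- by cts.
- by move=> q [/b0].
- by move=> q [/near_b[]].
- exact: cts_snd.
Qed.

End geodesics.

(** * The snake and the Griffiths space *)

Section clamp_bounds.
Context {R : realType}.
Implicit Types (x v : R).

Lemma clamp_le0 x : x <= 0 -> clamp x = 0.
Proof. by move=> h; rewrite /clamp max_l // ge_min h orbT. Qed.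

Lemma clamp_ge1 x : 1 <= x -> clamp x = 1.
Proof. by move=> h; rewrite /clamp min_l // max_r. Qed.

Lemma clamp_lower v x : v <= 1 -> v <= x -> v <= clamp x.
Proof. by move=> h1 h2; rewrite /clamp le_max le_min h1 h2 orbT. Qed.

Lemma clamp_upper v x : 0 <= v -> x <= v -> clamp x <= v.
Proof. by move=> h1 h2; rewrite /clamp ge_max ge_min h1 h2 orbT. Qed.

End clamp_bounds.

(** * From the square to the cones and back *)

Section to_cones.
Context {R : realType} (y e : R).
Implicit Types (x Y t T : R) (u a : R * R) (k n : nat).
Hypotheses (ok : admissible y e) (yp : 0 < y) (y2 : y <= 2^-1).

Notation lo := (lo y e).
Notation hi := (hi y e).
Notation width := (width y e).
Notation sheet := (sheet y e).

(* Height in the two cones; it vanishes in the middle of the square. *)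
Definition level Y : R := clamp ((Y - (1 - y / 2)) / (y / 4)) - clamp ((y / 2 - Y) / (y / 4)).

Let y40 : 0 < y / 4. Proof. by rewrite divr_gt0. Qed.

Lemma level_itv Y : -1 <= level Y <= 1.
Proof.
rewrite /level; have := clamp01 ((Y - (1 - y / 2)) / (y / 4)).
by have := clamp01 ((y / 2 - Y) / (y / 4)); move: (clamp _) (clamp _) => p q; lra.
Qed.

Lemma level_ge0 Y : y / 2 <= Y -> 0 <= level Y.
Proof.
move=> h; rewrite /level [X in _ - X]clamp_le0 ?subr0; first by case/andP: (clamp01 ((Y - (1 - y / 2)) / (y / 4))).
by rewrite pmulr_lle0 ?invr_gt0 // subr_le0.
Qed.

Lemma level_le0 Y : Y <= 1 - y / 2 -> level Y <= 0.
Proof.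
move=> h; rewrite /level [X in X - _]clamp_le0 ?sub0r ?oppr_le0; first by case/andP: (clamp01 ((y / 2 - Y) / (y / 4))).
by rewrite pmulr_lle0 ?invr_gt0 // subr_le0.
Qed.

Lemma level1 Y : 1 - y / 4 <= Y -> level Y = 1.
Proof.
have yp' := yp; have y2' := y2.
move=> h; rewrite /level clamp_ge1 ?clamp_le0 ?subr0 //.
  by rewrite pmulr_lle0 ?invr_gt0 // subr_le0; lra.
by rewrite ler_pdivlMr // mul1r; lra.
Qed.

Lemma levelN1 Y : Y <= y / 4 -> level Y = -1.
Proof.
have yp' := yp; have y2' := y2.
move=> h; rewrite /level clamp_le0 ?clamp_ge1 ?sub0r //.
  by rewrite ler_pdivlMr // mul1r; lra.
by rewrite pmulr_lle0 ?invr_gt0 // subr_le0; lra.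
Qed.

Lemma cts_level (U : topologicalType) (A : set U) (f : U -> R) :
  {within A, continuous f} -> {within A, continuous (fun v => level (f v))}.
Proof. by move=> cf; rewrite /level; cts. Qed.

(** The regions above the band are separated by the points 1/(2n) where it touches the top edge, so
    the n-th one has indices 2n - 2 and 2n - 1. Those below are separated by the points 1/(2n-1) and
    have indices 2n - 1 and 2n, whence [num_lo]. *)
Definition num_up x : nat := (idx x)./2.+1.
Definition num_lo x : nat := uphalf (idx x).
(** Equal to 1 unless the zigzag is within y/4 of the top edge, and 0 where it touches that edge:
    this factor hides the jump of [num_up] at the touching points. *)
Definition plateau_up x : R := Num.min 1 ((1 - zigzag x) / (y / 4)).
Definition plateau_lo x : R := Num.min 1 (zigzag x / (y / 4)).

Lemma num_lo_gt0 x : 0 < x <= 1 -> (0 < num_lo x)%N.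
Proof. by move=> /idx_itv[k0 _]; rewrite uphalf_gt0. Qed.

Lemma diam_up_le x : 0 < x <= 1 -> arc_diam (num_up x) <= 4 * x.
Proof.
move=> x01; have [k0 /andP[_ h]] := idx_itv x01; have [x0 _] := andP x01.
rewrite /arc_diam ler_pdivrMr ?ltr0n //.
have : (idx x).+1%:R <= 2 * (num_up x)%:R :> R.
  by rewrite -natrM ler_nat /num_up mul2n doubleS -{1}(odd_double_half (idx x)); case: odd.
have := ler_wpM2r (ltW x0); move=> /[apply]; move: h.
move: ((idx x).+1%:R : R) ((num_up x)%:R : R) => a b; nra.
Qed.

Lemma diam_lo_le x : 0 < x <= 1 -> arc_diam (num_lo x) <= 8 * x.
Proof.
move=> x01; have [k0 /andP[_ h]] := idx_itv x01; have [x0 _] := andP x01.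
rewrite /arc_diam ler_pdivrMr ?ltr0n ?num_lo_gt0 //.
have : (idx x).+1%:R <= 4 * (num_lo x)%:R :> R.
  rewrite -natrM ler_nat /num_lo; case: (idx x) k0 => // k _.
  rewrite [uphalf _]/= mulnS -{1}(odd_double_half k).
  have -> : (4 * k./2 = k./2.*2 + k./2.*2)%N by rewrite -!mul2n -mulnDl.
  apply: (@leq_trans (3 + k./2.*2)); last by rewrite leq_add // leq_addr.
  by rewrite -addn2 addnAC leq_add2r; case: odd.
have := ler_wpM2r (ltW x0); move=> /[apply]; move: h.
move: ((idx x).+1%:R : R) ((num_lo x)%:R : R) => a b; nra.
Qed.

Lemma plateau_up_itv x : 0 < x <= 1 -> 0 <= plateau_up x <= 1.
Proof.
move=> /zigzag_itv/andP[z0 z1]; rewrite /plateau_up ge_min lexx andbT le_min ler01 /=.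
by rewrite divr_ge0 ?subr_ge0 // ltW.
Qed.

Lemma plateau_lo_itv x : 0 < x <= 1 -> 0 <= plateau_lo x <= 1.
Proof.
move=> /zigzag_itv/andP[z0 z1]; rewrite /plateau_lo ge_min lexx andbT le_min ler01 /=.
by rewrite divr_ge0 // ltW.
Qed.

Lemma cts_zigzag (A : set (R * R)) : (forall u, A u -> 0 < u.1 <= 1) ->
  {within A, continuous (fun u : R * R => zigzag u.1)}.
Proof. by apply: cts_pl => u; exact: cvg_fst. Qed.

(** Between the pieces k and k + 1 the number changes only for odd k, and then [zigzag] is 1 at
    1/(k+1), so that [plateau_up] vanishes there. *)
Lemma cts_diam_up j (A : set (R * R)) : (forall u, A u -> 0 < u.1 <= 1) ->
  {within A, continuous (fun u : R * R => arc_diam (num_up u.1) ^+ j * plateau_up u.1)}.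
Proof.
move=> A01; apply: (@cts_pieces R _ _ A fst) => // [u|k k0]; first exact: cvg_fst.
have cz : {within A `&` fst @^-1` piece k, continuous (fun u : R * R => zigzag u.1)}.
  by apply: cts_zigzag => u [/A01].
apply: (@cts_eq _ _ _ (fun u : R * R => arc_diam k./2.+1 ^+ j * plateau_up u.1)).
  move=> u [Au pk]; rewrite /num_up; case: (piece_eq k0 pk) => [-> //|[uk ->]].
  have uE : u.1 = k.+1%:R^-1 by apply: (@mulfI _ k.+1%:R); rewrite ?pnatr_eq0 // uk mulfV ?pnatr_eq0.
  rewrite /plateau_up uE /zigzag pl_V //=; case: (boolP (odd k)) => ko.
    by rewrite /= subrr mul0r min_r ?ler01 // !mulr0.
  by rewrite uphalf_half (negPf ko).
by rewrite /plateau_up; cts.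
Qed.

Lemma cts_diam_lo j (A : set (R * R)) : (forall u, A u -> 0 < u.1 <= 1) ->
  {within A, continuous (fun u : R * R => arc_diam (num_lo u.1) ^+ j * plateau_lo u.1)}.
Proof.
move=> A01; apply: (@cts_pieces R _ _ A fst) => // [u|k k0]; first exact: cvg_fst.
have cz : {within A `&` fst @^-1` piece k, continuous (fun u : R * R => zigzag u.1)}.
  by apply: cts_zigzag => u [/A01].
apply: (@cts_eq _ _ _ (fun u : R * R => arc_diam (uphalf k) ^+ j * plateau_lo u.1)).
  move=> u [Au pk]; rewrite /num_lo; case: (piece_eq k0 pk) => [-> //|[uk ->]].
  have uE : u.1 = k.+1%:R^-1 by apply: (@mulfI _ k.+1%:R); rewrite ?pnatr_eq0 // uk mulfV ?pnatr_eq0.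
  rewrite /plateau_lo uE /zigzag pl_V //=; case: (boolP (odd k)) => ko; last first.
    by rewrite /= mul0r min_r ?ler01 // !mulr0.
  by rewrite uphalf_half ko.
by rewrite /plateau_lo; cts.
Qed.

(** Affine coordinate across the band: -1 on [lo], 0 on the middle line, 1 on [hi]. Off the band it
    leaves this range and is truncated in [base]. *)
Definition center x Y : R := (2 * (Y - lo x) - width x) / width x.

(* Points above the band go to the foot of an upper arc, points below it to
   the foot of a lower arc, and the middle of the band goes to 0. *)
Definition base u : R * R :=
  if 0 < u.1 then
    (clamp (center u.1 u.2) * (arc_diam (num_up u.1) ^+ 1 * plateau_up u.1) +
     clamp (- center u.1 u.2) * (arc_diam (num_lo u.1) ^+ 1 * plateau_lo u.1),
     clamp (center u.1 u.2) * (arc_diam (num_up u.1) ^+ 2 * plateau_up u.1) -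
     clamp (- center u.1 u.2) * (arc_diam (num_lo u.1) ^+ 2 * plateau_lo u.1))
  else 0.

Lemma base_up u : 0 < u.1 -> 0 <= center u.1 u.2 ->
  let r := clamp (center u.1 u.2) * plateau_up u.1 in let d := arc_diam (num_up u.1) in
  base u = (d * r, d ^+ 2 * r).
Proof.
move=> u0 c0; rewrite /base u0 (@clamp_le0 _ (- _)) ?oppr_le0 // !mul0r addr0 subr0.
by rewrite expr1; congr (_, _); ring.
Qed.

Lemma base_lo u : 0 < u.1 -> center u.1 u.2 <= 0 ->
  let r := clamp (- center u.1 u.2) * plateau_lo u.1 in let d := arc_diam (num_lo u.1) in
  base u = (d * r, - (d ^+ 2 * r)).
Proof.
move=> u0 c0; rewrite /base u0 (@clamp_le0 _ (center _ _)) // !mul0r add0r sub0r.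
by rewrite expr1; congr (_, _); ring.
Qed.

Lemma base0 Y : base (0, Y) = 0.
Proof. by rewrite /base ltxx. Qed.

Lemma sq_pos u : unit_square R u -> u.1 != 0 -> 0 < u.1 <= 1.
Proof. by move=> /unit_squareP[/andP[x0 ->] _] xn; rewrite lt_def xn x0. Qed.

Lemma base_arcs u : unit_square R u -> arcs (base u).
Proof.
move=> sq; have [x0|xn] := eqVneq u.1 0; first by left; rewrite /base x0 ltxx.
have xp := sq_pos sq xn; have [x0 _] := andP xp.
have [c0|c0] := leP 0 (center u.1 u.2).
  rewrite base_up //; have d0 := @arc_diam_gt0 R (num_up u.1) isT.
  right; exists (num_up u.1) => //=; set r := _ * plateau_up _.
  have /andP[r0 r1] : 0 <= r <= 1.
    have [h1 h2] := andP (clamp01 (center u.1 u.2)).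
    have [h3 h4] := andP (plateau_up_itv xp).
    by rewrite mulr_ge0 //= mulr_ile1.
  rewrite (ger0_norm (mulr_ge0 (exprn_ge0 2 (ltW d0)) r0)); split; first by ring.
  by rewrite (mulr_ge0 (ltW d0) r0) ler_piMr // ltW.
rewrite base_lo ?(ltW c0) //; have d0 := @arc_diam_gt0 R _ (num_lo_gt0 xp).
right; exists (num_lo u.1); first exact: num_lo_gt0.
rewrite /=; set r := _ * plateau_lo _.
have /andP[r0 r1] : 0 <= r <= 1.
  have [h1 h2] := andP (clamp01 (- center u.1 u.2)).
  have [h3 h4] := andP (plateau_lo_itv xp).
  by rewrite mulr_ge0 //= mulr_ile1.
rewrite normrN (ger0_norm (mulr_ge0 (exprn_ge0 2 (ltW d0)) r0)); split; first by ring.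
by rewrite (mulr_ge0 (ltW d0) r0) ler_piMr // ltW.
Qed.

Lemma cts_base : {within unit_square R, continuous base}.
Proof.
pose A := unit_square R `&` [set u : R * R | 0 < u.1].
have A01 u : A u -> 0 < u.1 <= 1 by move=> [sq u0]; apply: sq_pos => //; rewrite gt_eqF.
have cf : continuous (fst : R * R -> R) by move=> u; exact: cvg_fst.
have cc : {within A, continuous (fun u : R * R => center u.1 u.2)}.
  rewrite /center; have cw : {within A, continuous (fun u : R * R => width u.1)} by exact: cts_width.
  have cl : {within A, continuous (fun u : R * R => lo u.1)} by exact: cts_lo.
  have cv : {within A, continuous (fun u : R * R => (width u.1)^-1)}.
    by apply: cts_V => // u /A01/(width_itv ok)/andP[/lt0r_neq0].
  by cts.
have c1 := cts_diam_up (j := 1) A01; have c2 := cts_diam_up (j := 2) A01.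
have c3 := cts_diam_lo (j := 1) A01; have c4 := cts_diam_lo (j := 2) A01.
have cE : {within A, continuous (fun u => ((base u).1, (base u).2))}.
  apply: (@cts_eq _ _ _ (fun u : R * R =>
   (clamp (center u.1 u.2) * (arc_diam (num_up u.1) ^+ 1 * plateau_up u.1) +
     clamp (- center u.1 u.2) * (arc_diam (num_lo u.1) ^+ 1 * plateau_lo u.1),
     clamp (center u.1 u.2) * (arc_diam (num_up u.1) ^+ 2 * plateau_up u.1) -
     clamp (- center u.1 u.2) * (arc_diam (num_lo u.1) ^+ 2 * plateau_lo u.1)))).
    by move=> u [_ /= u0]; rewrite /base u0.
  by apply: cts_pair; [apply: cts_D|apply: cts_B]; (apply: cts_M; [by cts|assumption]).
have bd u : unit_square R u -> 0 <= (base u).1 <= 8 * u.1 /\ `|(base u).2| <= 16 * u.1.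
  move=> sq; have [n n0 [h1 h2 h3]] := arcsP (base_arcs sq).
  have b8 : (base u).1 <= 8 * u.1.
    have [x0|xn] := eqVneq u.1 0; first by rewrite /base x0 ltxx mulr0.
    have xp := sq_pos sq xn; have [x0 _] := andP xp.
    have [c0|c0] := leP 0 (center u.1 u.2).
      rewrite base_up //=; have d0 := @arc_diam_gt0 R (num_up u.1) isT.
      have [h4 h5] := andP (clamp01 (center u.1 u.2)).
      have [h6 h7] := andP (plateau_up_itv xp).
      apply: le_trans (_ : 4 * u.1 <= _); last by lra.
      apply: le_trans (diam_up_le xp); rewrite ler_piMr ?(ltW d0) //.
      by rewrite mulr_ile1.
    rewrite base_lo ?(ltW c0) //=; have d0 := @arc_diam_gt0 R _ (num_lo_gt0 xp).
    have [h4 h5] := andP (clamp01 (- center u.1 u.2)).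
    have [h6 h7] := andP (plateau_lo_itv xp).
    apply: le_trans (diam_lo_le xp); rewrite ler_piMr ?(ltW d0) //.
    by rewrite mulr_ile1.
  split; first by rewrite h2.
  have := @arc_diam_le R n n0; rewrite h1 => d2.
  by have := ler_wpM2r h2 d2; lra.
apply: (@cts_eq _ _ _ (fun u => ((base u).1, (base u).2))).
  by move=> u _; rewrite -surjective_pairing.
apply: cts_pair.
  apply: (@cts_squeeze R _ _ fst _ (fun=> 0) 8) => //.
  - exact: cts_cst.
  - by move=> u /unit_squareP[/andP[]].
  - by move=> u /bd[/andP[h1 h2] _]; rewrite subr0 ger0_norm.
  - exact: (cts_fst cE).
apply: (@cts_squeeze R _ _ fst _ (fun=> 0) 16) => //.
- exact: cts_cst.
- by move=> u /unit_squareP[/andP[]].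
- by move=> u /bd[_ h]; rewrite subr0.
- exact: (cts_snd cE).
Qed.

(** As [hi] is at most 1 and the width at least [y], the middle line stays below 1 - y/2. So the
    part of the square sent to positive levels meets only arcs of the upper kind, whatever the
    abscissa. *)
Lemma center_ge0 x Y : 0 < x <= 1 -> 1 - y / 2 <= Y -> 0 <= center x Y.
Proof.
move=> x01 h; have /andP[w0 w1] := width_itv ok x01; have := hi_le1 ok x01.
have yw : y <= width x.
  by case: ok => _ e0 _ _; rewrite /width lerDl mulr_ge0 //; case/andP: x01 => /ltW.
by rewrite /hi => h2; rewrite divr_ge0 ?(ltW w0) //; lra.
Qed.

Lemma center_le0 x Y : 0 < x <= 1 -> Y <= y / 2 -> center x Y <= 0.
Proof.
move=> x01 h; have /andP[w0 w1] := width_itv ok x01; have := lo_ge0 ok x01.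
have yw : y <= width x.
  by case: ok => _ e0 _ _; rewrite /width lerDl mulr_ge0 //; case/andP: x01 => /ltW.
by move=> h2; rewrite mulr_le0_ge0 ?invr_ge0 ?(ltW w0) //; lra.
Qed.

Lemma base_ge0 u : 0 < u.1 <= 1 -> 0 <= center u.1 u.2 -> 0 <= (base u).2.
Proof.
move=> x01 c0; have [x0 _] := andP x01; rewrite base_up //=.
have [h1 _] := andP (clamp01 (center u.1 u.2)); have [h2 _] := andP (plateau_up_itv x01).
by rewrite !mulr_ge0.
Qed.

Lemma base_le0 u : 0 < u.1 <= 1 -> center u.1 u.2 <= 0 -> (base u).2 <= 0.
Proof.
move=> x01 c0; have [x0 _] := andP x01; rewrite base_lo //= oppr_le0.
have [h1 _] := andP (clamp01 (- center u.1 u.2)); have [h2 _] := andP (plateau_lo_itv x01).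
by rewrite !mulr_ge0.
Qed.

Lemma base_level_gt0 u : unit_square R u -> 0 < level u.2 -> 0 <= (base u).2.
Proof.
move=> sq l0; have [x0|xn] := eqVneq u.1 0; first by rewrite /base x0 ltxx.
apply: base_ge0; first exact: sq_pos.
apply: center_ge0; first exact: sq_pos.
by rewrite leNgt; apply/negP => /ltW/level_le0; rewrite leNgt l0.
Qed.

Lemma base_level_lt0 u : unit_square R u -> level u.2 < 0 -> (base u).2 <= 0.
Proof.
move=> sq l0; have [x0|xn] := eqVneq u.1 0; first by rewrite /base x0 ltxx.
apply: base_le0; first exact: sq_pos.
apply: center_le0; first exact: sq_pos.
by rewrite leNgt; apply/negP => /ltW/level_ge0; rewrite leNgt l0.
Qed.

Lemma base_above u : 0 < u.1 <= 1 -> hi u.1 <= u.2 ->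
  let d := arc_diam (num_up u.1) in
  base u = (d * plateau_up u.1, d ^+ 2 * plateau_up u.1).
Proof.
move=> x01 h; have [x0 _] := andP x01; have /andP[w0 _] := width_itv ok x01.
have c1 : 1 <= center u.1 u.2 by rewrite ler_pdivlMr // mul1r; move: h; rewrite /hi; lra.
by rewrite base_up ?clamp_ge1 ?mul1r //; lra.
Qed.

Lemma base_below u : 0 < u.1 <= 1 -> u.2 <= lo u.1 ->
  let d := arc_diam (num_lo u.1) in
  base u = (d * plateau_lo u.1, - (d ^+ 2 * plateau_lo u.1)).
Proof.
move=> x01 h; have [x0 _] := andP x01; have /andP[w0 _] := width_itv ok x01.
have c1 : 1 <= - center u.1 u.2.
  by rewrite /center -mulNr ler_pdivlMr // mul1r; lra.
by rewrite base_lo ?clamp_ge1 ?mul1r //; lra.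
Qed.

(** A reduced plateau means that the zigzag is above 1 - y/4; a point above the band is above the
    zigzag too, hence at [level] 1. That is the apex of the cone, where the position in the arcs is
    forgotten, so the reduction costs nothing. *)
Lemma plateau_up_lt1 u : 0 < u.1 <= 1 -> hi u.1 <= u.2 -> u.2 <= 1 ->
  plateau_up u.1 = 1 \/ 1 - y / 4 <= u.2.
Proof.
move=> x01 h _; rewrite /plateau_up; have := zigzag_le_hi ok x01.
have [l|l] := leP 1 ((1 - zigzag u.1) / (y / 4)); [by left|right].
by move: l; rewrite ltr_pdivrMr // mul1r; lra.
Qed.

Lemma plateau_lo_lt1 u : 0 < u.1 <= 1 -> u.2 <= lo u.1 ->
  plateau_lo u.1 = 1 \/ u.2 <= y / 4.
Proof.
move=> x01 h; rewrite /plateau_lo; have := lo_le_zigzag ok x01.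
have [l|l] := leP 1 (zigzag u.1 / (y / 4)); [by left|right].
by move: l; rewrite ltr_pdivrMr // mul1r; lra.
Qed.

Definition to_cones u : R * R * R :=
  ((1 - `|level u.2|) * (base u).1, (1 - `|level u.2|) * (base u).2, level u.2).

Lemma cts_to_cones : {within unit_square R, continuous to_cones}.
Proof.
have cb := cts_base; have cl : {within unit_square R, continuous (fun u : R * R => level u.2)}.
  by apply: cts_level; cts.
by rewrite /to_cones; cts; exact: cb.
Qed.

Lemma arc_height_cone T a : -1 <= T <= 1 ->
  arc_height ((1 - `|T|) * a.1, (1 - `|T|) * a.2, T) = (1 - `|T|) ^+ 2 * (`|a.2| - a.1 ^+ 2).
Proof.
move=> T1; have T0 : 0 <= 1 - `|T| by rewrite subr_ge0 ler_norml.
by rewrite /arc_height /= normrM (ger0_norm T0); ring.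
Qed.

Lemma arc_cones_cone T a : -1 <= T <= 1 -> arcs a ->
  (0 < T -> 0 <= a.2) -> (T < 0 -> a.2 <= 0) ->
  arc_cones ((1 - `|T|) * a.1, (1 - `|T|) * a.2, T).
Proof.
move=> T1 Aa Tp Tn; have T0 : 0 <= 1 - `|T| by rewrite subr_ge0 ler_norml.
split => //=; last by exists a.
have [h|h|->] := ltgtP T 0; last by rewrite mul0r.
- by rewrite -mulrNN mulr_ge0 ?oppr_ge0 ?(ltW h) // mulr_ge0_le0 // Tn.
- by rewrite mulr_ge0 ?(ltW h) // mulr_ge0 // Tp.
Qed.

(** Points off the band hit the foot of an arc or an apex, points of the left edge hit arc
    coordinate 0, and [arc_height] vanishes at all of these. *)
Lemma to_cones_pair u : unit_square R u ->
  arc_cones (to_cones u) /\ (sheet u = 0 -> arc_height (to_cones u) = 0).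
Proof.
move=> sq; split.
  apply: arc_cones_cone; [exact: level_itv|exact: base_arcs| |].
    exact: base_level_gt0.
  exact: base_level_lt0.
move=> /(sheet_eq0P ok sq) s0; rewrite arc_height_cone; last exact: level_itv.
case: s0 => [x0|[x01 [h|h]]].
- by rewrite /base x0 ltxx /= normr0 expr0n subr0 mulr0.
- rewrite base_below //; have d0 := @arc_diam_gt0 R _ (num_lo_gt0 x01).
  case: (plateau_lo_lt1 x01 h) => [->|l].
    by rewrite !mulr1 /= normrN (ger0_norm (exprn_ge0 2 (ltW d0))) subrr mulr0.
  by rewrite levelN1 // normrN normr1 subrr expr0n mul0r.
- rewrite base_above //; have d0 := @arc_diam_gt0 R (num_up u.1) isT.
  have /unit_squareP[_ /andP[_ u1]] := sq.
  case: (plateau_up_lt1 x01 h u1) => [->|l].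
    by rewrite !mulr1 /= (ger0_norm (exprn_ge0 2 (ltW d0))) subrr mulr0.
  by rewrite level1 // normr1 subrr expr0n mul0r.
Qed.

(* Signed abscissa: the foot of the n-th upper arc goes to 1/(2n-1), that of
   the n-th lower arc to -1/(2n). *)
Definition spread a : R := if 0 < a.2 then a.1 / (4 - a.1) else - (a.1 / 4).

(** The centre 1/2 and the term [e * spread a] keep the feet off the band: at an upper foot of
    abscissa x the band ends at y + e x, and [y] is at most 1/2; lower feet are symmetric. *)
Definition pull a T : R * R := (`|spread a|, clamp (2^-1 + T + e * spread a)).

(** What continuity of [spread] asks for: its two formulas meet along a.2 = 0, where both have to
    give 0, and 4 - a.1 must stay away from 0. *)
Definition arc_cover : set (R * R) := [set a | 0 <= a.1 <= 2 /\ (a.2 = 0 -> a.1 = 0)].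

Lemma arcs_cover a : arcs a -> arc_cover a.
Proof.
move=> /arcsP[n n0 [an a0 ad]]; split; first by rewrite a0 (le_trans ad) // arc_diam_le.
move=> a2; move: an; rewrite a2 normr0 => /esym/eqP; rewrite mulf_eq0.
by rewrite gt_eqF ?arc_diam_gt0 //= => /eqP.
Qed.

Lemma spread_le a : arc_cover a -> `|spread a| <= a.1 / 2.
Proof.
move=> [/andP[a0 a2] _]; rewrite /spread; case: ifP => _; last first.
  by rewrite normrN ger0_norm; lra.
rewrite ger0_norm ?divr_ge0 //; last by lra.
by apply: ler_wpM2l => //; rewrite lef_pV2 ?posrE; lra.
Qed.

Lemma spread_ge0 a : arc_cover a -> 0 <= a.2 -> 0 <= spread a.
Proof.
move=> [/andP[a0 a2] az]; rewrite le_eqVlt => /orP[/eqP h|h].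
  by rewrite /spread -h ltxx az ?mul0r ?oppr0.
by rewrite /spread h divr_ge0 //; lra.
Qed.

Lemma spread_le0 a : arc_cover a -> a.2 <= 0 -> spread a <= 0.
Proof.
by move=> [/andP[a0 a2] az] h; rewrite /spread ltNge h /= oppr_le0 divr_ge0.
Qed.

Lemma cts_spread : {within arc_cover, continuous spread}.
Proof.
apply: (@cts_squeeze R _ _ fst _ (fun=> 0) 1).
- by move=> a; exact: cvg_fst.
- exact: cts_cst.
- by move=> a [/andP[]].
- move=> a aC; rewrite subr0; have := spread_le aC.
  by case: aC => /andP[a0 _] _; lra.
have c2 : continuous (snd : R * R -> R) by move=> a; exact: cvg_snd.
apply: (@cts_paste _ _ _ ((fun a : R * R => a.2) @^-1` [set r : R | 0 <= r]) ((fun a : R * R => a.2) @^-1` [set r : R | r <= 0])).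
- by apply: preimage_closed; [move=> a _; exact: c2|exact: closed_ge].
- by apply: preimage_closed; [move=> a _; exact: c2|exact: closed_le].
- by move=> a _ /=; case: (leP 0 a.2) => h; [left|right; exact: ltW].
- apply: (@cts_eq _ _ _ (fun a : R * R => a.1 / (4 - a.1))).
    move=> a [[[_ az] /= a1] /= a2]; rewrite /spread lt_def a2 andbT.
    by case: eqP => // /az a10; rewrite a10 ltxx in a1.
  have cv : {within arc_cover `&` [set u | 0 < u.1] `&` (fun a : R * R => a.2) @^-1` [set r : R | 0 <= r],
      continuous (fun a : R * R => (4 - a.1)^-1)}.
    apply: cts_V; last by cts.
    by move=> a [[[/andP[_ h] _] _] _]; rewrite gt_eqF //; lra.
  by apply: cts_M => //; cts.
- apply: (@cts_eq _ _ _ (fun a : R * R => - (a.1 / 4))); last by cts.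
  by move=> a [_ /= h]; rewrite /spread ltNge h.
Qed.

Lemma pull_sq a T : arc_cover a -> unit_square R (pull a T).
Proof.
move=> aC; apply/unit_squareP; split; last exact: clamp01.
rewrite /= normr_ge0 /=; apply: le_trans (spread_le aC) _.
by case: aC => /andP[_ h] _; lra.
Qed.

Lemma cts_pull (U : topologicalType) (A : set U) (f : U -> R * R) (g : U -> R) :
  {within A, continuous f} -> {within A, continuous g} ->
  (forall v, A v -> arc_cover (f v)) ->
  {within A, continuous (fun v => pull (f v) (g v))}.
Proof.
move=> cf cg fA; have cs : {within A, continuous (fun v => spread (f v))}.
  exact: (cts_comp cf cts_spread fA).
by rewrite /pull; cts.
Qed.

Lemma pull_above a T : arc_cover a -> 0 <= a.2 -> 2^-1 <= T -> (pull a T).2 = 1.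
Proof.
move=> aC a2 T2; rewrite /pull /= clamp_ge1 //; case: ok => _ e0 _ _.
by have := mulr_ge0 e0 (spread_ge0 aC a2); lra.
Qed.

Lemma pull_below a T : arc_cover a -> a.2 <= 0 -> T <= - 2^-1 -> (pull a T).2 = 0.
Proof.
move=> aC a2 T2; rewrite /pull /= clamp_le0 //; case: ok => _ e0 _ _.
by have := mulr_ge0_le0 e0 (spread_le0 aC a2); lra.
Qed.

Lemma spread_foot_up n : (0 < n)%N ->
  spread (arc_diam n, arc_diam n ^+ 2) = (n.*2.-1)%:R^-1.
Proof.
move=> n0; rewrite /spread /= exprn_gt0 ?arc_diam_gt0 //.
case: n n0 => // n _; rewrite doubleS /= natr_odd /arc_diam.
have : 1 <= n.+1%:R :> R by rewrite ler1n.
by move: n.+1%:R => m m1; field; apply/andP; split; [|apply/andP; split]; lra.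
Qed.

Lemma spread_foot_lo n : (0 < n)%N ->
  spread (arc_diam n, - (arc_diam n ^+ 2)) = - n.*2%:R^-1.
Proof.
move=> n0; rewrite /spread /= ltNge oppr_le0 exprn_ge0 ?(ltW (arc_diam_gt0 _)) //=.
by rewrite /arc_diam -mul2n natrM; field; rewrite pnatr_eq0 -lt0n.
Qed.

Lemma pull_foot_up n T : (0 < n)%N -> 0 <= T ->
  let v := pull (arc_diam n, arc_diam n ^+ 2) T in
  v.1 = (n.*2.-1)%:R^-1 /\ hi v.1 <= v.2.
Proof.
move=> n0 T0 v; have vE : v.1 = (n.*2.-1)%:R^-1.
  by rewrite /v /= spread_foot_up // ger0_norm.
split => //; have k0 : (0 < n.*2.-1)%N by case: (n) n0.
rewrite vE /hi /lo pl_V // /bottoms.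
have -> : odd n.*2.-1 by case: (n) n0 => // m _; rewrite doubleS /= odd_double.
rewrite add0r /v /= spread_foot_up //.
have /andP[_ w1] := widths_itv ok k0; apply: clamp_lower => //.
by rewrite /width; have := y2; have := T0; move: ((n.*2.-1)%:R^-1 : R) => c; lra.
Qed.

Lemma pull_foot_lo n T : (0 < n)%N -> T <= 0 ->
  let v := pull (arc_diam n, - (arc_diam n ^+ 2)) T in
  v.1 = n.*2%:R^-1 /\ v.2 <= lo v.1.
Proof.
move=> n0 T0 v; have vE : v.1 = n.*2%:R^-1.
  by rewrite /v /= spread_foot_lo // normrN ger0_norm.
have k0 : (0 < n.*2)%N by rewrite double_gt0.
split => //; rewrite vE /lo pl_V // /bottoms odd_double.
rewrite /v /= spread_foot_lo //.
have /andP[_ w1] := widths_itv ok k0; apply: clamp_upper; first by rewrite subr_ge0.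
by rewrite /widths; have := y2; have := T0; move: (n.*2%:R^-1 : R) => c; lra.
Qed.

(** Division by 1 - |T| undoes the contraction of the cone. The bound 1/2 keeps the denominator away
    from 0: once |T| reaches 1/2 the image is on the top or bottom edge, where a distorted abscissa
    does no harm. *)
Definition from_cones (g : R * R * R) : R * R :=
  let s := Num.max (1 - `|g.2|) 2^-1 in pull (g.1.1 / s, g.1.2 / s) g.2.

Lemma arc_conesP (g : R * R * R) : arc_cones g -> [/\ -1 <= g.2 <= 1 &
  exists2 a, arcs a & [/\ g = ((1 - `|g.2|) * a.1, (1 - `|g.2|) * a.2, g.2),
    0 < g.2 -> 0 <= a.2 & g.2 < 0 -> a.2 <= 0]].
Proof.
case: g => [[r s] T] [/= T1 Ts [a Aa [rE sE]]]; split => //.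
have T0 : 0 <= 1 - `|T| by rewrite subr_ge0 ler_norml.
have [TE|Tn] := eqVneq (1 - `|T|) 0.
  by exists 0; [left|rewrite rE sE TE !mul0r].
have Tp : 0 < 1 - `|T| by rewrite lt_def Tn.
exists a => //; split; first by rewrite rE sE.
  by move=> h; move: Ts; rewrite sE pmulr_rge0 // pmulr_rge0.
by move=> h; move: Ts; rewrite sE -mulrNN pmulr_rge0 ?oppr_gt0 // -mulrN pmulr_rge0 // oppr_ge0.
Qed.

Definition depth T : R := Num.max (1 - `|T|) 2^-1.

Lemma depth_gt0 T : 0 < depth T.
Proof. by rewrite /depth lt_max invr_gt0 ltr0n orbT. Qed.

Lemma depthE T : `|T| <= 2^-1 -> depth T = 1 - `|T|.
Proof. by move=> h; rewrite /depth max_l //; lra. Qed.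

Lemma from_cones_cover (g : R * R * R) : arc_cones g ->
  arc_cover (g.1.1 / depth g.2, g.1.2 / depth g.2).
Proof.
move=> /arc_conesP[T1 [a Aa [gE _ _]]]; rewrite gE /=.
have T0 : 0 <= 1 - `|g.2| by rewrite subr_ge0 ler_norml.
have k0 := depth_gt0 g.2.
have k1 : (1 - `|g.2|) / depth g.2 <= 1 by rewrite ler_pdivrMr // mul1r /depth le_max lexx.
have k2 : 0 <= (1 - `|g.2|) / depth g.2 by rewrite divr_ge0 // ltW.
have [/andP[a0 a2] az] := arcs_cover Aa.
split => /=; first by rewrite mulrAC mulr_ge0 //=; apply: le_trans a2; rewrite ler_piMl.
move/eqP; rewrite !mulf_eq0 invr_eq0 (gt_eqF k0) orbF => /orP[/eqP ->|/eqP /az ->].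
  by rewrite !mul0r.
by rewrite mulr0 mul0r.
Qed.

Lemma cts_from_cones : {within @arc_cones R, continuous from_cones}.
Proof.
have cd : {within @arc_cones R, continuous (fun g : R * R * R => (depth g.2)^-1)}.
  apply: cts_V; first by move=> g _; rewrite gt_eqF // depth_gt0.
  by rewrite /depth; cts.
apply: cts_pull; last exact: from_cones_cover; last by cts.
by apply: cts_pair; (apply: cts_M => //; cts).
Qed.

Lemma from_cones_low (g : R * R * R) a : `|g.2| <= 2^-1 ->
  g = ((1 - `|g.2|) * a.1, (1 - `|g.2|) * a.2, g.2) -> from_cones g = pull a g.2.
Proof.
move=> h gE; rewrite /from_cones -/(depth g.2) gE /= depthE //.
have k0 : 1 - `|g.2| != 0 by rewrite gt_eqF // -depthE // depth_gt0.
by rewrite ![(1 - _) * _]mulrC !mulfK // -surjective_pairing.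
Qed.

Lemma from_cones_sq (g : R * R * R) : arc_cones g -> unit_square R (from_cones g).
Proof. by move=> /from_cones_cover h; exact: pull_sq. Qed.

Lemma from_cones_high (g : R * R * R) : arc_cones g -> 2^-1 <= g.2 -> (from_cones g).2 = 1.
Proof.
move=> gc T2; have cov := from_cones_cover gc.
have [T1 [a Aa [gE ap _]]] := arc_conesP gc.
have T0 : 0 <= 1 - `|g.2| by rewrite subr_ge0 ler_norml.
apply: pull_above => //=; rewrite gE /= divr_ge0 ?(ltW (depth_gt0 _)) // mulr_ge0 //.
by apply: ap; lra.
Qed.

Lemma from_cones_deep (g : R * R * R) : arc_cones g -> g.2 <= - 2^-1 -> (from_cones g).2 = 0.
Proof.
move=> gc T2; have cov := from_cones_cover gc.
have [T1 [a Aa [gE _ an]]] := arc_conesP gc.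
have T0 : 0 <= 1 - `|g.2| by rewrite subr_ge0 ler_norml.
apply: pull_below => //=; rewrite gE /= mulr_le0_ge0 ?invr_ge0 ?(ltW (depth_gt0 _)) //.
by rewrite mulr_ge0_le0 // an //; lra.
Qed.

Lemma sheet_top (v : R * R) : unit_square R v -> v.2 = 1 -> sheet v = 0.
Proof.
move=> sq v1; apply/(sheet_eq0P ok sq); have [->|vn] := eqVneq v.1 0; [by left|right].
have v01 := sq_pos sq vn; split => //; right; rewrite v1; exact: hi_le1.
Qed.

Lemma sheet_bottom (v : R * R) : unit_square R v -> v.2 = 0 -> sheet v = 0.
Proof.
move=> sq v0; apply/(sheet_eq0P ok sq); have [->|vn] := eqVneq v.1 0; [by left|right].
have v01 := sq_pos sq vn; split => //; left; rewrite v0; exact: lo_ge0.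
Qed.

Lemma spread0 : spread 0 = 0.
Proof. by rewrite /spread ltxx mul0r oppr0. Qed.

Lemma arcs_height_eq0 a : arcs a -> `|a.2| - a.1 ^+ 2 = 0 -> a = 0 \/
  exists2 n, (0 < n)%N & a = (arc_diam n, arc_diam n ^+ 2) \/ a = (arc_diam n, - (arc_diam n ^+ 2)).
Proof.
move=> /arcsP[n n0 [an a0 ad]] h.
have [az|ap] := eqVneq a.1 0.
  left; have a2 : a.2 = 0 by apply/eqP; rewrite -normr_eq0 an az mulr0.
  by rewrite [LHS]surjective_pairing az a2.
right; exists n => //; have aE : a.1 = arc_diam n.
  by apply: (mulIf ap); rewrite -an -expr2; lra.
rewrite [a]surjective_pairing aE; move: an; rewrite aE -expr2.
by have [s|s] := leP 0 a.2; [rewrite ger0_norm // => ->; left|rewrite ltr0_norm // => <-; right; rewrite opprK].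
Qed.

(** The zeros are the apexes, which go to the top or bottom edge, the points over arc coordinate 0,
    and the feet. For |T| below 1/2 the second kind goes to the left edge, and a foot is brought
    beyond the band at its own abscissa by [pull_foot_up] or [pull_foot_lo]. *)
Lemma from_cones_pair (g : R * R * R) : arc_cones g ->
  unit_square R (from_cones g) /\ (arc_height g = 0 -> sheet (from_cones g) = 0).
Proof.
move=> gc; have sq := from_cones_sq gc; split => //.
have [T1 [a Aa [gE ap an]]] := arc_conesP gc.
rewrite {1}gE arc_height_cone // => /eqP; rewrite mulf_eq0 expf_eq0 /= => /orP[/eqP T0|/eqP az].
  have [h|h] := leP 0 g.2.
    by apply: sheet_top => //; apply: from_cones_high => //; rewrite ger0_norm // in T0; lra.
  by apply: sheet_bottom => //; apply: from_cones_deep => //; rewrite ltr0_norm // in T0; lra.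
have [hT|hT] := leP 2^-1 g.2; first by apply: sheet_top => //; exact: from_cones_high.
have [hT'|hT'] := leP g.2 (- 2^-1); first by apply: sheet_bottom => //; exact: from_cones_deep.
have Tl : `|g.2| <= 2^-1 by rewrite ler_norml !ltW.
apply/(sheet_eq0P ok sq); rewrite (from_cones_low Tl gE).
case: (arcs_height_eq0 Aa az) => [a0|[n n0 [aE|aE]]].
- by left; rewrite a0 /pull spread0 normr0.
- right; have d2 : 0 < arc_diam n ^+ 2 :> R by rewrite exprn_gt0 ?arc_diam_gt0.
  have T0 : 0 <= g.2 by rewrite leNgt; apply/negP => /an; rewrite aE /= leNgt d2.
  have [h1 h2] := pull_foot_up n0 T0; rewrite aE; split; last by right.
  by rewrite h1; apply: invn_itv; case: (n) n0.
- right; have d2 : 0 < arc_diam n ^+ 2 :> R by rewrite exprn_gt0 ?arc_diam_gt0.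
  have T0 : g.2 <= 0 by rewrite leNgt; apply/negP => /ap; rewrite aE /= oppr_ge0 leNgt d2.
  have [h1 h2] := pull_foot_lo n0 T0; rewrite aE; split; last by left.
  by rewrite h1; apply: invn_itv; rewrite double_gt0.
Qed.

(** * The round trip from the square *)

Lemma sq_seg t (v w : R * R) : 0 <= t <= 1 -> unit_square R v -> unit_square R w ->
  unit_square R ((1 - t) * v.1 + t * w.1, (1 - t) * v.2 + t * w.2).
Proof.
move=> /andP[t0 t1] /unit_squareP[/andP[? ?] /andP[? ?]] /unit_squareP[/andP[? ?] /andP[? ?]].
by apply/unit_squareP; split; apply/andP; split => /=; nra.
Qed.

(** The identity on [y/2, 1 - y/2], and constant on the two end intervals of length y/4. It brings
    to the top or bottom edge exactly the heights at which [level] is 1 or -1, before [flatten]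
    changes the abscissas there without control. *)
Definition stretch Y : R := clamp (Y + Num.max 0 (Y - (1 - y / 2)) - Num.max 0 (y / 2 - Y)).

Lemma stretch_ge Y : y / 2 <= Y <= 1 -> Y <= stretch Y.
Proof.
move=> /andP[h1 h2]; apply: clamp_lower => //.
by rewrite [Num.max 0 (y / 2 - Y)]max_l ?subr_le0 // subr0 lerDl le_max lexx.
Qed.

Lemma stretch_le Y : 0 <= Y <= 1 - y / 2 -> stretch Y <= Y.
Proof.
move=> /andP[h1 h2]; apply: clamp_upper => //.
by rewrite [Num.max 0 (Y - _)]max_l ?subr_le0 // addr0 gerBl le_max lexx.
Qed.

Lemma stretch1 Y : 1 - y / 4 <= Y -> stretch Y = 1.
Proof.
have [yp' y2'] := (yp, y2).
move=> h; rewrite /stretch clamp_ge1 // [Num.max 0 (y / 2 - Y)]max_l; last by lra.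
by rewrite max_r; lra.
Qed.

Lemma stretch0 Y : Y <= y / 4 -> stretch Y = 0.
Proof.
have [yp' y2'] := (yp, y2).
move=> h; rewrite /stretch clamp_le0 // [Num.max 0 (Y - _)]max_l; last by lra.
by rewrite max_r; lra.
Qed.

(** The round trip without the bound on the denominator in [from_cones]; the two agree as long as
    |[level]| is at most 1/2. *)
Definition flatten u : R * R := pull (base u) (level u.2).

Lemma hi_ge x : 0 < x <= 1 -> y <= hi x.
Proof.
move=> x01; have := lo_ge0 ok x01; rewrite /hi /width; case: ok => _ e0 _ _.
by have : 0 <= e * x; [rewrite mulr_ge0 //; case/andP: x01 => /ltW|lra].
Qed.

Lemma lo_le x : 0 < x <= 1 -> lo x <= 1 - y.
Proof.
move=> x01; have := hi_le1 ok x01; rewrite /hi /width; case: ok => _ e0 _ _.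
by have : 0 <= e * x; [rewrite mulr_ge0 //; case/andP: x01 => /ltW|lra].
Qed.

Lemma double_half_up k : (k./2.+1).*2.-1 = if odd k then k else k.+1.
Proof.
rewrite doubleS /=; case: (boolP (odd k)) => ko.
  by rewrite -{2}(odd_double_half k) ko.
by rewrite -{2}(odd_double_half k) (negPf ko).
Qed.

Lemma double_half_lo k : (uphalf k).*2 = if odd k then k.+1 else k.
Proof.
rewrite uphalf_half doubleD; case: (boolP (odd k)) => ko.
  by rewrite -{2}(odd_double_half k) ko.
by rewrite -{2}(odd_double_half k) (negPf ko).
Qed.

(** If the plateau is 1, the image lies over the end 1/j, j odd, of the piece of [u]. So both points
    lie over one piece, where [hi] is affine, and the segment between them stays above the band.
    Otherwise both ends of the homotopy are on the top edge. *)
Lemma flatten_above u : unit_square R u -> 0 < u.1 <= 1 -> hi u.1 <= u.2 ->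
  (flatten u).2 = 1 /\ stretch u.2 = 1 \/
  exists k, [/\ (0 < k)%N, piece k u.1, piece k (flatten u).1 &
                hi (flatten u).1 <= (flatten u).2].
Proof.
move=> sq x01 h; have /unit_squareP[_ /andP[_ Y1]] := sq.
have [yp' hy] := (yp, hi_ge x01).
have bE := base_above x01 h.
case: (plateau_up_lt1 x01 h Y1) => [p1|l]; [right|left].
  have [k0 _] := idx_itv x01; have pk := piece_idx x01.
  exists (idx u.1); rewrite /flatten bE p1 !mulr1.
  have T0 : 0 <= level u.2 by apply: level_ge0; lra.
  have [v1 v2] := @pull_foot_up (num_up u.1) _ isT T0; split => //; rewrite v1.
  by rewrite double_half_up; case: odd; [exact: piece_V|exact: piece_VS].
rewrite /flatten level1 // stretch1 // pull_above //; last by lra.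
  by apply: arcs_cover; exact: base_arcs.
rewrite bE /= mulr_ge0 ?exprn_ge0 ?(ltW (arc_diam_gt0 _)) //.
by case/andP: (plateau_up_itv x01).
Qed.

Lemma flatten_below u : unit_square R u -> 0 < u.1 <= 1 -> u.2 <= lo u.1 ->
  (flatten u).2 = 0 /\ stretch u.2 = 0 \/
  exists k, [/\ (0 < k)%N, piece k u.1, piece k (flatten u).1 &
                (flatten u).2 <= lo (flatten u).1].
Proof.
move=> sq x01 h; have [yp' ly] := (yp, lo_le x01).
have bE := base_below x01 h.
case: (plateau_lo_lt1 x01 h) => [p1|l]; [right|left].
  have [k0 _] := idx_itv x01; have pk := piece_idx x01.
  exists (idx u.1); rewrite /flatten bE p1 !mulr1.
  have T0 : level u.2 <= 0 by apply: level_le0; lra.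
  have [v1 v2] := pull_foot_lo (num_lo_gt0 x01) T0; split => //; rewrite v1.
  by rewrite double_half_lo; case: odd; [exact: piece_VS|exact: piece_V].
rewrite /flatten levelN1 // stretch0 // pull_below //; last by lra.
  by apply: arcs_cover; exact: base_arcs.
rewrite bE /= oppr_le0 mulr_ge0 ?exprn_ge0 ?(ltW (arc_diam_gt0 _)) //.
  by rewrite num_lo_gt0.
by case/andP: (plateau_lo_itv x01).
Qed.

Lemma flatten_sq u : unit_square R u -> unit_square R (flatten u).
Proof. by move=> /base_arcs/arcs_cover h; exact: pull_sq. Qed.

Lemma flatten_x0 u : u.1 = 0 -> (flatten u).1 = 0.
Proof. by move=> u0; rewrite /flatten /base u0 ltxx /= spread0 normr0. Qed.

Lemma stretch_sq u : unit_square R u -> unit_square R (u.1, stretch u.2).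
Proof. by move=> /unit_squareP[h _]; apply/unit_squareP; split => //; exact: clamp01. Qed.

Lemma cts_flatten : {within unit_square R, continuous flatten}.
Proof.
apply: cts_pull; [exact: cts_base|by apply: cts_level; cts|].
by move=> u /base_arcs/arcs_cover.
Qed.

Lemma cts_stretch : {within unit_square R, continuous (fun u : R * R => (u.1, stretch u.2))}.
Proof. by rewrite /stretch; cts. Qed.

Let pair_sq := pair_homotopic (unit_square R) sheet (unit_square R) sheet.

Lemma id_stretch_homotopic : pair_sq id (fun u => (u.1, stretch u.2)).
Proof.
apply: pair_homotopic_segment; [by cts|exact: cts_stretch|].
move=> u t sq t01 v; have sqv : unit_square R v by apply: sq_seg => //; exact: stretch_sq.
split => // /(sheet_eq0P ok sq) h; apply/(sheet_eq0P ok sqv).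
have v1 : v.1 = u.1 by rewrite /v /=; ring.
have /unit_squareP[_ /andP[Y0 Y1]] := sq.
have [yp' y2'] := (yp, y2); have [t0 t1] := andP t01.
rewrite v1; case: h => [->|[x01 h]]; [by left|right; split => //].
case: h => h; [left|right]; rewrite /v /=.
  have : stretch u.2 <= u.2 by apply: stretch_le; have := lo_le x01; lra.
  nra.
have : u.2 <= stretch u.2 by apply: stretch_ge; have := hi_ge x01; lra.
nra.
Qed.

Lemma stretch_flatten_homotopic : pair_sq (fun u => (u.1, stretch u.2)) flatten.
Proof.
apply: pair_homotopic_segment; [exact: cts_stretch|exact: cts_flatten|].
move=> u t sq t01 v.
have v1E : v.1 = (1 - t) * u.1 + t * (flatten u).1 by [].
have v2E : v.2 = (1 - t) * stretch u.2 + t * (flatten u).2 by [].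
have sqv : unit_square R v.
  by apply: sq_seg => //; [exact: stretch_sq|exact: flatten_sq].
split => // /(sheet_eq0P ok sq) h.
have /unit_squareP[_ /andP[Y0 Y1]] := sq.
have [yp' y2'] := (yp, y2); have [t0 t1] := andP t01.
case: h => [x0|[x01 [h|h]]].
- apply/(sheet_eq0P ok sqv); left.
  by rewrite v1E flatten_x0 // x0 !mulr0 addr0.
- case: (flatten_below sq x01 h) => [[f0 s0]|[k [k0 pu pf fl]]].
    by apply: sheet_bottom => //; rewrite v2E f0 s0 !mulr0 addr0.
  have pv : piece k v.1 by exact: piece_seg.
  apply/(sheet_eq0P ok sqv); right; split; first exact: piece_le1 pv.
  left; rewrite v1E v2E (lo_seg y e k0 t01 pu pf).
  have : stretch u.2 <= u.2 by apply: stretch_le; have := lo_le x01; lra.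
  by move=> hs; nra.
- case: (flatten_above sq x01 h) => [[f1 s1]|[k [k0 pu pf fl]]].
    by apply: sheet_top => //; rewrite v2E f1 s1; ring.
  have pv : piece k v.1 by exact: piece_seg.
  apply/(sheet_eq0P ok sqv); right; split; first exact: piece_le1 pv.
  right; move: fl; rewrite v1E v2E /hi (lo_seg y e k0 t01 pu pf) width_seg => fl.
  have : u.2 <= stretch u.2 by apply: stretch_ge; have := hi_ge x01; lra.
  by rewrite /hi in h; move=> hs; nra.
Qed.

Lemma flatten_sheet u : unit_square R u -> sheet u = 0 -> sheet (flatten u) = 0.
Proof.
move=> sq /(sheet_eq0P ok sq) h; have sqf := flatten_sq sq.
case: h => [x0|[x01 [h|h]]].
- by apply/(sheet_eq0P ok sqf); left; exact: flatten_x0.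
- case: (flatten_below sq x01 h) => [[f0 _]|[k [k0 pu pf fl]]]; first exact: sheet_bottom.
  by apply/(sheet_eq0P ok sqf); right; split; [exact: piece_le1 pf|left].
- case: (flatten_above sq x01 h) => [[f1 _]|[k [k0 pu pf fl]]]; first exact: sheet_top.
  by apply/(sheet_eq0P ok sqf); right; split; [exact: piece_le1 pf|right].
Qed.

Lemma cts_from_to : {within unit_square R, continuous (from_cones \o to_cones)}.
Proof.
apply: (@cts_comp _ _ _ _ (@arc_cones R)); [exact: cts_to_cones|exact: cts_from_cones|].
by move=> u /to_cones_pair[].
Qed.

(** At each point the two maps agree or land on the same edge, top or bottom. *)
Lemma flatten_from_to_homotopic : pair_sq flatten (from_cones \o to_cones).
Proof.
apply: pair_homotopic_segment; [exact: cts_flatten|exact: cts_from_to|].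
move=> u t sq t01; rewrite [(from_cones \o to_cones) u]/(from_cones (to_cones u)).
have [gc _] := to_cones_pair sq; have cov := arcs_cover (base_arcs sq).
have sqf := from_cones_sq gc; have sqr := flatten_sq sq.
move=> v; have v1E : v.1 = (1 - t) * (flatten u).1 + t * (from_cones (to_cones u)).1 by [].
have v2E : v.2 = (1 - t) * (flatten u).2 + t * (from_cones (to_cones u)).2 by [].
have sqv : unit_square R v by exact: sq_seg.
split => // s0.
have [hT|hT] := leP 2^-1 (level u.2).
  have b0 : 0 <= (base u).2 by apply: base_level_gt0 => //; lra.
  by apply: sheet_top => //; rewrite v2E (from_cones_high gc hT) (pull_above cov b0 hT); ring.
have [hT'|hT'] := leP (level u.2) (- 2^-1).
  have b0 : (base u).2 <= 0 by apply: base_level_lt0 => //; lra.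
  by apply: sheet_bottom => //; rewrite v2E (from_cones_deep gc hT') (pull_below cov b0 hT'); ring.
have Tl : `|(to_cones u).2| <= 2^-1 by rewrite ler_norml !ltW.
have fE : from_cones (to_cones u) = flatten u by exact: (@from_cones_low _ (base u) Tl).
have -> : v = flatten u.
  rewrite [RHS]surjective_pairing [v]surjective_pairing v1E v2E fE.
  by congr (_, _); ring.
exact: flatten_sheet.
Qed.

Lemma from_to_homotopic : pair_sq (from_cones \o to_cones) id.
Proof.
apply: track_homotopic_sym; apply: track_homotopic_trans id_stretch_homotopic _.
exact: track_homotopic_trans stretch_flatten_homotopic flatten_from_to_homotopic.
Qed.

(** * The round trip from the cones *)

Lemma level_from_ge0 (g : R * R * R) : arc_cones g -> 0 <= g.2 -> 0 <= g.1.2 ->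
  0 <= level (from_cones g).2.
Proof.
move=> gc T0 s0; have [yp' y2'] := (yp, y2).
have := spread_ge0 (from_cones_cover gc); rewrite /= divr_ge0 ?(ltW (depth_gt0 _)) // => /(_ isT).
rewrite /from_cones -/(depth g.2) /pull /=; set sp := spread _ => sp0.
apply: level_ge0; apply: le_trans (_ : 2^-1 <= _); first by lra.
apply: clamp_lower; first by lra.
by case: ok => _ e0 _ _; have := mulr_ge0 e0 sp0; lra.
Qed.

Lemma level_from_le0 (g : R * R * R) : arc_cones g -> g.2 <= 0 -> g.1.2 <= 0 ->
  level (from_cones g).2 <= 0.
Proof.
move=> gc T0 s0; have [yp' y2'] := (yp, y2).
have := spread_le0 (from_cones_cover gc).
rewrite /= mulr_le0_ge0 ?invr_ge0 ?(ltW (depth_gt0 _)) // => /(_ isT).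
rewrite /from_cones -/(depth g.2) /pull /=; set sp := spread _ => sp0.
apply: level_le0; apply: le_trans (_ : 2^-1 <= _); last by lra.
apply: clamp_upper; first by lra.
by case: ok => _ e0 _ _; have := mulr_ge0_le0 e0 sp0; lra.
Qed.

Lemma level_from_high (g : R * R * R) : arc_cones g -> 2^-1 <= `|g.2| ->
  `|level (from_cones g).2| = 1.
Proof.
move=> gc; have [yp' y2'] := (yp, y2); have [h|h] := leP 0 g.2.
  by rewrite (ger0_norm h) => /(from_cones_high gc) ->; rewrite level1 ?normr1 //; lra.
rewrite (ltr0_norm h) => hT; rewrite (from_cones_deep gc); last by lra.
by rewrite levelN1 ?normrN ?normr1 //; lra.
Qed.

(* Same position in the arcs, at the height of the image in the square. *)
Definition relevel (g : R * R * R) : R * R * R :=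
  let T := level (from_cones g).2 in let s := (1 - `|T|) / depth g.2 in
  (s * g.1.1, s * g.1.2, T).

Lemma cts_level_from :
  {within @arc_cones R, continuous (fun g : R * R * R => level (from_cones g).2)}.
Proof. by apply: cts_level; apply: cts_snd; exact: cts_from_cones. Qed.

Lemma cts_depthV :
  {within @arc_cones R, continuous (fun g : R * R * R => (depth g.2)^-1)}.
Proof.
apply: cts_V; first by move=> g _; rewrite gt_eqF // depth_gt0.
by rewrite /depth; cts.
Qed.

Lemma cts_relevel : {within @arc_cones R, continuous relevel}.
Proof.
have c1 := cts_level_from; have c2 := cts_depthV.
have c3 : {within @arc_cones R,
    continuous (fun g : R * R * R => 1 - `|level (from_cones g).2|)}.
  by apply: cts_B; [cts|apply: cts_norm].
by rewrite /relevel; apply: cts_pair => //; apply: cts_pair; apply: cts_M; (apply: cts_M || cts).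
Qed.

Let pair_cones := pair_homotopic (@arc_cones R) (@arc_height R) (@arc_cones R) (@arc_height R).

(** The new level never has the sign opposite to the old one, and from level 0 it can only move to
    the side of the arc. Hence moving linearly between the levels does not leave the two cones. *)
Lemma level_from_sign (g : R * R * R) a : arc_cones g ->
  g = ((1 - `|g.2|) * a.1, (1 - `|g.2|) * a.2, g.2) -> -1 <= g.2 <= 1 ->
  (0 < g.2 -> 0 <= a.2) -> (g.2 < 0 -> a.2 <= 0) ->
  let T := level (from_cones g).2 in
  [/\ 0 <= T * g.2, 0 < T -> 0 <= a.2 & T < 0 -> a.2 <= 0].
Proof.
move=> gc gE T1 ap an T.
have T0 : 0 <= 1 - `|g.2| by rewrite subr_ge0 ler_norml.
have sE : g.1.2 = (1 - `|g.2|) * a.2 by rewrite gE.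
have [h|h|h] := ltgtP g.2 0.
- have a2 := an h; have s0 : g.1.2 <= 0 by rewrite sE mulr_ge0_le0.
  have Tn := level_from_le0 gc (ltW h) s0; rewrite -/T in Tn.
  by split; [rewrite -mulrNN mulr_ge0 // oppr_ge0 // ltW|move=> hh; lra|].
- have a2 := ap h; have s0 : 0 <= g.1.2 by rewrite sE mulr_ge0.
  have Tn := level_from_ge0 gc (ltW h) s0; rewrite -/T in Tn.
  by split; [rewrite mulr_ge0 // ltW| |move=> hh; lra].
- have sE' : g.1.2 = a.2 by rewrite sE h normr0 subr0 mul1r.
  split; first by rewrite h mulr0.
    move=> hh; rewrite leNgt; apply/negP => /ltW; rewrite -sE' => /(level_from_le0 gc).
    by rewrite h lexx -/T => /(_ isT); lra.
  move=> hh; rewrite leNgt; apply/negP => /ltW; rewrite -sE' => /(level_from_ge0 gc).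
  by rewrite h lexx -/T => /(_ isT); lra.
Qed.

Lemma id_relevel_homotopic : pair_cones id relevel.
Proof.
apply: pair_homotopic_segment3; [by cts|exact: cts_relevel|].
move=> g t gc t01 v; have [T1 [a Aa [gE ap an]]] := arc_conesP gc.
have [t0 t1] := andP t01.
have [TT Tp Tn] := level_from_sign gc gE T1 ap an.
have hi1 := @level_from_high g gc.
set T := level (from_cones g).2 in TT Tp Tn hi1.
have T0 : 0 <= 1 - `|g.2| by rewrite subr_ge0 ler_norml.
have T'1 : -1 <= T <= 1 by exact: level_itv.
pose S := (1 - t) * g.2 + t * T.
(* The levels do not have opposite signs, so the absolute value is affine between them; the segment
   therefore keeps the arc point [a] and changes only the level. *)
have nS : 1 - `|S| = (1 - t) * (1 - `|g.2|) + t * (1 - `|T|).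
  have -> : `|S| = (1 - t) * `|g.2| + t * `|T|; last by ring.
  have [h|h] := leP 0 g.2; have [h'|h'] := leP 0 T.
  - have S0 : 0 <= S by rewrite /S addr_ge0 // mulr_ge0 // subr_ge0.
    by rewrite (ger0_norm S0) (ger0_norm h) (ger0_norm h').
  - have g0 : g.2 = 0.
      apply/eqP; rewrite eq_le h andbT leNgt; apply/negP => g0.
      by move: TT; rewrite leNgt nmulr_rlt0 // g0.
    by rewrite /S g0 normr0 !mulr0 !add0r normrM (ger0_norm t0) (ltr0_norm h').
  - have g0 : T = 0.
      apply/eqP; rewrite eq_le h' andbT leNgt; apply/negP => g0.
      by move: TT; rewrite leNgt pmulr_rlt0 // h.
    by rewrite /S g0 normr0 !mulr0 !addr0 normrM (ltr0_norm h) ger0_norm ?subr_ge0.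
  - rewrite (ltr0_norm h) (ltr0_norm h') ler0_norm; first by rewrite /S; ring.
    by rewrite -oppr_ge0 opprD -!mulrN addr_ge0 // mulr_ge0 ?subr_ge0 ?oppr_ge0 // ltW.
have wE : (1 - `|T|) / depth g.2 * (1 - `|g.2|) = 1 - `|T|.
  have [h|h] := leP (2^-1) `|g.2|; first by rewrite (hi1 h) subrr !mul0r.
  by rewrite depthE ?(ltW h) // divfK // gt_eqF // -depthE ?(ltW h) // depth_gt0.
have S1 : -1 <= S <= 1 by rewrite /S; apply/andP; split; nra.
have r1 : g.1.1 = (1 - `|g.2|) * a.1 by rewrite {1}gE.
have r2 : g.1.2 = (1 - `|g.2|) * a.2 by rewrite {1}gE.
have mix c : (1 - t) * ((1 - `|g.2|) * c) +
    t * ((1 - `|T|) / depth g.2 * ((1 - `|g.2|) * c)) = (1 - `|S|) * c.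
  by rewrite nS [X in t * X]mulrA wE; ring.
have vE : v = ((1 - `|S|) * a.1, (1 - `|S|) * a.2, S).
  by rewrite /v /relevel /= -/T -!mix -r1 -r2.
rewrite vE; split.
  apply: arc_cones_cone => //; rewrite /S => hS.
    have [/ap//|h] := ltP 0 g.2.
    by apply: Tp; rewrite ltNge; apply/negP => h'; nra.
  have [/an//|h] := ltP g.2 0.
  by apply: Tn; rewrite ltNge; apply/negP => h'; nra.
rewrite {1}gE !arc_height_cone // => /eqP; rewrite mulf_eq0 expf_eq0 /= => /orP[/eqP h|/eqP ->]; last by rewrite mulr0.
have h1 : `|g.2| = 1 by lra.
have : `|T| = 1 by apply: hi1; rewrite h1 invf_le1 // ler1n.
by rewrite nS h => ->; rewrite subrr !mulr0 addr0 expr0n mul0r.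
Qed.

(** At fixed level the arc coordinate moves from its old place to that of the round trip. Since the
    two may lie on different arcs of the fan, a straight segment would leave it. *)
Definition slide (q : R * R * R * R) : R * R * R :=
  let g := q.1 in let T := level (from_cones g).2 in
  let b := geodesic q.2 (g.1.1 / depth g.2, g.1.2 / depth g.2) (base (from_cones g)) in
  ((1 - `|T|) * b.1, (1 - `|T|) * b.2, T).

Lemma arcs_low (g : R * R * R) a : `|g.2| <= 2^-1 ->
  g = ((1 - `|g.2|) * a.1, (1 - `|g.2|) * a.2, g.2) ->
  (g.1.1 / depth g.2, g.1.2 / depth g.2) = a.
Proof.
move=> h gE; rewrite gE /= depthE //.
have k0 : 1 - `|g.2| != 0 by rewrite gt_eqF // -depthE // depth_gt0.
by rewrite ![(1 - _) * _]mulrC !mulfK // -surjective_pairing.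
Qed.

(** For |g.2| at most 1/2 the rescaled point is a true arc point and [cts_geodesic] applies; for
    |g.2| at least 1/2 the new level is 1 or -1 and the factor in front of the geodesic vanishes. *)
Lemma cts_slide : {within @arc_cones R `*` `[0, 1], continuous slide}.
Proof.
pose A := @arc_cones R `*` (`[0, 1]%classic : set R).
have cg (W : topologicalType) (f : R * R * R -> W) : {within @arc_cones R, continuous f} ->
    {within A, continuous (fun q : R * R * R * R => f q.1)}.
  by move=> cf; apply: (@cts_comp _ _ _ _ (@arc_cones R) fst f) => //; [cts|move=> q []].
have cT := cg _ _ cts_level_from.
have cn : continuous (fun q : R * R * R * R => `|q.1.2|).
  by apply/continuous_subspace_setT; cts.
apply: (@cts_paste _ _ A ((fun q : R * R * R * R => `|q.1.2|) @^-1` [set r : R | r <= 2^-1])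
    ((fun q : R * R * R * R => `|q.1.2|) @^-1` [set r : R | 2^-1 <= r])).
- by apply: preimage_closed; [move=> q _; exact: cn|exact: closed_le].
- by apply: preimage_closed; [move=> q _; exact: cn|exact: closed_ge].
- by move=> q _ /=; case: (leP `|q.1.2| 2^-1) => h; [left|right; exact: ltW].
- set B := A `&` _.
  have BA : B `<=` A by move=> q [].
  have cT' := cts_sub BA cT.
  have c1 : {within B, continuous (fun q : R * R * R * R => 1 - `|level (from_cones q.1).2|)}.
    by apply: cts_B; [cts|apply: cts_norm].
  have cd := cts_sub BA (cg _ _ cts_depthV).
  have c2 : {within B, continuous (fun q : R * R * R * R =>
      geodesic q.2 (q.1.1.1 / depth q.1.2, q.1.1.2 / depth q.1.2) (base (from_cones q.1)))}.
    apply: (@cts_comp _ _ _ _ _ (fun q : R * R * R * R =>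
      (q.2, ((q.1.1.1 / depth q.1.2, q.1.1.2 / depth q.1.2), base (from_cones q.1)))) _ _ (@cts_geodesic R)).
      apply: cts_pair; first by cts.
      apply: cts_pair; first by apply: cts_pair; apply: cts_M => //; cts.
      apply: (cts_sub BA); apply: (cg _ (base \o from_cones)).
      apply: (@cts_comp _ _ _ _ (unit_square R)); [exact: cts_from_cones|exact: cts_base|].
      by move=> g /from_cones_sq.
    move=> [g t] [[/= gc]]; rewrite in_itv /= => t01 h.
    have [T1 [a Aa [gE _ _]]] := arc_conesP gc.
    split => //=; first by rewrite (arcs_low h gE).
    exact/base_arcs/from_cones_sq.
  rewrite /slide; apply: cts_pair => //; apply: cts_pair; apply: cts_M => //.
    exact: (cts_fst c2).
  exact: (cts_snd c2).
- apply: (@cts_eq _ _ _ (fun q : R * R * R * R => (0, 0, level (from_cones q.1).2))).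
    move=> q [[gc _] /= h]; rewrite /slide (level_from_high gc h) subrr !mul0r //.
  apply: cts_pair; first by cts.
  by apply: cts_sub cT => q [].
Qed.

(** The round trip fixes the feet: 1/(2n-1) has index 2n - 1, hence number n, and [zigzag] is 0
    there, so the plateau is 1. With both ends equal the geodesic is constant, which keeps the zero
    set of [arc_height] during [slide]. *)
Lemma base_foot_up n (v : R * R) : (0 < n)%N -> v.1 = (n.*2.-1)%:R^-1 -> hi v.1 <= v.2 ->
  base v = (arc_diam n, arc_diam n ^+ 2).
Proof.
move=> n0 v1 hv; have k0 : (0 < n.*2.-1)%N by case: (n) n0.
have v01 : 0 < v.1 <= 1 by rewrite v1; exact: invn_itv.
have idE : idx v.1 = n.*2.-1 by rewrite v1 /idx invrK natrK.
have ko : odd n.*2.-1 by case: (n) n0 => // m _; rewrite doubleS /= odd_double.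
have nE : num_up v.1 = n.
  rewrite /num_up idE; case: (n) n0 => // m _.
  by rewrite doubleS /= uphalf_double.
have pE : plateau_up v.1 = 1.
  rewrite /plateau_up v1 /zigzag pl_V // ko /= subr0 min_l // ler_pdivlMr // mul1r.
  by have [yp' y2'] := (yp, y2); lra.
by rewrite (base_above v01 hv) nE pE !mulr1.
Qed.

Lemma base_foot_lo n (v : R * R) : (0 < n)%N -> v.1 = n.*2%:R^-1 -> v.2 <= lo v.1 ->
  base v = (arc_diam n, - (arc_diam n ^+ 2)).
Proof.
move=> n0 v1 hv; have k0 : (0 < n.*2)%N by rewrite double_gt0.
have v01 : 0 < v.1 <= 1 by rewrite v1; exact: invn_itv.
have idE : idx v.1 = n.*2 by rewrite v1 /idx invrK natrK.
have nE : num_lo v.1 = n by rewrite /num_lo idE uphalf_double.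
have pE : plateau_lo v.1 = 1.
  rewrite /plateau_lo v1 /zigzag pl_V // odd_double /= min_l // ler_pdivlMr // mul1r.
  by have [yp' y2'] := (yp, y2); lra.
by rewrite (base_below v01 hv) nE pE !mulr1.
Qed.

Lemma relevel_to_from_homotopic : pair_cones relevel (to_cones \o from_cones).
Proof.
exists slide; split.
- exact: cts_slide.
- move=> g t gc t01; have [T1 [a Aa [gE ap an]]] := arc_conesP gc.
  have sq := from_cones_sq gc; have Ab := base_arcs sq.
  have [TT Tp Tn] := level_from_sign gc gE T1 ap an.
  rewrite /slide /=; set T := level (from_cones g).2 in TT Tp Tn *.
  have T'1 : -1 <= T <= 1 by exact: level_itv.
  have [h|h] := leP (2^-1) `|g.2|.
    have T'E : `|T| = 1 := level_from_high gc h.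
    rewrite T'E subrr !mul0r; have a0 : arcs (0 : R * R) by left.
    have zE : (0, 0, T) = ((1 - `|T|) * (0 : R * R).1, (1 - `|T|) * (0 : R * R).2, T).
      by rewrite /= !mulr0.
    rewrite zE; split; first exact: arc_cones_cone.
    by move=> _; rewrite arc_height_cone // T'E subrr expr0n mul0r.
  have hl := ltW h; rewrite (arcs_low hl gE).
  have Ageo := geodesic_arcs t01 Aa Ab; split.
    apply: arc_cones_cone => // hT.
      by apply: geodesic_ge0 => //; [exact: Tp|exact: base_level_gt0].
    by apply: geodesic_le0 => //; [exact: Tn|exact: base_level_lt0].
  rewrite {1}gE arc_height_cone // => /eqP; rewrite mulf_eq0 expf_eq0 /= => /orP[/eqP h0|/eqP az].
    by move: h; have := normr_ge0 g.2; lra.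
  rewrite arc_height_cone //.
  case: (arcs_height_eq0 Aa az) => [a0|[n n0 [aE|aE]]].
  + have -> : base (from_cones g) = 0.
      by rewrite (from_cones_low hl gE) a0 /pull spread0 normr0 base0.
    by rewrite a0 geodesic_id /= normr0 expr0n subrr mulr0.
  + have d2 : 0 < arc_diam n ^+ 2 :> R by rewrite exprn_gt0 ?arc_diam_gt0.
    have g0 : 0 <= g.2 by rewrite leNgt; apply/negP => /an; rewrite aE /= leNgt d2.
    have [h1 h2] := pull_foot_up n0 g0.
    rewrite (from_cones_low hl gE) aE (base_foot_up n0 h1 h2) geodesic_id /=.
    by rewrite (ger0_norm (ltW d2)) subrr mulr0.
  + have d2 : 0 < arc_diam n ^+ 2 :> R by rewrite exprn_gt0 ?arc_diam_gt0.
    have g0 : g.2 <= 0 by rewrite leNgt; apply/negP => /ap; rewrite aE /= oppr_ge0 leNgt d2.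
    have [h1 h2] := pull_foot_lo n0 g0.
    rewrite (from_cones_low hl gE) aE (base_foot_lo n0 h1 h2) geodesic_id /=.
    by rewrite normrN (ger0_norm (ltW d2)) subrr mulr0.
- move=> g gc; have [T1 [a Aa [gE _ _]]] := arc_conesP gc.
  have Ab := base_arcs (from_cones_sq gc).
  rewrite /slide /relevel /=; have [h|h] := leP (2^-1) `|g.2|.
    by rewrite (level_from_high gc h) subrr !mul0r.
  have aE := arcs_low (ltW h) gE.
  by rewrite aE geodesic0 // -aE /= !mulrA ![(1 - _) * _ / _]mulrAC.
- move=> g gc; have [T1 [a Aa [gE _ _]]] := arc_conesP gc.
  have Ab := base_arcs (from_cones_sq gc).
  rewrite /slide /to_cones /=; have [h|h] := leP (2^-1) `|g.2|.
    by rewrite (level_from_high gc h) subrr !mul0r.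
  by rewrite (arcs_low (ltW h) gE) geodesic1.
Qed.

Lemma to_from_homotopic : pair_cones (to_cones \o from_cones) id.
Proof.
apply: track_homotopic_sym.
exact: track_homotopic_trans id_relevel_homotopic relevel_to_from_homotopic.
Qed.

Lemma snake_arc_cones : set_homotopy_equivalent R
  (dbl (unit_square R) sheet) (dbl (@arc_cones R) (@arc_height R)).
Proof.
apply: (dbl_homotopy_equivalent (f := to_cones) (g := from_cones)).
- exact: continuous_sheet.
- exact: continuous_arc_height.
- exact: cts_to_cones.
- exact: cts_from_cones.
- exact: to_cones_pair.
- exact: from_cones_pair.
- exact: from_to_homotopic.
- exact: to_from_homotopic.
Qed.
End to_cones.

Lemma snake_griffiths (R : realType) (y e : R) : admissible y e -> 0 < y -> y <= 2^-1 ->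
  homotopy_equivalent R (snake_space R y e) (griffiths R).
Proof.
move=> ok y0 y2; rewrite /snake_space (snake_setE ok).
apply: (homotopy_equivalent_image (snake_arc_cones ok y0 y2)).
- exact: griffiths_compact.
- exact: norm_hausdorff.
- exact: continuous_griffiths_map.
- exact: griffiths_map_inj.
- exact: griffiths_map_range.
Qed.

(** * The sine curve *)

Section unit_interval.
Context {R : realType}.
Implicit Types (x : R).

Lemma itv01P x : (`[0, 1]%classic : set R) x <-> 0 <= x <= 1.
Proof. by rewrite /= in_itv. Qed.

Lemma cts_squeeze01 (f g : R -> R) (C : R) : {within `[0, 1], continuous g} ->
  (forall x, 0 <= x <= 1 -> `|f x - g x| <= C * x) ->
  {within `[0, 1] `&` [set u | 0 < u], continuous f} -> {within `[0, 1], continuous f}.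
Proof.
move=> cg fg cf; apply: (@cts_squeeze _ _ _ id f g C) => //.
- by move=> c; exact: cvg_id.
- by move=> u /itv01P/andP[].
Qed.

Lemma cts_pl01 (a : nat -> R) : {within `[0, 1] `&` [set u | 0 < u], continuous (pl a)}.
Proof.
apply: (@cts_pl _ _ _ (fun u => u)); first by move=> c; exact: cvg_id.
by move=> u [/itv01P/andP[_ ->] /= ->].
Qed.

End unit_interval.

Section sine_curve.
Context {R : realType}.
Implicit Types (x X Y t : R) (k n : nat) (u : R * R).

(* (abscissa, zigzag) runs along P_1 Q_1 P_2 Q_2 ..., with vertices at x = 1/k. *)
Definition abscissas k : R := 2 / 2 ^+ (uphalf k).

(** At 0 the interpolation would return the junk value [abscissas 1], so the limit 0 is set by
    hand. *)
Definition abscissa x : R := if x == 0 then 0 else pl abscissas x.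

Lemma abscissaE x : 0 < x <= 1 -> abscissa x = pl abscissas x.
Proof. by case/andP=> x0 _; rewrite /abscissa gt_eqF. Qed.

Lemma abscissas_gt0 k : 0 < abscissas k.
Proof. by rewrite divr_gt0 ?exprn_gt0. Qed.

Lemma abscissas_le k : (0 < k)%N -> abscissas k <= 2 / k%:R.
Proof.
move=> k0; rewrite ler_pM2l // lef_pV2 ?posrE ?exprn_gt0 ?ltr0n //.
have kn : (k <= (uphalf k).*2)%N by rewrite -leq_uphalf_double.
rewrite -natrX ler_nat; apply: leq_trans kn _; have : (0 < uphalf k)%N by case: (k) k0.
by case: (uphalf k) => // n _; rewrite -mul2n expnS leq_mul2l ltn_expl.
Qed.

Lemma abscissa_gt0 x : 0 < x <= 1 -> 0 < abscissa x.
Proof.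
move=> x01; rewrite abscissaE //; have [k0 _] := idx_itv x01.
have /andP[f0 f1] := wt_itv (piece_idx x01).
rewrite /pl; set s := wt _ _ in f0 f1 *.
have := abscissas_gt0 (idx x); have := abscissas_gt0 (idx x).+1.
move: (abscissas _) (abscissas _) => a b a0 b0.
by have := mulr_ge0 f0 (ltW a0); nra.
Qed.

Lemma abscissa_le x : 0 <= x <= 1 -> abscissa x <= 2 * x.
Proof.
case/andP; rewrite le_eqVlt => /orP[/eqP <-|x0] x1.
  by rewrite /abscissa eqxx mulr0.
have x01 : 0 < x <= 1 by rewrite x0.
rewrite abscissaE // -[2 * x]add0r -(pl_affine 0 2 x01); apply: pl_le => // k k0.
by rewrite add0r abscissas_le.
Qed.

Lemma abscissa_itv x : 0 <= x <= 1 -> 0 <= abscissa x <= 1.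
Proof.
case/andP; rewrite le_eqVlt => /orP[/eqP <-|x0] x1.
  by rewrite /abscissa eqxx lexx ler01.
have x01 : 0 < x <= 1 by rewrite x0.
rewrite ltW ?abscissa_gt0 //= abscissaE // -(pl_cst 1 x01); apply: pl_le => // k k0.
rewrite ler_pdivrMr ?exprn_gt0 // mul1r -natrX ler_nat.
by rewrite -{1}(expn1 2) leq_exp2l //; case: (k) k0.
Qed.

Lemma cts_abscissa : {within `[0, 1], continuous abscissa}.
Proof.
apply: (@cts_squeeze01 _ _ (fun=> 0) 2); first exact: cts_cst.
  by move=> x x01; rewrite subr0 ger0_norm ?abscissa_le //; case/andP: (abscissa_itv x01).
apply: (@cts_eq _ _ _ (pl abscissas)); last exact: cts_pl01.
by move=> x [_ /= x0]; rewrite /abscissa gt_eqF.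
Qed.

(* Increases strictly along the curve: on horizontal stretches of the
   zigzag the abscissa is constant, on the others both factors vary. *)
Definition travel x : R := abscissa x * (1 - zigzag x / 4).

(** The default index at 0 is 0, with weight 1, so the value is that of vertex 1. *)
Lemma zigzag0 : zigzag 0 = 0 :> R.
Proof. by rewrite /zigzag /pl /idx invr0 truncn0 /wt mulr0 subr0 !mul1r subrr mul0r add0r. Qed.

Lemma zigzag01 x : 0 <= x <= 1 -> 0 <= zigzag x <= 1.
Proof.
case/andP; rewrite le_eqVlt => /orP[/eqP <-|x0] x1; first by rewrite zigzag0 lexx ler01.
by apply: zigzag_itv; rewrite x0.
Qed.

Lemma travel_piece k x : (0 < k)%N -> piece k x -> travel x =
  let s := wt k x in if odd k then abscissas k * (1 - s / 4)
  else abscissas k * (1 - s / 2) * (1 - (1 - s) / 4).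
Proof.
move=> k0 pk; have x01 := piece_le1 k0 pk.
rewrite /travel abscissaE // /zigzag !(plE _ k0 pk) /=; set s := wt k x.
have aS : abscissas k.+1 = if odd k then abscissas k else abscissas k / 2.
  rewrite /abscissas /= uphalf_half; case: (odd k); rewrite ?add1n ?add0n //.
  by rewrite exprS invfM mulrCA mulrC.
by rewrite aS; case: (odd k) => /=; field.
Qed.

(** From P to Q the abscissa is constant and the second factor falls. From Q to the next P the
    abscissa halves while the second factor climbs from 3/4 to 1; the weight 1/4 is small enough for
    the product to keep falling. *)
Lemma travel_lt_piece k x x' : (0 < k)%N -> piece k x -> piece k x' -> x < x' ->
  travel x < travel x'.
Proof.
move=> k0 pk pk' xx; rewrite (travel_piece k0 pk) (travel_piece k0 pk') /=.
have /andP[s0 s1] := wt_itv pk; have /andP[s0' s1'] := wt_itv pk'.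
have ss : wt k x' < wt k x.
  by rewrite /wt ltr_pM2l ?ltr0n // ltrD2l ltrN2 ltr_pM2l // ltr0n.
have a0 := abscissas_gt0 k; move: (abscissas k) a0 => a a0.
move: (wt k x) (wt k x') s0 s1 s0' s1' ss => s s' s0 s1 s0' s1' ss.
case: (odd k); rewrite -?mulrA ltr_pM2l //; first by lra.
by nra.
Qed.

Lemma travel_V_le m n : (0 < m)%N -> (m <= n)%N -> travel n%:R^-1 <= travel m%:R^-1.
Proof.
move=> m0 /subnK <-; elim: (n - m)%N => // d IH; apply: le_trans IH.
have d0 : (0 < d + m)%N by rewrite addn_gt0 m0 orbT.
apply: ltW; apply: (travel_lt_piece d0); [exact: piece_VS|exact: piece_V|].
by rewrite addSn ltf_pV2 ?posrE ?ltr0n // ltr_nat.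
Qed.

Lemma travel_le_piece k x x' : (0 < k)%N -> piece k x -> piece k x' -> x <= x' ->
  travel x <= travel x'.
Proof.
move=> k0 pk pk'; rewrite le_eqVlt => /orP[/eqP -> //|]; move=> h; apply: ltW.
exact: travel_lt_piece pk pk' h.
Qed.

Lemma travel_lt x x' : 0 <= x -> x < x' -> x' <= 1 -> travel x < travel x'.
Proof.
rewrite le_eqVlt => /orP[/eqP <- x0 x1|x0 xx x1].
  have x01 : 0 < x' <= 1 by rewrite x0.
  rewrite /travel {1}/abscissa eqxx mul0r mulr_gt0 ?abscissa_gt0 //.
  by have := zigzag_itv x01; lra.
have x01 : 0 < x <= 1 by rewrite x0 (le_trans (ltW xx)).
have x01' : 0 < x' <= 1 by rewrite (lt_trans x0 xx).
have [k0 /andP[k1 k2]] := idx_itv x01; have [k0' /andP[k1' k2']] := idx_itv x01'.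
have pk := piece_idx x01; have pk' := piece_idx x01'.
move: (idx x) (idx x') k0 k1 k2 k0' k1' k2' pk pk' => k k' k0 k1 k2 k0' k1' k2' pk pk'.
have [kk|kk|kk] := ltngtP k k'; last by rewrite -kk in pk'; exact: travel_lt_piece pk pk' xx.
  suff : k.+1%:R * x <= 1 by move: k2; lra.
  apply: le_trans k1'; apply: le_trans (_ : k'%:R * x <= _); last by rewrite ler_wpM2l // ltW.
  by rewrite ler_wpM2r ?ler_nat // ltW.
apply: le_lt_trans (_ : travel k%:R^-1 < _).
  apply: (travel_le_piece k0 pk (piece_V k0)).
  by rewrite -[_^-1]mul1r ler_pdivlMr ?ltr0n // mulrC.
apply: le_lt_trans (_ : travel k'.+1%:R^-1 < _); first exact: travel_V_le.
apply: (travel_lt_piece k0' (piece_VS k0') pk').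
by rewrite -[_^-1]mul1r ltr_pdivrMr ?ltr0n // mulrC.
Qed.

Lemma travel0 : travel 0 = 0.
Proof. by rewrite /travel /abscissa eqxx mul0r. Qed.

Lemma travel1 : travel 1 = 1.
Proof.
have h := travel_piece (ltn0Sn 0) (piece_V (R := R) (ltn0Sn 0)).
rewrite invr1 in h; rewrite h /= /wt mulr1 subrr mulr0 mul0r subr0 mulr1.
by rewrite /abscissas /= expr1 divff.
Qed.

Lemma cts_travel : {within `[0, 1], continuous travel}.
Proof.
apply: (@cts_squeeze01 _ _ (fun=> 0) 2); first exact: cts_cst.
  move=> x x01; rewrite subr0; have := abscissa_le x01.
  have /andP[a0 a1] := abscissa_itv x01; have /andP[z0 z1] := zigzag01 x01.
  by rewrite /travel ger0_norm; nra.
have cz : {within `[0, 1] `&` [set u : R | 0 < u], continuous (@zigzag R)}.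
  exact: cts_pl01.
have ca : {within `[0, 1] `&` [set u : R | 0 < u], continuous abscissa}.
  by apply: cts_sub cts_abscissa => x [].
by rewrite /travel; cts.
Qed.

Definition arrival X : R := get [set x | 0 <= x <= 1 /\ travel x = X].

Lemma arrivalP X : 0 <= X <= 1 -> 0 <= arrival X <= 1 /\ travel (arrival X) = X.
Proof.
move=> X01; rewrite /arrival; case: (getPex (P := [set x | 0 <= x <= 1 /\ travel x = X])) => //.
have [|c c01 cX] := @IVT R travel 0 1 X ler01 cts_travel.
  by rewrite travel0 travel1 min_l // max_r.
by exists c; split => //; move: c01; rewrite in_itv.
Qed.

Lemma travel01 x : 0 <= x <= 1 -> 0 <= travel x <= 1.
Proof.
move=> x01; have /andP[a0 a1] := abscissa_itv x01; have /andP[z0 z1] := zigzag01 x01.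
by rewrite /travel; apply/andP; split; nra.
Qed.

Lemma travelK x : 0 <= x <= 1 -> arrival (travel x) = x.
Proof.
move=> x01; have /andP[x0 x1] := x01; have t01 := travel01 x01.
have [/andP[a0 a1] ta] := arrivalP t01.
have [h|h|//] := ltgtP (arrival (travel x)) x.
  by have := travel_lt a0 h x1; rewrite ta ltxx.
by have := travel_lt x0 h a1; rewrite ta ltxx.
Qed.

Lemma arrival0 : arrival 0 = 0.
Proof. by rewrite -{1}travel0 travelK // lexx ler01. Qed.

Lemma arrival1 : arrival 1 = 1.
Proof. by rewrite -{1}travel1 travelK // ler01 lexx. Qed.

(** A monotone map of an interval onto an interval has no jumps. *)
Lemma cts_arrival : {within `[0, 1], continuous arrival}.
Proof.
apply: segment_inc_surj_continuous.
  move=> X X'; rewrite !in_itv /= => X01 X01'.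
  have [/andP[a0 a1] ta] := arrivalP X01; have [/andP[a0' a1'] ta'] := arrivalP X01'.
  rewrite -{2}ta -{2}ta'; apply/idP/idP.
    by rewrite le_eqVlt => /orP[/eqP -> //|h]; apply/ltW/travel_lt.
  by apply: contraLR; rewrite -!ltNge => h; exact: travel_lt.
rewrite arrival0 arrival1 => x /= ; rewrite in_itv /= => x01.
by exists (travel x); rewrite ?travelK // in_itv travel01.
Qed.

End sine_curve.

(** * The parameter of the curve, extended to the square *)

Section sine_curve_points.
Context {R : realType}.
Implicit Types (x X Y t : R) (k n : nat) (u : R * R).

Definition curve x : R * R := (abscissa x, zigzag x).

Definition vertex k : R * R := (abscissas k, (~~ odd k)%:R).

Lemma piece_mix k t : (0 < k)%N -> 0 <= t <= 1 ->
  piece k ((1 - t) * k%:R^-1 + t * k.+1%:R^-1 : R).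
Proof. by move=> k0 t01; apply: piece_seg => //; [exact: piece_V|exact: piece_VS]. Qed.

Lemma curve_mix k t : (0 < k)%N -> 0 <= t <= 1 ->
  curve ((1 - t) * k%:R^-1 + t * k.+1%:R^-1) = (1 - t) *: vertex k + t *: vertex k.+1.
Proof.
move=> k0 t01; have pk := piece_mix k0 t01.
rewrite /curve abscissaE; last exact: piece_le1 pk.
rewrite /zigzag !(pl_seg _ k0 t01 (piece_V k0) (piece_VS k0)) !(pl_V _ k0) !pl_V //.
Qed.

Lemma vertex_segment k u : (0 < k)%N ->
  conv_hull [set vertex k; vertex k.+1] u <-> exists2 x, piece k x & u = curve x.
Proof.
move=> k0; rewrite conv_hull2; split=> [[t]|[x pk ->]].
  rewrite /= in_itv /= => t01 <-; exists ((1 - t) * k%:R^-1 + t * k.+1%:R^-1).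
    exact: piece_mix.
  by rewrite curve_mix.
by exists (wt k x); [exact: wt_itv|rewrite -curve_mix // ?wt_itv // -(wt_x x k0)].
Qed.

Lemma sinePE n : sineP R n.+1 = vertex n.*2.+1.
Proof. by rewrite /sineP /vertex /abscissas /= doubleK odd_double. Qed.

Lemma sineQE n : sineQ R n.+1 = vertex n.*2.+2.
Proof. by rewrite /sineQ /vertex /abscissas /= uphalf_double odd_double. Qed.

Lemma sine_curveE u : sine_curve R u <->
  (u.1 = 0 /\ 0 <= u.2 <= 1) \/ exists2 x, 0 < x <= 1 & u = curve x.
Proof.
have edge : conv_hull [set (0, 0); (0, 1)] u <-> u.1 = 0 /\ 0 <= u.2 <= 1.
  rewrite conv_hull2; split=> [[t]|[u0 u01]].
    by rewrite /= in_itv /= => t01 <-; rewrite seg2E /= !mulr0 addr0 mulr1 add0r.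
  exists u.2; first by rewrite /= in_itv.
  by rewrite seg2E !mulr0 addr0 mulr1 add0r -u0 -surjective_pairing.
split=> [[/edge|[[//|n] _]]|[/edge|[x x01 ->]]]; [by left| |by left|right].
  rewrite sinePE sineQE (sinePE n.+1) doubleS => h; right.
  by case: h => /vertex_segment[//|x /piece_le1 h ->]; exists x => //; exact: h.
have [k0 _] := idx_itv x01; have pk := piece_idx x01.
move: (idx x) k0 pk => k k0 pk.
have u0 : (0 < uphalf k)%N by case: (k) k0.
exists (uphalf k) => //; case: (boolP (odd k)) => ko; [left|right].
  have kE : k = (uphalf k).-1.*2.+1.
    by case: (k) ko => // m; rewrite /= => me; rewrite even_halfK.
  case: (uphalf k) u0 kE => // n _ /= kE.
  by rewrite sinePE sineQE; apply/vertex_segment => //; exists x; rewrite // -kE.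
have kE : k = (uphalf k).*2 by rewrite even_uphalfK.
case: (uphalf k) u0 kE => // n _; rewrite doubleS => kE.
by rewrite sinePE sineQE doubleS; apply/vertex_segment => //; exists x; rewrite // -kE.
Qed.

(** [travel x] is X (1 - Y/4) at the curve point (X, Y), so this formula extends the inverse of the
    parametrisation to the plane. It turns membership in the curve into an equation and gives maps
    of the square access to the parameter. *)
Definition foot u : R := arrival (clamp (u.1 * (1 - u.2 / 4))).

Lemma foot_arg u : unit_square R u -> 0 <= u.1 * (1 - u.2 / 4) <= 1.
Proof. by move=> /unit_squareP[/andP[a b] /andP[c d]]; apply/andP; split; nra. Qed.

Lemma foot01 u : unit_square R u -> 0 <= foot u <= 1.
Proof. by move=> /foot_arg h; rewrite /foot clampE //; case: (arrivalP h). Qed.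

Lemma foot_eq0 u : unit_square R u -> (foot u == 0) = (u.1 == 0).
Proof.
move=> sq; have [f01 fE] := arrivalP (foot_arg sq); rewrite -[X in arrival X]clampE ?foot_arg // -/(foot u) in f01 fE.
have /unit_squareP[/andP[a b] /andP[c d]] := sq.
apply/eqP/eqP => h; last by rewrite /foot h mul0r clampE ?lexx ?ler01 // arrival0.
rewrite h travel0 in fE; have : 1 - u.2 / 4 != 0 by rewrite gt_eqF //; lra.
by move/eqP: fE; rewrite eq_sym mulf_eq0 => /orP[/eqP|/eqP ->] //; rewrite eqxx.
Qed.

Lemma foot_curve x : 0 <= x <= 1 -> foot (curve x) = x.
Proof. by move=> x01; rewrite /foot /= -/(travel x) clampE ?travel01 // travelK. Qed.

Lemma continuous_foot : continuous foot.
Proof.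
apply/continuous_subspace_setT.
apply: (@cts_comp _ _ _ _ _ (fun u : R * R => clamp (u.1 * (1 - u.2 / 4))) _ _ cts_arrival).
  by cts.
by move=> u _; rewrite /= in_itv /= clamp01.
Qed.

Lemma curve_square x : 0 <= x <= 1 -> unit_square R (curve x).
Proof. by move=> x01; apply/unit_squareP; split; [exact: abscissa_itv|exact: zigzag01]. Qed.

Lemma sine_curve_square u : sine_curve R u -> unit_square R u.
Proof.
move=> /sine_curveE[[u0 u01]|[x /andP[x0 x1] ->]]; last by apply: curve_square; rewrite ltW.
by apply/unit_squareP; rewrite u0 lexx ler01.
Qed.

Lemma sine_curveP u : unit_square R u ->
  sine_curve R u <-> u.1 = 0 \/ u = curve (foot u).
Proof.
move=> sq; split.
  move=> /sine_curveE[[u0 _]|[x /andP[x0 x1] ->]]; [by left|right].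
  by rewrite foot_curve // ltW.
have /unit_squareP[s1 s2] := sq.
move=> [h|h]; apply/sine_curveE; first by left.
have /andP[f0 f1] := foot01 sq; move: f0; rewrite le_eqVlt => /orP[f0|f0].
  by left; rewrite eq_sym foot_eq0 // in f0; split => //; exact/eqP.
by right; exists (foot u); rewrite // f0.
Qed.

Lemma cts01_foot (g : R -> R) : {within `[0, 1], continuous g} ->
  {within unit_square R, continuous (fun u => g (foot u))}.
Proof.
move=> cg; apply: (@cts_comp _ _ _ _ _ foot g (continuous_subspaceT continuous_foot) cg).
by move=> u /foot01; rewrite /= in_itv.
Qed.

Lemma sine_curve_compact : compact (sine_curve R).
Proof.
have csq : compact (unit_square R) by apply: compact_setX; exact: segment_compact.
have closed_sq : closed (unit_square R).
  by apply: compact_closed => //; exact: norm_hausdorff.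
(* [zigzag] oscillates at 0; the factor [foot u] makes the second term continuous there and lets the
   whole left edge satisfy the equation. *)
pose phi u : R := `|u.1 - abscissa (foot u)| + `|foot u * u.2 - foot u * zigzag (foot u)|.
have cphi : {within unit_square R, continuous phi}.
  have c1 := cts01_foot cts_abscissa; 
  have c2 := @continuous_subspaceT _ _ (unit_square R) _ continuous_foot.
  have c3 : {within unit_square R, continuous (fun u => foot u * zigzag (foot u))}.
    apply: (@cts01_foot (fun x => x * zigzag x)).
    apply: (@cts_squeeze01 _ _ (fun=> 0) 1); first exact: cts_cst.
      move=> x x01; have /andP[z0 z1] := zigzag01 x01; have /andP[x0 _] := x01.
      by rewrite subr0 ger0_norm; nra.
    have cz : {within `[0, 1] `&` [set u : R | 0 < u], continuous (@zigzag R)}.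
      exact: cts_pl01.
    by cts.
  by apply: cts_D; apply: cts_norm; apply: cts_B => //; cts.
have -> : sine_curve R = [set u | unit_square R u /\ phi u = 0].
  apply/seteqP; split => u.
    move=> uT; have sq := sine_curve_square uT; split => //.
    case/(sine_curveP sq): uT => [u0|uE].
      have /eqP f0 : foot u == 0 by rewrite foot_eq0 // u0.
      by rewrite /phi f0 u0 /abscissa eqxx subrr !mul0r subrr normr0 addr0.
    have [h1 h2] : u.1 = abscissa (foot u) /\ u.2 = zigzag (foot u) by rewrite {1 3}uE.
    by rewrite /phi -h1 -h2 !subrr normr0 addr0.
  move=> [sq /eqP]; rewrite paddr_eq0 ?normr_ge0 // !normr_eq0 !subr_eq0 => /andP[/eqP h1 /eqP h2].
  apply/(sine_curveP sq); have [u0|u0] := eqVneq u.1 0; [by left|right].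
  have f0 : foot u != 0 by rewrite foot_eq0.
  by rewrite [LHS]surjective_pairing h1 (mulfI f0 h2).
apply: subclosed_compact csq _; first exact: cts_closed_zero.
by move=> u [].
Qed.

End sine_curve_points.

Section gluing.
Context {R : realType} {T V : topologicalType}.

(** The variant of [cts_lift] for maps that do not keep the sheets: two independent formulas, which
    have to agree where the two closed sets meet. *)
Lemma cts_glue (A D : set T) (z : T -> R) (F0 F1 : T -> V) : closed D ->
  continuous z -> (forall x, A x -> z x = 0 \/ D x) ->
  {within A, continuous F0} -> {within A `&` D, continuous F1} ->
  (forall x, A x -> D x -> z x = 0 -> F0 x = F1 x) ->
  {within A, continuous (fun x => if z x == 0 then F0 x else F1 x)}.
Proof.
move=> cD cz AD c0 c1 F01.
apply: (@cts_paste _ _ A (z @^-1` [set 0]) D) => //.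
- by apply: preimage_closed; [move=> x _; exact: cz|exact: closed_eq].
- apply: (@cts_eq _ _ _ F0); last by apply: cts_sub c0 => x [].
  by move=> x [_ /= z0]; rewrite /= z0 eqxx.
- apply: cts_eq c1 => x [Ax Dx]; by case: eqP => // /F01 ->.
Qed.

End gluing.

(** * The thin snake and circles along the sine curve *)

Section snake_sine.
Context {R : realType} (e : R).
Implicit Types (x Y t z : R) (u : R * R) (v : R * R * R).
Hypotheses (e0 : 0 < e) (e1 : e <= 1).
Notation lo := (lo 0 e).
Notation sheet := (sheet 0 e).

Lemma admissible0 : admissible 0 e.
Proof. by split; rewrite ?add0r // ltW. Qed.

Let ok := admissible0.

Definition offset x : R := zigzag x - lo x.

Lemma lo0 : lo 0 = 0.
Proof. by rewrite /lo /pl /idx invr0 truncn0 /wt mulr0 subr0 !mul1r subrr mul0r add0r. Qed.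

Lemma hi_thin x : hi 0 e x = lo x + e * x.
Proof. by rewrite /hi /width add0r. Qed.

Lemma bandP x : 0 <= x <= 1 ->
  [/\ 0 <= lo x, 0 <= offset x, offset x <= e * x & lo x + e * x <= 1].
Proof.
case/andP; rewrite le_eqVlt => /orP[/eqP <-|x0] x1.
  by rewrite /offset lo0 zigzag0 subrr mulr0 addr0 lexx ler01.
have x01 : 0 < x <= 1 by rewrite x0.
have := zigzag_le_hi ok x01; have := hi_le1 ok x01; rewrite hi_thin /offset => h1 h2.
by split=> //; [exact: lo_ge0|rewrite subr_ge0; exact: lo_le_zigzag|lra].
Qed.

(* How far a point is above the lower edge of the band, inside of the band. *)
Definition rise u : R := Num.min (e * u.1) (Num.max 0 (u.2 - lo u.1)).

Lemma riseP u : unit_square R u ->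
  [\/ u.2 <= lo u.1 /\ rise u = 0,
      lo u.1 <= u.2 <= lo u.1 + e * u.1 /\ rise u = u.2 - lo u.1 |
      lo u.1 + e * u.1 <= u.2 /\ rise u = e * u.1].
Proof.
move=> /unit_squareP[/andP[x0 x1] _]; have ex : 0 <= e * u.1 by rewrite mulr_ge0 // ltW.
rewrite /rise; have [h|h] := leP u.2 (lo u.1).
  by constructor 1; rewrite max_l ?subr_le0 // min_r.
rewrite max_r ?subr_ge0 ?(ltW h) //.
have [h'|h'] := leP u.2 (lo u.1 + e * u.1).
  by constructor 2; split; rewrite ?(ltW h) // min_r // lerBlDl.
by constructor 3; split; rewrite ?(ltW h') // min_l // lerBrDl ltW.
Qed.

Lemma rise_itv u : unit_square R u -> 0 <= rise u <= e * u.1.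
Proof.
move=> sq; have /unit_squareP[/andP[x0 x1] _] := sq.
have ex : 0 <= e * u.1 by rewrite mulr_ge0 // ltW.
by case: (riseP sq) => -[h ->]; apply/andP; split => //; lra.
Qed.

(** Subtracting [rise] closes the band up, adding [offset] puts it on the zigzag, and [abscissa]
    moves the vertices from 1/k to those of the sine curve. *)
Definition to_base u : R * R := (abscissa u.1, u.2 + offset u.1 - rise u).

Lemma to_base_square u : unit_square R u -> unit_square R (to_base u).
Proof.
move=> sq; have /unit_squareP[x01 /andP[Y0 Y1]] := sq.
have [h1 h2 h3 h4] := bandP x01; have /andP[z0 z1] := zigzag01 x01.
apply/unit_squareP; split; rewrite /=; first exact: abscissa_itv.
rewrite /offset in h2 h3 *.
by case: (riseP sq) => -[h ->]; apply/andP; split; lra.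
Qed.

Lemma to_base_band u : unit_square R u -> lo u.1 <= u.2 <= lo u.1 + e * u.1 ->
  rise u = u.2 - lo u.1 /\ to_base u = curve u.1.
Proof.
move=> sq /andP[h1 h2]; have rE : rise u = u.2 - lo u.1 by case: (riseP sq) => -[h ->]; lra.
by split => //; rewrite /to_base rE /offset /curve; congr (_, _); ring.
Qed.

Lemma sine_curve_curve x : 0 <= x <= 1 -> sine_curve R (curve x).
Proof. by move=> x01; apply/sine_curveP; [exact: curve_square|right; rewrite foot_curve]. Qed.

Lemma sheet_neq0 u : unit_square R u -> sheet u != 0 <->
  0 < u.1 <= 1 /\ lo u.1 < u.2 < lo u.1 + e * u.1.
Proof.
move=> sq; have /unit_squareP[/andP[x0 x1] _] := sq; split.
  move=> h; have xp : 0 < u.1.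
    rewrite lt_def x0 andbT; apply: contraNneq h => u0.
    by apply/eqP/(sheet_eq0P ok sq); left.
  have x01 : 0 < u.1 <= 1 by rewrite xp.
  split=> //; rewrite -hi_thin -(height_gt0 ok _ x01) -(sheetE 0 e sq).
  by rewrite lt_def h sheetE // height_ge0.
move=> [x01 h]; rewrite sheetE // gt_eqF // (height_gt0 ok _ x01) hi_thin //.
Qed.

(** The width of the band at the parameter of the point; on the square it vanishes exactly on the
    left edge, where the circles are collapsed. *)
Definition len u : R := e * foot u.

(** The square with a strip erected along the curve, in the direction of the third coordinate. In
    the double for [flange_height], which vanishes at both ends of each slice of the strip, a slice
    becomes a circle attached at its end 0, while the square is not doubled. *)
Definition flanged : set (R * R * R) := [set v |
  unit_square R v.1 /\ (v.2 = 0 \/ sine_curve R v.1 /\ 0 <= v.2 <= len v.1)].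

Definition flange_height v : R := v.2 * (len v.1 - v.2).

Lemma flangedP v : flanged v -> v.2 = 0 \/
  [/\ 0 < foot v.1 <= 1, v.1 = curve (foot v.1) & 0 <= v.2 <= e * foot v.1].
Proof.
move=> [sq [->|[vT vk]]]; first by left.
have /andP[f0 f1] := foot01 sq; move: f0; rewrite le_eqVlt => /orP[/eqP f0|f0].
  by left; move: vk; rewrite /len -f0 mulr0 => /andP[a b]; apply/eqP; rewrite eq_le b.
right; split; rewrite ?f0 //; case/(sine_curveP sq): vT => // v0.
by move: f0; rewrite lt_def foot_eq0 // v0 eqxx.
Qed.

Lemma continuous_len : continuous len.
Proof.
by move=> u; apply: cvgM; [exact: cvg_cst|exact: continuous_foot].
Qed.

Lemma cts_len (U : topologicalType) (A : set U) (p : U -> R * R) :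
  {within A, continuous p} -> {within A, continuous (fun q => len (p q))}.
Proof. exact/cts_after/continuous_len. Qed.

Lemma continuous_flange_height : continuous flange_height.
Proof.
apply/continuous_subspace_setT.
have h : {within setT, continuous (fun v => len v.1)} by apply: cts_len; cts.
by rewrite /flange_height; cts.
Qed.

(** On the flange, the slice over a curve point goes isometrically onto the slice of the band;
    elsewhere the maximum with 0 keeps the image in the square. *)
Definition from_flange v : R * R :=
  (foot v.1, Num.max 0 (v.1.2 - offset (foot v.1)) + v.2).

Lemma from_flange_curve x k : 0 <= x <= 1 -> from_flange (curve x, k) = (x, lo x + k).
Proof.
move=> x01; rewrite /from_flange foot_curve //= /offset.
have [h _ _ _] := bandP x01.
by rewrite (_ : zigzag x - _ = lo x) ?max_r //; ring.
Qed.

Lemma from_flange_square v : flanged v -> unit_square R (from_flange v).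
Proof.
move=> fv; have [sq _] := fv; have f01 := foot01 sq.
have [h1 h2 h3 h4] := bandP f01.
have /unit_squareP[_ /andP[Y0 Y1]] := sq.
case: (flangedP fv) => [v0|[x01 vE /andP[k0 k1]]].
  apply/unit_squareP; split => //=; rewrite v0 addr0 le_max lexx /= ge_max ler01 /=.
  by lra.
have -> : from_flange v = (foot v.1, lo (foot v.1) + v.2).
  by rewrite -from_flange_curve // -vE -surjective_pairing.
by apply/unit_squareP; split => //=; apply/andP; split; lra.
Qed.

Lemma cts_offset : {within `[0, 1], continuous offset}.
Proof.
apply: (@cts_squeeze01 _ _ (fun=> 0) e); first exact: cts_cst.
  by move=> x /bandP[_ h1 h2 _]; rewrite subr0 ger0_norm.
by apply: cts_B; exact: cts_pl01.
Qed.

Lemma cts_rise : {within unit_square R, continuous rise}.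
Proof.
apply: (@cts_squeeze _ _ _ fst _ (fun=> 0) e).
- by move=> u; exact: cvg_fst.
- exact: cts_cst.
- by move=> u /unit_squareP[/andP[]].
- by move=> u /rise_itv/andP[r0 r1]; rewrite subr0 ger0_norm.
rewrite /rise; have cl : {within unit_square R `&` [set u | 0 < u.1], continuous (fun u => lo u.1)}.
  apply: cts_lo; first by move=> u; exact: cvg_fst.
  by move=> u [/unit_squareP[/andP[_ ->] _] /= ->].
by cts.
Qed.

Lemma cts_to_base : {within unit_square R, continuous to_base}.
Proof.
have c01 (g : R -> R) : {within `[0, 1], continuous g} ->
    {within unit_square R, continuous (fun u => g u.1)}.
  move=> cg; apply: (@cts_comp _ _ _ _ _ fst g _ cg); first by cts.
  by move=> u /unit_squareP[]; rewrite /= in_itv.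
have c1 := c01 _ cts_offset; have c2 := c01 _ cts_abscissa; have c3 := cts_rise.
by rewrite /to_base; cts.
Qed.

Lemma cts_from_flange : {within flanged, continuous from_flange}.
Proof.
have cf : {within flanged, continuous (fun v => foot v.1)}.
  by apply: (cts_after continuous_foot); cts.
have co : {within flanged, continuous (fun v => offset (foot v.1))}.
  apply: (@cts_comp _ _ _ _ _ (fun v => foot v.1) offset cf cts_offset).
  by move=> v [/foot01]; rewrite /= in_itv.
by rewrite /from_flange; apply: cts_pair => //; apply: cts_D; last cts; apply: cts_max; first cts; apply: cts_B => //; cts.
Qed.

(* The path 0 -> l -> 0 on the flange: out along the upper sheet, back along the lower. *)
Definition fold_len (l s : R) : R := l - `|l - s|.

Definition fold_height (l s : R) : R := Num.min l s * (l - Num.min l s).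

Lemma fold_lenP l s : 0 <= s <= 2 * l -> 0 <= fold_len l s <= l /\
  (fold_height l s = 0 \/ fold_height l s = fold_len l s * (l - fold_len l s)).
Proof.
rewrite /fold_len /fold_height => /andP[s0 s1].
have [h|h] := leP l s.
  by rewrite ler0_norm ?subr_le0 //; split; [lra|left; rewrite subrr mulr0].
by rewrite gtr0_norm ?subr_gt0 // opprB addrC subrK; split; [lra|right].
Qed.

Lemma cts_fold_len (U : topologicalType) (A : set U) (l s : U -> R) :
  {within A, continuous l} -> {within A, continuous s} ->
  {within A, continuous (fun q => fold_len (l q) (s q))}.
Proof. by move=> cl cs; rewrite /fold_len; cts. Qed.

Lemma cts_fold_height (U : topologicalType) (A : set U) (l s : U -> R) :
  {within A, continuous l} -> {within A, continuous s} ->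
  {within A, continuous (fun q => fold_height (l q) (s q))}.
Proof. by move=> cl cs; rewrite /fold_height; cts. Qed.

(** * Maps between the thin snake and the doubled flanges *)

Let snake := dbl (unit_square R) sheet.
Let sine := dbl flanged flange_height.

(** A slice of the roof is run at double speed: its first half covers the upper sheet of the flange
    outwards, its second half the lower sheet back. *)
Definition to_sine (p : R * R * R) : R * R * R * R :=
  if p.2 == 0 then (to_base p.1, 0, 0)
  else (to_base p.1, fold_len (e * p.1.1) (2 * rise p.1), fold_height (e * p.1.1) (2 * rise p.1)).

(** The two sheets of a flange go to the roof over the band and to the floor under it. *)
Definition from_sine (q : R * R * R * R) : R * R * R :=
  if q.2 == 0 then (from_flange q.1, 0) else (from_flange q.1, sheet (from_flange q.1)).

Lemma snake_closed : closed [set p : R * R * R | p.2 - sheet p.1 = 0].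
Proof.
have -> : [set p : R * R * R | p.2 - sheet p.1 = 0] =
    [set p | setT p /\ p.2 - sheet p.1 = 0].
  by apply/seteqP; split => p //= [].
apply: cts_closed_zero; first exact: closedT.
by apply: cts_B; [cts|apply: (cts_after (continuous_sheet ok)); cts].
Qed.

Lemma sine_closed :
  closed [set q : R * R * R * R | sine_curve R q.1.1 /\ q.2 - flange_height q.1 = 0].
Proof.
apply: (@cts_closed_zero _ _ ((fun q : R * R * R * R => q.1.1) @^-1` sine_curve R)
  (fun q : R * R * R * R => q.2 - flange_height q.1)).
  apply: preimage_closed.
    by move=> q _; apply: continuous_comp; exact: cvg_fst.
  by apply: compact_closed; [exact: norm_hausdorff|exact: sine_curve_compact].
by apply: cts_B; [cts|apply: (cts_after continuous_flange_height); cts].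
Qed.

Lemma sheet_eq0_rise u : unit_square R u -> sheet u = 0 -> rise u = 0 \/ rise u = e * u.1.
Proof.
move=> sq h; have [[_ ->]|[h' _]|[_ ->]] := riseP sq; [by left| |by right].
have rI := rise_itv sq; have /unit_squareP[/andP[x0 x1] _] := sq.
case/(sheet_eq0P ok sq): h => [u0|[x01 [h|h]]].
- by left; move: rI; rewrite u0 mulr0 => /andP[a b]; apply/eqP; rewrite eq_le b.
- by left; case: (riseP sq) => -[h'' ->]; lra.
- by right; rewrite hi_thin in h; case: (riseP sq) => -[h'' ->]; lra.
Qed.

Lemma fold0 l : 0 <= l -> fold_len l 0 = 0 /\ fold_height l 0 = 0.
Proof.
by move=> l0; rewrite /fold_len /fold_height subr0 ger0_norm // min_r // mul0r subrr.
Qed.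

Lemma fold_end l t : 0 <= l -> 0 <= t <= 1 ->
  fold_len l ((2 - t) * l) = t * l /\ fold_height l ((2 - t) * l) = 0.
Proof.
move=> l0 /andP[t0 t1]; rewrite /fold_len /fold_height min_l; last by nra.
by rewrite subrr mulr0 ler0_norm; [split => //; ring|nra].
Qed.

Lemma cts_to_sine : {within snake, continuous to_sine}.
Proof.
have csq (W : topologicalType) (g : R * R -> W) : {within unit_square R, continuous g} ->
    {within snake, continuous (fun p => g p.1)}.
  by move=> cg; apply: (@cts_comp _ _ _ _ _ fst g _ cg); [cts|move=> p []].
have c1 := csq _ _ cts_to_base; have c2 := csq _ _ cts_rise.
apply: (@cts_glue _ _ _ _ [set p : R * R * R | p.2 - sheet p.1 = 0]).
- exact: snake_closed.
- by move=> p; exact: cvg_snd.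
- by move=> p [_ [z0|z0]]; [left|right; rewrite /= z0 subrr].
- by cts.
- have c3 : {within snake, continuous (fun p => fold_len (e * p.1.1) (2 * rise p.1))}.
    by apply: cts_fold_len; cts.
  have c4 : {within snake, continuous (fun p => fold_height (e * p.1.1) (2 * rise p.1))}.
    by apply: cts_fold_height; cts.
  by apply: (@cts_sub _ _ _ snake) => [p [] //|]; cts.
move=> p [sq _] /= h p0; move: h; rewrite p0 sub0r => /eqP; rewrite oppr_eq0 => /eqP h.
have /unit_squareP[/andP[x0 x1] _] := sq; have ex : 0 <= e * p.1.1 by rewrite mulr_ge0 // ltW.
(* Where roof and floor meet, [rise] is 0 or the full width, so the doubled path is at its start or
   its end; both have flange coordinate and height 0, as on the floor. *)
case: (sheet_eq0_rise sq h) => ->; first by rewrite mulr0; case: (fold0 ex) => -> ->.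
have := @fold_end (e * p.1.1) 0 ex; rewrite subr0 mul0r => -[|-> ->] //.
by rewrite lexx ler01.
Qed.

Lemma cts_from_sine : {within sine, continuous from_sine}.
Proof.
have c1 : {within sine, continuous (fun q => from_flange q.1)}.
  by apply: (@cts_comp _ _ _ _ _ fst _ _ cts_from_flange); [cts|move=> q []].
apply: (@cts_glue _ _ _ _ [set q : R * R * R * R | sine_curve R q.1.1 /\ q.2 - flange_height q.1 = 0]).
- exact: sine_closed.
- by move=> q; exact: cvg_snd.
- move=> q [[sq qk] [->|qh]]; first by left.
  case: qk => [k0|[qT _]]; last by right; rewrite /= qh subrr.
  by left; rewrite qh /flange_height k0 mul0r.
- by cts.
- apply: (@cts_sub _ _ _ sine) => [q [] //|]; apply: cts_pair => //.
  exact: (cts_after (continuous_sheet ok)).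
move=> [v z] [fv _] /= [vT h] z0; congr (_, _); apply/esym.
have sq := from_flange_square fv; have [sqv _] := fv.
have f01 := foot01 sqv.
move: h; rewrite z0 sub0r => /eqP; rewrite oppr_eq0 mulf_eq0 => h.
have [f0|f0] := eqVneq (foot v.1) 0; first by apply/(sheet_eq0P ok sq); left.
have vE : v.1 = curve (foot v.1).
  by case/(sine_curveP sqv): vT => // u0; move: f0; rewrite foot_eq0 // u0 eqxx.
have fp : 0 < foot v.1 <= 1 by rewrite lt_def f0.
apply/(sheet_eq0P ok sq); right; split => //.
have -> : from_flange v = (foot v.1, lo (foot v.1) + v.2).
  by rewrite -from_flange_curve // -vE -surjective_pairing.
case/orP: h => [/eqP ->|]; first by left; rewrite addr0.
by rewrite subr_eq0 => /eqP <-; right; rewrite hi_thin.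
Qed.

Lemma sheet_band u : unit_square R u -> sheet u != 0 ->
  [/\ 0 < u.1 <= 1, rise u = u.2 - lo u.1, 0 < rise u < e * u.1 & to_base u = curve u.1].
Proof.
move=> sq /(sheet_neq0 sq)[x01 /andP[h1 h2]].
have hh : lo u.1 <= u.2 <= lo u.1 + e * u.1 by rewrite !ltW.
have [rE tE] := to_base_band sq hh.
by split => //; rewrite rE; apply/andP; split; lra.
Qed.

Lemma to_sine_dbl p : snake p -> sine (to_sine p).
Proof.
move=> [sq pz]; rewrite /to_sine; case: eqP => [p0|/eqP p0].
  by split; [split; [exact: to_base_square|left]|left].
have {}pz : sheet p.1 != 0 by case: pz p0 => ->; rewrite ?eqxx.
have [x01 rE /andP[r0 r1] ->] := sheet_band sq pz.
have x01' : 0 <= p.1.1 <= 1 by case/andP: x01 => /ltW -> ->.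
have lE : len (curve p.1.1) = e * p.1.1 by rewrite /len foot_curve.
have [|fI fh] := @fold_lenP (e * p.1.1) (2 * rise p.1); first by apply/andP; split; lra.
split; last by rewrite /= /flange_height /= lE.
by split; [exact: curve_square|right; split; [exact: sine_curve_curve|rewrite lE]].
Qed.

Lemma from_sine_dbl q : sine q -> snake (from_sine q).
Proof.
move=> [fv _]; rewrite /from_sine; case: ifP => _.
  by split; [exact: from_flange_square|left].
by split; [exact: from_flange_square|right].
Qed.

(** At time t the loop is run only up to the parameter (2 - t) [rise]: at t = 0 a roof slice goes
    out over the roof and back along the floor, at t = 1 it stays on the roof. The shortened loop
    ends on the floor at t times the width, exactly where the upper edge of the band has been moved
    by then. Over the band, subtracting t [rise] cancels the motion of the floor. *)
Definition snake_track (q : R * R * R * R) : R * R * R :=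
  let u := q.1.1 in let t := q.2 in
  let w := from_flange (to_base u, 0) in
  let x := (1 - t) * w.1 + t * u.1 in let Y := (1 - t) * w.2 + t * u.2 in
  if q.1.2 == 0 then (x, Y, 0)
  else (x, Y + fold_len (e * u.1) ((2 - t) * rise u) - t * rise u,
        sheet (u.1, lo u.1 + Num.min (e * u.1) ((2 - t) * rise u))).

Lemma cts_collapse : {within unit_square R, continuous (fun u => from_flange (to_base u, 0))}.
Proof.
apply: (@cts_comp _ _ _ _ _ (fun u => (to_base u, 0)) _ _ cts_from_flange).
  by apply: cts_pair; [exact: cts_to_base|exact: cts_cst].
by move=> u /to_base_square; split => //; left.
Qed.

Lemma collapse_square u : unit_square R u -> unit_square R (from_flange (to_base u, 0)).
Proof. by move=> sq; apply: from_flange_square; split; [exact: to_base_square|left]. Qed.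

Lemma collapse_band u : unit_square R u -> sheet u != 0 ->
  from_flange (to_base u, 0) = (u.1, lo u.1).
Proof.
move=> sq h; have [/andP[x0 x1] _ _ ->] := sheet_band sq h.
by rewrite from_flange_curve ?addr0 // ltW.
Qed.

Lemma square_mix (u w : R * R) t : unit_square R u -> unit_square R w -> 0 <= t <= 1 ->
  unit_square R ((1 - t) * u.1 + t * w.1, (1 - t) * u.2 + t * w.2).
Proof.
move=> /unit_squareP[/andP[a1 a2] /andP[a3 a4]] /unit_squareP[/andP[b1 b2] /andP[b3 b4]].
by move=> /andP[t0 t1]; apply/unit_squareP; split; apply/andP; split => /=; nra.
Qed.

Lemma fold_square u t : unit_square R u -> 0 <= t <= 1 -> 0 < u.1 ->
  let k := Num.min (e * u.1) ((2 - t) * rise u) in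
  [/\ 0 <= k <= e * u.1, unit_square R (u.1, lo u.1 + k) &
      (e * u.1 <= (2 - t) * rise u \/ rise u = 0) -> sheet (u.1, lo u.1 + k) = 0].
Proof.
move=> sq /andP[t0 t1] x0 k; have /unit_squareP[/andP[_ x1] _] := sq.
have x01 : 0 <= u.1 <= 1 by rewrite ltW.
have /andP[r0 r1] := rise_itv sq; have [b1 b2 b3 b4] := bandP x01.
have s0 : 0 <= (2 - t) * rise u by rewrite mulr_ge0 //; lra.
have kI : 0 <= k <= e * u.1.
  by rewrite /k le_min s0 ge_min lexx /= andbT; lra.
have sqk : unit_square R (u.1, lo u.1 + k).
  by have /andP[k0 k1] := kI; apply/unit_squareP; split => //=; apply/andP; split; lra.
split=> // h; apply/(sheet_eq0P ok sqk); right; rewrite /= x0 x1 hi_thin; split => //.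
case: h => h; first by right; rewrite /k min_l.
by left; rewrite /k h mulr0 min_r ?addr0 //; lra.
Qed.

Lemma cts_snake_track : {within snake `*` `[0, 1], continuous snake_track}.
Proof.
pose A := snake `*` (`[0, 1]%classic : set R).
rewrite -/A.
have csq (W : topologicalType) (g : R * R -> W) : {within unit_square R, continuous g} ->
    {within A, continuous (fun q => g q.1.1)}.
  move=> cg; apply: (@cts_comp _ _ _ _ _ (fun q : R * R * R * R => q.1.1) g _ cg); first by cts.
  by move=> q [[]].
have c1 := csq _ _ cts_collapse; have c2 := csq _ _ cts_rise.
pose D := (fun q : R * R * R * R => q.1) @^-1` [set p : R * R * R | p.2 - sheet p.1 = 0].
have cc : {within A, continuous (fun q => fold_len (e * q.1.1.1) ((2 - q.2) * rise q.1.1))}.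
  by apply: cts_fold_len; cts.
have ch : {within A, continuous (fun q : R * R * R * R =>
    sheet (q.1.1.1, lo q.1.1.1 + Num.min (e * q.1.1.1) ((2 - q.2) * rise q.1.1)))}.
  (* [lo] has no limit at the left edge, so the roof term is not composed of continuous parts there;
     the bound of the height by half the abscissa replaces that. *)
  apply: (@cts_squeeze _ _ _ (fun q : R * R * R * R => q.1.1.1) _ (fun=> 0) (2^-1)).
  - apply/continuous_subspace_setT; by cts.
  - exact: cts_cst.
  - by move=> q [[/unit_squareP[/andP[]]]].
  - move=> [[u z] t] [[sq _] /itv01P t01] /=; rewrite subr0.
    have /unit_squareP[/andP[x0 x1] _] := sq.
    have [x0'|x0'] := eqVneq u.1 0.
      rewrite x0' mulr0 /sheet /= clampE ?lexx ?ler01 // height_x0 normr0 //.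
    have xp : 0 < u.1 by rewrite lt_def x0'.
    have [_ sqk _] := fold_square sq t01 xp.
    by rewrite sheetE // ger0_norm ?height_ge0 // [leRHS]mulrC; apply: (height_le ok).
  set B := _ `&` _; have BA : B `<=` A by move=> q [].
  have cl : {within B, continuous (fun q : R * R * R * R => lo q.1.1.1)}.
    apply: cts_lo; first by apply/continuous_subspace_setT; cts.
    by move=> q [[[/unit_squareP[/andP[_ ->] _] _] _] /= ->].
  have c2' := cts_sub BA c2.
  by apply: (cts_after (continuous_sheet ok)); cts.
apply: (@cts_glue _ _ _ _ D (fun q : R * R * R * R => q.1.2)).
- by apply: preimage_closed; [move=> q _; exact: cvg_fst|exact: snake_closed].
- by apply/continuous_subspace_setT; cts.
- by move=> q [[_ [z0|z0]]]; [left|right; rewrite /D /= z0 subrr].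
- by cts.
- apply: (@cts_sub _ _ _ (A)) => [q [] //|].
  have c3 : {within A, continuous (fun q => q.2 * rise q.1.1)} by cts.
  apply: cts_pair ch; apply: cts_pair; first by cts.
  by apply: cts_B; last exact: c3; apply: cts_D cc; cts.
move=> [[u z] t] [[sq _] /itv01P t01]; rewrite /D /= => h z0; move: h.
rewrite z0 sub0r => /eqP; rewrite oppr_eq0 => /eqP h.
have /unit_squareP[/andP[x0 x1] _] := sq; have ex : 0 <= e * u.1 by rewrite mulr_ge0 // ltW.
have r01 := rise_itv sq.
have end1 : rise u = 0 \/ rise u = e * u.1 := sheet_eq0_rise sq h.
have fE : fold_len (e * u.1) ((2 - t) * rise u) = t * rise u.
  by case: end1 => ->; [rewrite !mulr0; case: (fold0 ex)|case: (fold_end ex t01)].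
have hE : sheet (u.1, lo u.1 + Num.min (e * u.1) ((2 - t) * rise u)) = 0.
  have [x0'|x0'] := eqVneq u.1 0.
    by rewrite x0' /sheet /= clampE ?lexx ?ler01 // height_x0.
  have xp : 0 < u.1 by rewrite lt_def x0'.
  have [_ _] := fold_square sq t01 xp; apply; case: end1 => ->; [by right|left].
  by have /andP[t0 t1] := t01; nra.
by rewrite fE hE addrK.
Qed.

Lemma snake_track_band p t : snake p -> p.2 != 0 ->
  [/\ 0 < p.1.1 <= 1, rise p.1 = p.1.2 - lo p.1.1, 0 < rise p.1 < e * p.1.1 &
     snake_track (p, t) = (p.1.1, lo p.1.1 + fold_len (e * p.1.1) ((2 - t) * rise p.1),
       sheet (p.1.1, lo p.1.1 + Num.min (e * p.1.1) ((2 - t) * rise p.1)))].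
Proof.
move=> [sq pz] p0; have {}pz : sheet p.1 != 0 by case: pz p0 => ->; rewrite ?eqxx.
have [x01 rE r01 _] := sheet_band sq pz; split => //.
rewrite /snake_track (negbTE p0) (collapse_band sq pz) /=; congr (_, _, _); first by ring.
by rewrite rE; ring.
Qed.

Lemma to_sine_band p : snake p -> p.2 != 0 -> to_sine p =
  (curve p.1.1, fold_len (e * p.1.1) (2 * rise p.1), fold_height (e * p.1.1) (2 * rise p.1)).
Proof.
move=> [sq pz] p0; have {}pz : sheet p.1 != 0 by case: pz p0 => ->; rewrite ?eqxx.
by have [_ _ _ tE] := sheet_band sq pz; rewrite /to_sine (negbTE p0) tE.
Qed.

Lemma snake_track_dbl p t : snake p -> 0 <= t <= 1 -> snake (snake_track (p, t)).
Proof.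
move=> sp t01; have /andP[t0 t1] := t01; have [sq _] := sp.
have [p0|p0] := eqVneq p.2 0.
  by rewrite /snake_track p0 eqxx; split; [exact: square_mix (collapse_square sq) sq t01|left].
have [x01 rE /andP[r0 r1] ->] := snake_track_band t sp p0.
have [x0 x1] := andP x01.
have [kI sqk hk] := fold_square sq t01 x0.
set k := Num.min _ _ in kI sqk hk *.
have [|/andP[f0 f1] _] := @fold_lenP (e * p.1.1) ((2 - t) * rise p.1).
  by apply/andP; split; nra.
have [b1 b2 b3 b4] : [/\ 0 <= lo p.1.1, 0 <= offset p.1.1, offset p.1.1 <= e * p.1.1 &
    lo p.1.1 + e * p.1.1 <= 1] by apply: bandP; rewrite ltW.
split; first by apply/unit_squareP; split => /=; apply/andP; split; lra.
have [h|h] := leP (e * p.1.1) ((2 - t) * rise p.1); first by left; apply: hk; left.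
right => /=; rewrite /k min_r ?(ltW h) // /fold_len gtr0_norm ?subr_gt0 //.
by congr sheet; congr (_, _); ring.
Qed.

Lemma from_to_sine : track_homotopic R snake (fun _ => snake) (from_sine \o to_sine) id.
Proof.
exists snake_track; split.
- exact: cts_snake_track.
- exact: snake_track_dbl.
- move=> p sp; have [sq _] := sp; have [p0|p0] := eqVneq p.2 0.
    rewrite /snake_track p0 eqxx subr0 !mul1r !mul0r !addr0 -surjective_pairing.
    by rewrite /= /to_sine p0 eqxx /from_sine eqxx.
  have [x01 rE /andP[r0 r1] ->] := snake_track_band 0 sp p0.
  rewrite /= (to_sine_band sp p0).
  have [x0 x1] := andP x01; have x01' : 0 <= p.1.1 <= 1 by rewrite ltW.
  rewrite /from_sine /= from_flange_curve // subr0.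
  have t01 : 0 <= (0 : R) <= 1 by rewrite lexx ler01.
  have [_ _ hk] := fold_square sq t01 x0; rewrite subr0 in hk.
  move: hk; have [h|h] := leP (e * p.1.1) (2 * rise p.1) => hk.
    rewrite hk; last by left.
    by rewrite /fold_height min_l // subrr mulr0 eqxx.
  rewrite /fold_height /fold_len min_r ?(ltW h) // gtr0_norm ?subr_gt0 //.
  rewrite (_ : e * p.1.1 - (e * p.1.1 - 2 * rise p.1) = 2 * rise p.1); last by ring.
  by rewrite gt_eqF // mulr_gt0 ?subr_gt0 // mulr_gt0.
- move=> p sp; have [sq pz] := sp; have [p0|p0] := eqVneq p.2 0.
    rewrite /snake_track p0 eqxx subrr !mul0r !mul1r !add0r -surjective_pairing.
    by rewrite -p0 -surjective_pairing.
  have [x01 rE /andP[r0 r1] ->] := snake_track_band 1 sp p0.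
  have -> : (2 - 1) * rise p.1 = rise p.1 by ring.
  rewrite /fold_len gtr0_norm ?subr_gt0 // min_r ?(ltW r1) //.
  have -> : lo p.1.1 + rise p.1 = p.1.2 by rewrite rE; ring.
  have -> : lo p.1.1 + (e * p.1.1 - (e * p.1.1 - rise p.1)) = p.1.2 by rewrite rE; ring.
  rewrite -surjective_pairing; case: pz => pz; first by rewrite pz eqxx in p0.
  by rewrite -pz -surjective_pairing.
Qed.

(** The same loop seen from the flange: its lower sheet was flattened into the curve and is pulled
    out again by the factor t, its upper sheet is run up to (2 - t) times the old position. *)
Definition sine_track (r : R * R * R * R * R) : R * R * R * R :=
  let v := r.1.1 in let t := r.2 in let w := to_base (from_flange v) in
  let b := ((1 - t) * w.1 + t * v.1.1, (1 - t) * w.2 + t * v.1.2) in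
  if r.1.2 == 0 then (b, t * v.2, 0)
  else (b, fold_len (len v.1) ((2 - t) * v.2), fold_height (len v.1) ((2 - t) * v.2)).

Lemma expand_curve x k : 0 <= x <= 1 -> 0 <= k <= e * x ->
  rise (x, lo x + k) = k /\ to_base (x, lo x + k) = curve x.
Proof.
move=> x01 /andP[k0 k1]; have [b1 b2 b3 b4] := bandP x01.
have sq : unit_square R (x, lo x + k).
  by apply/unit_squareP; split => //=; apply/andP; split; lra.
have [|-> ->] := @to_base_band _ sq; first by rewrite /= lerDl k0 lerD2l.
by split => //=; ring.
Qed.

Lemma sine_curve_foot u : unit_square R u -> sine_curve R u -> foot u != 0 -> u = curve (foot u).
Proof. by move=> sq /(sine_curveP sq)[u0|//]; rewrite foot_eq0 // u0 eqxx. Qed.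

(** Over the curve the round trip moves nothing in the square, so in [sine_track] the flanges move
    only within their own slices. *)
Lemma expand_fixed v : flanged v -> sine_curve R v.1 -> to_base (from_flange v) = v.1.
Proof.
move=> fv vT; have [sq vk] := fv; have f01 := foot01 sq; have /andP[f0 f1] := f01.
have /unit_squareP[_ /andP[Y0 Y1]] := sq.
have vI : 0 <= v.2 <= e * foot v.1.
  by case: vk => [->|[]//]; rewrite lexx mulr_ge0 // ltW.
have [fE|fN] := eqVneq (foot v.1) 0.
  have v2 : v.2 = 0.
    by apply/eqP; rewrite eq_le; move: vI; rewrite fE mulr0 andbC.
  have /eqP v1 : v.1.1 == 0 by rewrite -foot_eq0 // fE.
  have -> : from_flange v = v.1.
    rewrite /from_flange fE v2 /offset lo0 zigzag0 subr0 subr0 max_r // addr0 -v1.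
    by rewrite -surjective_pairing.
  rewrite /to_base v1 /abscissa eqxx /offset lo0 zigzag0 subr0 addr0.
  have := rise_itv sq; rewrite v1 mulr0 => rI.
  have -> : rise v.1 = 0 by apply/eqP; rewrite eq_le andbC.
  by rewrite subr0 -v1 -surjective_pairing.
have vE := sine_curve_foot sq vT fN.
have -> : from_flange v = (foot v.1, lo (foot v.1) + v.2).
  by rewrite -from_flange_curve // -vE -surjective_pairing.
by case: (expand_curve f01 vI) => _ ->.
Qed.

Lemma sine_neq0 q : sine q -> q.2 != 0 ->
  [/\ sine_curve R q.1.1, 0 < foot q.1.1 <= 1, q.1.1 = curve (foot q.1.1),
      0 < q.1.2 < len q.1.1 & q.2 = flange_height q.1].
Proof.
move=> [fv qz] q0; have {}qz : q.2 = flange_height q.1 by case: qz q0 => [->|//]; rewrite eqxx.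
have := q0; rewrite qz mulf_eq0 negb_or subr_eq0 => /andP[k0 kl].
case: (flangedP fv) => [h|[f01 vE]]; first by rewrite h eqxx in k0.
move=> /andP[h1 h2]; have [f0 f1] := andP f01.
split => //; first by rewrite vE; apply: sine_curve_curve; rewrite ltW.
by rewrite !lt_def k0 kl h1.
Qed.

Lemma sine_track_dbl q t : sine q -> 0 <= t <= 1 -> sine (sine_track (q, t)).
Proof.
move=> sq t01; have /andP[t0 t1] := t01; have [fv qz] := sq; have [sqv vk] := fv.
have mixT : sine_curve R q.1.1 -> forall s : R, (((1 - s) * (to_base (from_flange q.1)).1 + s * q.1.1.1,
    (1 - s) * (to_base (from_flange q.1)).2 + s * q.1.1.2) = q.1.1).
  move=> vT s; rewrite expand_fixed // [RHS]surjective_pairing; congr (_, _); ring.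
have [q0|q0] := eqVneq q.2 0.
  rewrite /sine_track q0 eqxx; split; last by left.
  split; first exact: (square_mix (to_base_square (from_flange_square fv)) sqv t01).
  case: vk => [k0|[vT /andP[k0 k1]]]; [left|right].
    by rewrite /= k0 mulr0.
  rewrite (mixT vT t); split => //=; rewrite mulr_ge0 //=; nra.
have [vT f01 vE /andP[k0 k1] zE] := sine_neq0 sq q0.
rewrite /sine_track (negbTE q0) (mixT vT t).
have [|fI fh] := @fold_lenP (len q.1.1) ((2 - t) * q.1.2).
  by apply/andP; split; nra.
by split => //; split => //; right.
Qed.

Lemma cts_sine_track : {within sine `*` `[0, 1], continuous sine_track}.
Proof.
pose A := sine `*` (`[0, 1]%classic : set R).
rewrite -/A.
have cfl : {within A, continuous (fun r => to_base (from_flange r.1.1))}.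
  apply: (@cts_comp _ _ _ _ _ (fun r : R * R * R * R * R => from_flange r.1.1) to_base _ cts_to_base).
    apply: (@cts_comp _ _ _ _ _ (fun r : R * R * R * R * R => r.1.1) from_flange _ cts_from_flange); first by cts.
    by move=> r [[]].
  by move=> r [[/from_flange_square]].
have cl : {within A, continuous (fun r : R * R * R * R * R => len r.1.1.1)}.
  by apply: cts_len; cts.
pose D := (fun r : R * R * R * R * R => r.1) @^-1`
  [set q : R * R * R * R | sine_curve R q.1.1 /\ q.2 - flange_height q.1 = 0].
apply: (@cts_glue _ _ _ _ D (fun r : R * R * R * R * R => r.1.2)).
- by apply: preimage_closed; [move=> q _; exact: cvg_fst|exact: sine_closed].
- by apply/continuous_subspace_setT; cts.
- move=> [[v z] t] [[[sq vk] zE] _]; case: zE => /= [->|zE]; first by left.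
  case: vk => [k0|[vT _]]; last by right; rewrite /D /= zE subrr.
  by left; rewrite zE /flange_height k0 mul0r.
- by cts.
- have c3 : {within A, continuous (fun r => fold_len (len r.1.1.1) ((2 - r.2) * r.1.1.2))}.
    by apply: cts_fold_len; cts.
  have c4 : {within A, continuous (fun r => fold_height (len r.1.1.1) ((2 - r.2) * r.1.1.2))}.
    by apply: cts_fold_height; cts.
  by apply: (@cts_sub _ _ _ A) => [q [] //|]; cts.
move=> [[v z] t] [[[sq vk] _] /itv01P t01] [/= vT h] z0.
have l0 : 0 <= len v.1 by have /andP[f0 _] := foot01 sq; rewrite mulr_ge0 // ltW.
move: h; rewrite z0 sub0r => /eqP; rewrite oppr_eq0 mulf_eq0 subr_eq0 => /orP[/eqP ->|/eqP <-].
  by rewrite !mulr0; case: (fold0 l0) => -> ->.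
by case: (fold_end l0 t01) => -> ->.
Qed.

Lemma to_from_sine : track_homotopic R sine (fun _ => sine) (to_sine \o from_sine) id.
Proof.
exists sine_track; split.
- exact: cts_sine_track.
- exact: sine_track_dbl.
- move=> q sq; have [fv _] := sq; have [q0|q0] := eqVneq q.2 0.
    rewrite /sine_track q0 eqxx subr0 !mul1r !mul0r !addr0 -surjective_pairing.
    by rewrite /= /from_sine q0 eqxx /to_sine eqxx.
  have [vT f01 vE kI zE] := sine_neq0 sq q0; have [f0 f1] := andP f01.
  have f01' : 0 <= foot q.1.1 <= 1 by rewrite ltW.
  have fE : from_flange q.1 = (foot q.1.1, lo (foot q.1.1) + q.1.2).
    by rewrite -from_flange_curve // -vE -surjective_pairing.
  have [|rE tE] := @expand_curve (foot q.1.1) q.1.2 f01'.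
    by case/andP: kI => k0 k1; rewrite !ltW.
  have s0 : sheet (from_flange q.1) != 0.
    apply/(sheet_neq0 (from_flange_square fv)); rewrite fE /=; split => //.
    by case/andP: kI => k0 k1; rewrite ltrDl k0 ltrD2l.
  rewrite /sine_track (negbTE q0) subr0 !mul1r !mul0r !addr0 -surjective_pairing.
  have -> : (to_sine \o from_sine) q = to_sine (from_flange q.1, sheet (from_flange q.1)).
    by rewrite /= /from_sine (negbTE q0).
  rewrite /to_sine [X in _ = if X then _ else _](negbTE s0).
  by rewrite [(_, sheet _).1]/= fE rE [(q, 0).1.1.1]/= [(q, 0).2]/= [(q, 0).1.1.2]/= subr0.
- move=> q sq; have [fv _] := sq; have [q0|q0] := eqVneq q.2 0.
    rewrite /sine_track q0 eqxx subrr !mul0r !mul1r !add0r.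
    by rewrite -surjective_pairing -surjective_pairing -q0 -surjective_pairing.
  have [vT f01 vE /andP[k0 k1] zE] := sine_neq0 sq q0.
  rewrite /sine_track (negbTE q0) subrr !mul0r !mul1r !add0r -surjective_pairing.
  have -> : (2 - 1) * q.1.2 = q.1.2 by ring.
  rewrite /fold_len /fold_height gtr0_norm ?subr_gt0 // min_r ?(ltW k1) //.
  rewrite (_ : len q.1.1 - (len q.1.1 - q.1.2) = q.1.2); last by ring.
  rewrite -/(flange_height q.1) -zE.
  by rewrite -surjective_pairing -surjective_pairing.
Qed.

Lemma snake_sine : set_homotopy_equivalent R
  (dbl (unit_square R) sheet) (dbl flanged flange_height).
Proof.
exists to_sine, from_sine; split.
- exact: cts_to_sine.
- exact: cts_from_sine.
- exact: to_sine_dbl.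
- exact: from_sine_dbl.
- by split; [exact: from_to_sine|exact: to_from_sine].
Qed.

End snake_sine.

(** * Embedding of the space of circles along the sine curve *)

Section SC_model.
Context {R : realType} (e : R) (s0 : circle R).
Hypotheses (e0 : 0 < e) (e1 : e <= 1).
Implicit Types (t : sine_curve R) (s : circle R).
Local Open Scope quotient_scope.

Let p0 : R * R := \val s0.

Lemma circle_val s : (\val s).1 ^+ 2 + (\val s).2 ^+ 2 = 1 :> R.
Proof. exact: (set_valP s). Qed.

(** With [sine_of], the coordinates after the rotation that takes [s0] to (1, 0); this is how an
    arbitrary base point is handled. *)
Definition cosine s : R := (\val s).1 * p0.1 + (\val s).2 * p0.2.
Definition sine_of s : R := p0.1 * (\val s).2 - p0.2 * (\val s).1.

Lemma cos2_sin2 s : cosine s ^+ 2 + sine_of s ^+ 2 = 1.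
Proof.
have h := circle_val s; have h0 := circle_val s0; rewrite -/p0 in h0.
by rewrite -[RHS](mulr1 1) -{1}h -h0 /cosine /sine_of; ring.
Qed.

Lemma cosine_base : cosine s0 = 1.
Proof. by rewrite /cosine -/p0 -!expr2; exact: circle_val. Qed.

Lemma sine_base : sine_of s0 = 0.
Proof. by rewrite /sine_of -/p0; ring. Qed.

Lemma circle_rebuild s : \val s =
  (cosine s * p0.1 - sine_of s * p0.2, cosine s * p0.2 + sine_of s * p0.1).
Proof.
have h0 := circle_val s0; rewrite -/p0 in h0.
rewrite [LHS]surjective_pairing; congr (_, _).
  by rewrite -[LHS]mulr1 -h0 /cosine /sine_of; ring.
by rewrite -[LHS]mulr1 -h0 /cosine /sine_of; ring.
Qed.

Lemma circle_with (c d : R) : c ^+ 2 + d ^+ 2 = 1 ->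
  exists s, cosine s = c /\ sine_of s = d.
Proof.
move=> cd; have h0 := circle_val s0; rewrite -/p0 in h0.
have hs : circle R (c * p0.1 - d * p0.2, c * p0.2 + d * p0.1).
  by rewrite /circle /= -[RHS](mulr1 1) -{1}cd -h0; ring.
exists (Sub_in hs); rewrite /cosine /sine_of /=.
by split; [rewrite -[RHS]mulr1|rewrite -[RHS]mulr1]; rewrite -h0; ring.
Qed.

(** The circle is projected to a diameter of length l: with k = l (1 - cos)/2 one has k (l - k) = (l
    sin / 2)^2, the height of the flange. The half circle with negative sine is the upper sheet. *)
Definition tube_coord (p : sine_curve R * circle R) : R * R * R * R :=
  (\val p.1, len e (\val p.1) * (1 - cosine p.2) / 2,
   (len e (\val p.1) * Num.min 0 (sine_of p.2) / 2) ^+ 2).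

Definition square_coord (u : unit_square R) : R * R * R * R := (\val u, 0, 0).

Definition summand_coord (b : bool) : SC_summand R b -> R * R * R * R :=
  match b with true => square_coord | false => tube_coord end.

Definition sum_coord : SC_sum R -> R * R * R * R := unstable.sigT_fun summand_coord.

Lemma continuous_square_coord : continuous square_coord.
Proof.
apply/continuous_subspace_setT.
have cu : {within setT, continuous (fun u : unit_square R => \val u : R * R)}.
  by apply: (@cts_after _ _ _ _ (fun u => u) (@set_val _ (unit_square R))); [exact: initial_continuous|cts].
by rewrite /square_coord; cts.
Qed.

Lemma continuous_tube_coord : continuous tube_coord.
Proof.
apply/continuous_subspace_setT.
have ct : {within setT, continuous (fun p : sine_curve R * circle R => \val p.1 : R * R)}.
  by apply: (@cts_after _ _ _ _ fst (@set_val _ (sine_curve R))); [exact: initial_continuous|cts].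
have cs : {within setT, continuous (fun p : sine_curve R * circle R => \val p.2 : R * R)}.
  by apply: (@cts_after _ _ _ _ snd (@set_val _ (circle R))); [exact: initial_continuous|cts].
have cl : {within setT, continuous (fun p : sine_curve R * circle R => len e (\val p.1))}.
  exact: cts_len.
by rewrite /tube_coord /cosine /sine_of; cts.
Qed.

Lemma continuous_sum_coord : continuous sum_coord.
Proof.
by apply: sigT_continuous => -[]; [exact: continuous_square_coord|exact: continuous_tube_coord].
Qed.

Lemma tube_square (t : sine_curve R) : unit_square R (\val t).
Proof. exact/sine_curve_square/set_valP. Qed.

Lemma len_edge (u : R * R) : u.1 = 0 -> len e u = 0.
Proof. by move=> u0; rewrite /len /foot u0 mul0r clampE ?lexx ?ler01 // arrival0 mulr0. Qed.

Lemma len_eq0 (u : R * R) : unit_square R u -> len e u = 0 -> u.1 = 0.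
Proof.
move=> sq /eqP; rewrite mulf_eq0 (gt_eqF e0) foot_eq0 //= => /eqP; exact.
Qed.

Lemma sum_coord_identify x x' : SC_identify s0 x x' -> sum_coord x = sum_coord x'.
Proof.
case=> [u t ut|u t s [/= t0 _] ut]; rewrite /sum_coord /unstable.sigT_fun /= /tube_coord /square_coord /=.
  by rewrite cosine_base sine_base subrr minxx !mulr0 !mul0r expr0n ut.
by rewrite (len_edge t0) !mul0r expr0n ut.
Qed.

Definition SC_map : SC s0 -> R * R * R * R := sum_coord \o repr.

Lemma continuous_SC_map : continuous SC_map.
Proof. by have [] := quotient_by_lift sum_coord_identify continuous_sum_coord. Qed.

Definition SC_pt x : SC s0 := \pi_(SC s0) x.

Lemma SC_mapE x : SC_map (SC_pt x) = sum_coord x.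
Proof. by have [_ h] := quotient_by_lift sum_coord_identify continuous_sum_coord; exact: h. Qed.

Lemma SC_compact : compact [set: SC s0].
Proof.
apply: quotient_by_compact; apply: sigT_compact; first exact: finite_finset.
case.
  by apply: compact_set_type; apply: compact_setX; exact: segment_compact.
rewrite /SC_summand -setXTT; apply: compact_setX; apply: compact_set_type.
  exact: sine_curve_compact.
exact: circle_compact.
Qed.

(** Tubes over the left edge and base points of circles are already in the square. What is left has
    a nonzero flange coordinate, which separates the two cases in the proof of injectivity. *)
Lemma SC_ptP (x : SC s0) : (exists u, x = SC_pt (SC_square u)) \/
  exists t s, x = SC_pt (SC_tube (t, s)) /\ (len e (\val t) != 0 /\ s != s0).
Proof.
rewrite -[x]reprK -/(SC_pt _); case: (repr x) => -[u|[t s]]; first by left; exists u.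
have [l0|l0] := eqVneq (len e (\val t)) 0.
  left; exists (Sub_in (tube_square t)).
  apply: quotient_by_pi; apply/asboolP; apply: rst_step; apply: SC_collapse => //.
  by split; [exact: len_eq0 (tube_square t) l0|case: (tube_square t)].
have [->|ss] := eqVneq s s0; last by right; exists t, s.
left; exists (Sub_in (tube_square t)).
by apply: quotient_by_pi; apply/asboolP; apply: rst_step; exact: SC_base.
Qed.

Lemma cosine_lt1 s : s != s0 -> cosine s != 1.
Proof.
apply: contraNneq => c1; apply/eqP/val_inj.
have := cos2_sin2 s; rewrite c1 expr1n => /eqP; rewrite -subr_eq0 addrAC subrr add0r.
rewrite sqrf_eq0 => /eqP d0; rewrite [LHS]circle_rebuild c1 d0 !mul0r !mul1r subr0 addr0.
by rewrite -surjective_pairing.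
Qed.

Lemma tube_flange_neq0 (t : sine_curve R) s : len e (\val t) != 0 -> s != s0 ->
  len e (\val t) * (1 - cosine s) / 2 != 0.
Proof.
move=> l0 /cosine_lt1 c1; apply: mulf_neq0; last by rewrite invr_eq0 pnatr_eq0.
by apply: mulf_neq0 => //; rewrite subr_eq0 eq_sym.
Qed.

Lemma SC_map_inj : injective SC_map.
Proof.
move=> x x'.
case: (SC_ptP x) => [[u ->]|[t [s [-> [l0 ss]]]]]; case: (SC_ptP x') => [[u' ->]|[t' [s' [-> [l0' ss']]]]];
  rewrite !SC_mapE /sum_coord /unstable.sigT_fun /= /square_coord /tube_coord /=.
- by case=> uu; congr (SC_pt (SC_square _)); exact: val_inj.
- by case=> _ /esym/eqP; rewrite (negbTE (tube_flange_neq0 l0' ss')).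
- by case=> _ /eqP; rewrite (negbTE (tube_flange_neq0 l0 ss)).
case=> tt; rewrite -tt; move: (len e _) l0 => l l0 cc dd.
have {}cc : cosine s = cosine s'.
  by move: cc; rewrite -!mulrA => /(mulfI l0); lra.
have {}dd : Num.min 0 (sine_of s) ^+ 2 = Num.min 0 (sine_of s') ^+ 2.
  have l2 : (l / 2) ^+ 2 != 0 by rewrite expf_neq0 // mulf_neq0 // invr_eq0 pnatr_eq0.
  by apply: (mulfI l2); rewrite -!exprMn ![l / 2 * _]mulrAC.
have d2 : sine_of s ^+ 2 = sine_of s' ^+ 2.
  by have := cos2_sin2 s; rewrite -(cos2_sin2 s') cc => /addrI.
congr (SC_pt (SC_tube (_, _))); first exact: val_inj.
apply: val_inj; rewrite [LHS]circle_rebuild [RHS]circle_rebuild cc.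
suff -> : sine_of s = sine_of s' by [].
move: dd d2; case: (leP 0 (sine_of s)) => h; case: (leP 0 (sine_of s')) => h' h1 h2.
- by apply/eqP; rewrite -(@eqrXn2 _ 2) // h2.
- by move: h1 h'; rewrite expr0n /= => h1; have := sqr_ge0 (sine_of s'); nra.
- by move: h1 h; rewrite expr0n /= => h1; nra.
- by apply: oppr_inj; apply/eqP; rewrite -(@eqrXn2 _ 2) ?oppr_ge0 ?ltW // !sqrrN h2.
Qed.

Lemma SC_map_range : range SC_map = dbl (flanged e) (flange_height e).
Proof.
apply/seteqP; split.
  move=> _ [x _ <-]; case: (SC_ptP x) => [[u ->]|[t [s [-> _]]]];
    rewrite SC_mapE /sum_coord /unstable.sigT_fun /= /square_coord /tube_coord.
    by split; [split; [exact: set_valP|left]|left].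
  have sq := tube_square t; have l0 : 0 <= len e (\val t).
    by have /andP[f0 _] := foot01 sq; rewrite mulr_ge0 // ltW.
  have cd := cos2_sin2 s; have d2 := sqr_ge0 (sine_of s).
  have [c1 c2] : -1 <= cosine s /\ cosine s <= 1 by split; nra.
  split; [split => //=; right; split; [exact: set_valP|]|].
    move: (len e _) l0 (cosine s) c1 c2 => l l0 c c1 c2.
    by rewrite -mulrA; apply/andP; split; [apply: mulr_ge0 => //; lra|rewrite ler_piMr //; lra].
  have [h|h] := leP 0 (sine_of s); rewrite /= /flange_height /=.
    by left; rewrite mulr0 mul0r expr0n.
  right; move: (len e _) => l; rewrite !exprMn.
  have -> : sine_of s ^+ 2 = 1 - cosine s ^+ 2 by rewrite -cd; ring.
  by field.
move=> [[u k] z] [[/= sq vk] zE].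
have [k0|kN] := eqVneq k 0.
  have -> : z = 0 by case: zE => // ->; rewrite k0 /flange_height mul0r.
  exists (SC_pt (SC_square (Sub_in sq))) => //.
  by rewrite SC_mapE /sum_coord /unstable.sigT_fun /= /square_coord /= k0.
case: vk => [/eqP|[uT /andP[k1 k2]]]; first by rewrite (negbTE kN).
have l0 : 0 < len e u by apply: lt_le_trans k2; rewrite lt_def kN.
(* Solves k = l (1 - cos)/2 for the cosine; the sign of the sine is then chosen by the sheet. *)
pose c := 1 - 2 * (k / len e u).
have kl : 0 <= k / len e u <= 1 by rewrite divr_ge0 ?(ltW l0) //= ler_pdivrMr // mul1r.
have cc : 0 <= 1 - c ^+ 2 by rewrite /c; nra.
have [s [sc sd]] : exists s, cosine s = c /\
    sine_of s = (if z == 0 then 1 else -1) * Num.sqrt (1 - c ^+ 2).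
  by apply: circle_with; rewrite exprMn sqr_sqrtr //; case: ifP => _; ring.
exists (SC_pt (SC_tube (Sub_in uT, s))) => //.
rewrite SC_mapE /sum_coord /unstable.sigT_fun /= /tube_coord /= sc sd.
congr (_, _, _); first by rewrite /c; field; rewrite gt_eqF.
case: eqP => z0.
  by rewrite mul1r min_l ?sqrtr_ge0 // mulr0 mul0r expr0n z0.
rewrite min_r; last by rewrite mulN1r oppr_le0 sqrtr_ge0.
have sq2 (l S : R) : (l * (-1 * S) / 2) ^+ 2 = (l / 2) ^+ 2 * S ^+ 2 by field.
case: zE => // ->; rewrite sq2 sqr_sqrtr // /flange_height /= /c.
by field; rewrite gt_eqF.
Qed.

End SC_model.

Lemma snake_SC (R : realType) (e : R) (s0 : circle R) : 0 < e -> e <= 1 ->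
  homotopy_equivalent R (snake_space R 0 e) (SC s0).
Proof.
move=> e0 e1; rewrite /snake_space (snake_setE (admissible0 e0 e1)).
apply: (homotopy_equivalent_image (snake_sine e0 e1)).
- exact: SC_compact.
- exact: norm_hausdorff.
- exact: continuous_SC_map.
- exact: SC_map_inj.
- exact: SC_map_range.
Qed.

Theorem theorem4p3 (R : realType) (y e : R) (s0 : circle R)
    (hy : 0 <= y <= 1) (he : 0 <= e) (hye : 0 < y + e <= 1) :
  [/\ 2^-1 < y <= 1 ->
        contractible R (snake_space R 1 0) /\ contractible R (snake_space R y e),
      y = 0 -> homotopy_equivalent R (snake_space R y e) (SC s0) &
      0 < y <= 2^-1 ->
        homotopy_equivalent R (snake_space R y e) (griffiths R)].
Proof.
have [[y0 _] [ye0 ye1]] := (andP hy, andP hye).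
have ok : admissible y e by [].
split=> [/andP[y2 _]|y00|/andP[yp y2]].
- split; last exact: snake_contractible ok y2.
  apply: snake_contractible; first by split; rewrite ?addr0.
  by rewrite invf_lt1 ?ltr1n.
- by subst y; rewrite add0r in ye0 ye1; exact: snake_SC.
- exact: snake_griffiths.
Qed.
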